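(* Let $k>n$ be positive integers and let $E\subset\mathbb{R}^k$ be a (Lebesgue) measurable set. If $f\colon E\to\mathbb{H}^n$ is locally Lipschitz (with respect to the Euclidean metric on $E$ and the Carnot–Carathéodory metric $d_{cc}$ on $\mathbb{H}^n$), then for $\mathcal{H}^k$-almost every point $x\in E$, $$\mathrm{rank}\,\operatorname{ap}df_x\le n.$$
   Context: The Heisenberg group $\mathbb{H}^n$ is $\mathbb{C}^n\times\mathbb{R}=\mathbb{R}^{2n+1}$, with points $(z,t)=(x_1,y_1,\ldots,x_n,y_n,t)$, $z_j=x_j+iy_j$, and group law $(z,t)*(z',t')=\left(z+z',\,t+t'+2\,\mathrm{Im}\sum_{j=1}^n z_j\overline{z_j'}\right)$. The left-invariant horizontal vector fields are $X_j=\frac{\partial}{\partial x_j}+2y_j\frac{\partial}{\partial t}$, $Y_j=\frac{\partial}{\partial y_j}-2x_j\frac{\partial}{\partial t}$ ($j=1,\ldots,n$). The horizontal space at $p$ is $H_p\mathbb{H}^n=\mathrm{span}\{X_1(p),\ldots,X_n(p),Y_1(p),\ldots,Y_n(p)\}$, equipped with the inner product making these $2n$ vectors orthonormal. An absolutely continuous curve $\gamma\colon[a,b]\to\mathbb{R}^{2n+1}$ is horizontal if $\gamma'(s)\in H_{\gamma(s)}\mathbb{H}^n$ for almost every $s$; its length is the integral of the norm of $\gamma'$ with respect to this inner product. The Carnot–Carathéodory metric $d_{cc}(p,q)$ is the infimum of lengths of horizontal curves joining $p$ to $q$. $\mathbb{H}^n$ is always regarded as the metric space $(\mathbb{H}^n,d_{cc})$.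 $\mathcal{H}^k$ is the Hausdorff (Lebesgue) measure on $\mathbb{R}^k$. A function $f\colon E\to\mathbb{R}$ is approximately differentiable at almost every point of $E$ if for every $\varepsilon>0$ there are a set $K\subset E$ with $\mathcal{H}^k(E\setminus K)<\varepsilon$ and $g\in C^1(\mathbb{R}^k)$ that agrees with $f$ on $K$; at an $\mathcal{H}^k$-density point $x$ of $K$ the approximate derivative is $\operatorname{ap}df_x=dg_x$ (independent of the choice of $g$ and $K$). For maps into $\mathbb{R}^m$ this is understood componentwise. A locally Lipschitz map $f\colon E\to\mathbb{H}^n$ is locally Lipschitz as a map into the Euclidean space $\mathbb{R}^{2n+1}$, hence approximately differentiable a.e. in $E$, and $\operatorname{ap}df_x\colon\mathbb{R}^k\to\mathbb{R}^{2n+1}$ is taken in this sense. *)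

(* Defs.v *)
From HB Require Import structures.
From mathcomp Require Import all_boot all_order all_algebra.
From mathcomp Require Import all_classical all_reals all_analysis.

Set Implicit Arguments.
Unset Strict Implicit.
Unset Printing Implicit Defensive.

Import Order.TTheory GRing.Theory Num.Theory.
Import numFieldNormedType.Exports.

Local Open Scope classical_set_scope.
Local Open Scope ring_scope.

(* The norm that MathComp-Analysis puts on ['rV[R]_m] is the sup norm (same
   topology), so the Euclidean norm is defined here. *)
Definition enorm (R : realType) (m : nat) (v : 'rV[R]_m) : R :=
  Num.sqrt (\sum_(i < m) v 0 i ^+ 2).

Definition eball (R : realType) (m : nat) (x : 'rV[R]_m) (r : R) :
    set 'rV[R]_m :=
  [set y | enorm (y - x) < r].

Definition box (R : realType) (k : nat) (a b : 'rV[R]_k) : set 'rV[R]_k :=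
  [set x | forall j, a 0 j <= x 0 j < b 0 j].

Definition box_volume (R : realType) (k : nat) (a b : 'rV[R]_k) : R :=
  \prod_(j < k) (b 0 j - a 0 j).

(* The k-dimensional Lebesgue outer measure; it equals the Hausdorff measure
   H^k on R^k.  Null sets are the sets of outer measure 0, and Lebesgue
   measurability is Caratheodory's condition [caratheodory_measurable]. *)
Definition lebesgue_outer (R : realType) (k : nat) (A : set 'rV[R]_k) :
    \bar R :=
  ereal_inf [set l | exists a b : nat -> 'rV[R]_k,
    [/\ forall i j, a i 0 j <= b i 0 j,
        A `<=` \bigcup_i box (a i) (b i) &
        l = (\sum_(0 <= i <oo) (box_volume (a i) (b i))%:E)%E]].

Definition density_point (R : realType) (k : nat) (K : set 'rV[R]_k)
    (x : 'rV[R]_k) : Prop :=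
  fine (lebesgue_outer (K `&` eball x r)) / fine (lebesgue_outer (eball x r))
    @[r --> 0^'+] --> (1 : R).

Definition C1 (R : realType) (k : nat) (g : 'rV[R]_k -> R) : Prop :=
  (forall x, differentiable g x) /\
  (forall v, continuous (fun x => 'd g x v)).

(* [l] is the approximate derivative at x of the function f on E; the values
   of f outside E are irrelevant. *)
Definition ap_differential (R : realType) (k : nat) (E : set 'rV[R]_k)
    (f : 'rV[R]_k -> R) (x : 'rV[R]_k) (l : 'rV[R]_k -> R) : Prop :=
  exists (K : set 'rV[R]_k) (g : 'rV[R]_k -> R),
    [/\ K `<=` E, caratheodory_measurable (@lebesgue_outer R k) K, C1 g,
        (forall y, K y -> f y = g y) &
        density_point K x /\ (forall v, 'd g x v = l v)].

(* The matrix A represents the linear map v |-> v *m A, as for [jacobian]. *)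
Definition ap_jacobian (R : realType) (k m : nat) (E : set 'rV[R]_k)
    (f : 'rV[R]_k -> 'rV[R]_m) (x : 'rV[R]_k) (A : 'M[R]_(k, m)) : Prop :=
  forall i : 'I_m,
    ap_differential E (fun y => f y 0 i) x (fun v => (v *m A) 0 i).

(* The point (x_1, y_1, ..., x_n, y_n, t) of H^n is a row vector of length
   2n+1; with j counted from 0, x_j, y_j and t have indices 2j, 2j+1, 2n. *)
Definition x_idx (n : nat) (j : 'I_n) : 'I_(n.*2.+1) := inord j.*2.
Definition y_idx (n : nat) (j : 'I_n) : 'I_(n.*2.+1) := inord j.*2.+1.
Definition t_idx (n : nat) : 'I_(n.*2.+1) := ord_max.

Definition fieldX (R : realType) (n : nat) (j : 'I_n)
    (p : 'rV[R]_(n.*2.+1)) : 'rV[R]_(n.*2.+1) :=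
  delta_mx 0 (x_idx j) + (2 * p 0 (y_idx j)) *: delta_mx 0 (t_idx n).

Definition fieldY (R : realType) (n : nat) (j : 'I_n)
    (p : 'rV[R]_(n.*2.+1)) : 'rV[R]_(n.*2.+1) :=
  delta_mx 0 (y_idx j) - (2 * p 0 (x_idx j)) *: delta_mx 0 (t_idx n).

(* The horizontal space at p is the row space of this matrix. *)
Definition hframe (R : realType) (n : nat) (p : 'rV[R]_(n.*2.+1)) :
    'M[R]_(n + n, n.*2.+1) :=
  col_mx (\matrix_(j < n) fieldX j p) (\matrix_(j < n) fieldY j p).

(* The rows of [hframe p] are linearly independent, so for a horizontal v the
   vector [v *m pinvmx (hframe p)] is the unique family of coefficients of v in
   them; its Euclidean norm is the norm that makes these rows orthonormal. *)
Definition hnorm (R : realType) (n : nat) (p v : 'rV[R]_(n.*2.+1)) : R :=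
  enorm (v *m pinvmx (hframe p)).

Definition abs_continuous (R : realType) (m : nat) (a b : R)
    (gamma : R -> 'rV[R]_m) : Prop :=
  forall e : R, 0 < e -> exists2 d : R, 0 < d &
    forall (N : nat) (s t : 'I_N -> R),
      (forall i, [/\ a <= s i, s i <= t i & t i <= b]) ->
      trivIset setT (fun i => `]s i, t i[%classic) ->
      \sum_(i < N) (t i - s i) < d ->
      \sum_(i < N) enorm (gamma (t i) - gamma (s i)) < e.

Definition horizontal_curve (R : realType) (n : nat) (a b : R)
    (gamma : R -> 'rV[R]_(n.*2.+1)) : Prop :=
  abs_continuous a b gamma /\
  {ae @lebesgue_measure R, forall s, `[a, b]%classic s ->
    derivable gamma s 1 /\ (derive1 gamma s <= hframe (gamma s))%MS}.

Definition hlength_curve (R : realType) (n : nat) (a b : R)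
    (gamma : R -> 'rV[R]_(n.*2.+1)) : \bar R :=
  (\int[@lebesgue_measure R]_(s in `[a, b]) 
      (hnorm (gamma s) (derive1 gamma s))%:E)%E.

Definition d_cc (R : realType) (n : nat) (p q : 'rV[R]_(n.*2.+1)) : \bar R :=
  ereal_inf [set l | exists (a b : R) (gamma : R -> 'rV[R]_(n.*2.+1)),
    [/\ a < b, horizontal_curve a b gamma, gamma a = p, gamma b = q &
        l = hlength_curve a b gamma]].

(* Only the values of f on E matter. *)
Definition locally_lipschitz_cc (R : realType) (k n : nat) (E : set 'rV[R]_k)
    (f : 'rV[R]_k -> 'rV[R]_(n.*2.+1)) : Prop :=
  forall x, E x -> exists r L : R, 0 < r /\
    forall y z, E y -> E z -> eball x r y -> eball x r z ->
      (d_cc (f y) (f z) <= (L * enorm (y - z))%:E)%E.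

(* Main.v *)
(* Along a horizontal curve dt = 2 sum_j (y_j dx_j - x_j dy_j), so two points at
   distance D satisfy |theta_p (q - p)| <= 4 n D^2, where theta is the contact
   form.  Let x be a common density point of the sets on which the coordinates of
   f agree with C^1 functions.  Along small polygonal loops through points of
   these sets near x, rescaled by m, the terms m^2 theta_{f z}(f z' - f z)
   telescope up to twice the symplectic area of the image loop under A, while
   their sum is O(sum |w_{i+1} - w_i|^2), which tends to 0 as the loop is
   subdivided.  Hence the row space of A is isotropic for the symplectic form and
   lies in the kernel of theta, so its dimension is at most n.

   For the existence of A, f is locally Euclidean Lipschitz.  Rademacher's theorem
   and the Lebesgue density theorem show that on small cubes a Lipschitz F is
   close to affine; a smooth tensor-spline quasi-interpolant of F is then C^1 and
   its difference with F has a small Lipschitz constant on most of a cube.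
   Extending this difference by McShane's formula and iterating yields a C^1
   function equal to F off a set of small measure. *)

From HB Require Import structures.
Require Import Defs.
From mathcomp Require Import all_boot all_order all_algebra.
From mathcomp Require Import all_classical all_reals all_analysis.
From mathcomp Require Import measurable_realfun perm ring lra.

Set Implicit Arguments.
Unset Strict Implicit.
Unset Printing Implicit Defensive.

Import Order.TTheory GRing.Theory Num.Theory.
Import numFieldNormedType.Exports.

Local Open Scope classical_set_scope.
Local Open Scope ring_scope.

(** * Lebesgue outer measure on Borel sets *)

(** [E] contains no curves, so [f] cannot be restricted to paths, and no differentiability of [f] in
    the group sense is invoked. Only pairs of points of a set with density 1 at x are compared: near
    x such a set comes within o(1/m) of x + w/m for every w, which is enough for a blow-up. The
    contact estimate and the symplectic area are both of order two, so both survive the rescaling by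
    m^2. Subdivision separates them: cutting a segment into N pieces divides the quadratic error by
    N and leaves the area unchanged. The kernel condition comes from a spare factor m: if p is the
    value at x of the C^1 map and xi = m (f z - p), the differences of m theta(xi) tend to 0 while
    xi tends to wA, so theta(wA) = 0. The integrand of the length of a curve is not known to be
    measurable. Hence the bound of an increment by an integral is proved for an arbitrary
    nonnegative majorant of the derivative, by sorting points into layers according to slope. *)

Section LebesgueOuter.
Context (R : realType).

Definition box_cover (k : nat) (A : set 'rV[R]_k) (a b : nat -> 'rV[R]_k) :=
  (forall i j, a i 0 j <= b i 0 j) /\ A `<=` \bigcup_i box (a i) (b i).

Lemma box_volume_ge0 k (a b : 'rV[R]_k) :
  (forall j, a 0 j <= b 0 j) -> 0 <= box_volume a b.
Proof. by move=> ab; apply: prodr_ge0 => j _; rewrite subr_ge0. Qed.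

Lemma lebesgue_outer_le k (A : set 'rV[R]_k) a b : box_cover A a b ->
  (lebesgue_outer A <= \sum_(0 <= i <oo) (box_volume (a i) (b i))%:E)%E.
Proof. by case=> ab Aab; apply: ereal_inf_lbound; exists a, b. Qed.

Lemma lebesgue_outer_ge0 k (A : set 'rV[R]_k) : (0 <= lebesgue_outer A)%E.
Proof.
apply: le_ereal_inf_tmp => x [a [b [ab _ ->]]].
by apply: nneseries_ge0 => n _ _; rewrite lee_fin box_volume_ge0.
Qed.

Lemma lebesgue_outer_adherent k (A : set 'rV[R]_k) (e : R) :
  0 < e -> lebesgue_outer A \is a fin_num ->
  exists a b, box_cover A a b /\
  (\sum_(0 <= i <oo) (box_volume (a i) (b i))%:E <= lebesgue_outer A + e%:E)%E.
Proof.
move=> e0 fA; have [_ [a [b [ab Aab ->]]] le] := lb_ereal_inf_adherent e0 fA.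
by exists a, b; split => //; exact: ltW.
Qed.

(** The boxes are enumerated along a bijection of [nat] with [nat * nat]; the volumes being
    nonnegative, the sum in that order is an unordered sum and can be regrouped by rows. *)
Lemma lebesgue_outer_le_esum k (A : set 'rV[R]_k)
    (a b : nat -> nat -> 'rV[R]_k) :
  (forall n i j, a n i 0 j <= b n i 0 j) ->
  A `<=` \bigcup_n \bigcup_i box (a n i) (b n i) ->
  (lebesgue_outer A <=
   \sum_(0 <= n <oo) \sum_(0 <= i <oo) (box_volume (a n i) (b n i))%:E)%E.
Proof.
move=> ab Aab.
pose v (p : nat * nat) := (box_volume (a p.1 p.2) (b p.1 p.2))%:E.
have v0 p : (0 <= v p)%E by rewrite lee_fin box_volume_ge0.
apply: (@le_trans _ _ (\esum_(i in setT) v i)%E).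
  have /card_esym/ppcard_eqP[f] := card_nat2.
  have := @lebesgue_outer_le _ A (fun i => a (f i).1 (f i).2)
    (fun i => b (f i).1 (f i).2).
  move=> /(_ _)/le_trans; apply.
    split=> // t /Aab[n _ [i _ tni]].
    by exists (f^-1%FUN (n, i)) => //=; rewrite invK ?inE.
  by rewrite -(esum_pred_image v f xpredT) ?[fun=> _]set_true// image_eq.
rewrite (_ : esum _ _ = \sum_(0 <= i <oo) \sum_(0 <= j <oo) v (i, j))%E //.
pose J : nat -> set (nat * nat) := fun i => [set (i, j) | j in setT].
rewrite (_ : setT = \bigcup_k J k); last first.
  by rewrite predeqE => -[x y]; split => // _; exists x => //; exists y.
rewrite esum_bigcupT /=; last 2 first.
  - apply/trivIsetP => i j _ _ ij.
    rewrite predeqE => -[n m] /=; split => //= -[] [_] _ [<-{n} _].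
    by move=> [m' _] [] /esym/eqP; rewrite (negbTE ij).
  - by move=> p; exact: v0.
rewrite -(image_id [set: nat]) -fun_true esum_pred_image//; last first.
  by move=> n _; exact: esum_ge0.
apply: eq_eseriesr => /= j _.
rewrite -(esum_pred_image v (pair j) predT)//=; last first.
  by move=> ? ? _ _; exact: (@can_inj _ _ _ snd).
by congr esum; rewrite predeqE => -[x y]; split; move=> [i _ <-]; exists i.
Qed.

Lemma lebesgue_outer_subadd k (A : set 'rV[R]_k) (F : (set 'rV[R]_k)^nat) :
  subset_sigma_subadditive (@lebesgue_outer R k) A F.
Proof.
move=> AF; have [[i ioo]|] := pselect (exists i, lebesgue_outer (F i) = +oo%E).
  rewrite (eseries_pinfty _ _ ioo) ?leey// => n _.
  by rewrite -ltNye (lt_le_trans _ (lebesgue_outer_ge0 _)).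
rewrite -forallNE => Foo.
have Ffin i : lebesgue_outer (F i) \is a fin_num.
  by rewrite ge0_fin_numE ?lebesgue_outer_ge0// ltey; apply/eqP/Foo.
apply/lee_addgt0Pr => e e0.
rewrite (le_trans _ (epsilon_trick _ _ (ltW e0)))//; last first.
  by move=> n; exact: lebesgue_outer_ge0.
have H n : exists ab : (nat -> 'rV[R]_k) * (nat -> 'rV[R]_k),
    box_cover (F n) ab.1 ab.2 /\
    (\sum_(0 <= i <oo) (box_volume (ab.1 i) (ab.2 i))%:E
      <= lebesgue_outer (F n) + (e / (2 ^ n.+1)%:R)%:E)%E.
  have [|a [b ?]] := @lebesgue_outer_adherent _ (F n) (e / (2 ^ n.+1)%:R) _ (Ffin n).
    by rewrite divr_gt0// ltr0n expn_gt0.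
  by exists (a, b).
have [G PG] := choice H.
apply: (le_trans (@lebesgue_outer_le_esum _ A (fun n => (G n).1) (fun n => (G n).2) _ _)).
- by move=> n i j; exact: (PG n).1.1.
- by move=> t /AF[n _ /(PG n).1.2[i _ ?]]; exists n => //; exists i.
- apply: lee_nneseries => [n _ _|n _]; last exact: (PG n).2.
  by apply: nneseries_ge0 => i _ _; rewrite lee_fin box_volume_ge0// => j; exact: (PG n).1.1.
Qed.

Lemma box_volume0 k (a : 'rV[R]_k.+1) : box_volume a a = 0.
Proof. by rewrite /box_volume big_ord_recl subrr mul0r. Qed.

(* In dimension 0 a box always has volume 1, so [lebesgue_outer set0] is
   infinite there; hence the dimension [k.+1] from here on. *)
Lemma lebesgue_outer0 k : @lebesgue_outer R k.+1 set0 = 0%E.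
Proof.
apply/eqP; rewrite eq_le lebesgue_outer_ge0 andbT.
apply: (le_trans (@lebesgue_outer_le _ set0 (fun=> 0) (fun=> 0) _)).
  by split.
by rewrite eseries0// => i _ _; rewrite box_volume0.
Qed.

HB.instance Definition _ k := isSubsetOuterMeasure.Build R 'rV[R]_k.+1
  (@lebesgue_outer R k.+1) (@lebesgue_outer0 k) (@lebesgue_outer_ge0 k.+1)
  (@lebesgue_outer_subadd k.+1).

Definition upd k (a : 'rV[R]_k) (j : 'I_k) (c : R) : 'rV[R]_k :=
  \row_i if i == j then c else a 0 i.

Lemma box_volume_split k (a b : 'rV[R]_k) j c :
  box_volume a (upd b j c) + box_volume (upd a j c) b = box_volume a b.
Proof.
rewrite /box_volume (bigD1 j)//= [X in _ + X](bigD1 j)//= [RHS](bigD1 j)//=.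
rewrite !mxE eqxx; set P := \prod_(i < k | i != j) (b 0 i - a 0 i).
rewrite [X in _ * X + _](_ : _ = P); last first.
  by apply: eq_bigr => i /negbTE ij; rewrite mxE ij.
rewrite [X in _ + _ * X](_ : _ = P); last first.
  by apply: eq_bigr => i /negbTE ij; rewrite mxE ij.
by rewrite -mulrDl addrC addrA subrK.
Qed.

(** The hyperplane cuts every box into two boxes whose volumes add up, so a near-optimal cover of X
    splits into covers of its two parts. *)
Lemma caratheodory_halfspace k (j : 'I_k.+1) (c : R) :
  caratheodory_measurable (@lebesgue_outer R k.+1) [set x : 'rV[R]_k.+1 | x 0 j < c].
Proof.
set H := [set x : 'rV[R]_k.+1 | _].
suff le X : (lebesgue_outer (X `&` H) + lebesgue_outer (X `&` ~` H)
    <= lebesgue_outer X)%E.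
  by apply: le_caratheodory_measurable => Y; exact: le.
have [->|Xoo] := eqVneq (lebesgue_outer X) +oo%E; first by rewrite leey.
have fX : lebesgue_outer X \is a fin_num.
  by rewrite ge0_fin_numE ?lebesgue_outer_ge0// ltey.
apply/lee_addgt0Pr => e e0.
have [a [b [[ab Xab] le]]] := lebesgue_outer_adherent e0 fX.
(* [t i] is c clamped to the j-th side of the i-th box, so both pieces have ordered corners, one of
   them being possibly degenerate. *)
pose t i := Num.max (a i 0 j) (Num.min (b i 0 j) c).
have at_ i : a i 0 j <= t i by rewrite le_max lexx.
have tb i : t i <= b i 0 j by rewrite ge_max ab ge_min lexx.
apply: le_trans le.
have v1 i : forall l, a i 0 l <= upd (b i) j (t i) 0 l.
  by move=> l; rewrite mxE; case: eqP => [->|].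
have v2 i : forall l, upd (a i) j (t i) 0 l <= b i 0 l.
  by move=> l; rewrite mxE; case: eqP => [->|].
have -> : (\sum_(0 <= i <oo) (box_volume (a i) (b i))%:E =
   \sum_(0 <= i <oo) (box_volume (a i) (upd (b i) j (t i)))%:E +
   \sum_(0 <= i <oo) (box_volume (upd (a i) j (t i)) (b i))%:E)%E.
  rewrite -nneseriesD; last 2 first.
  - by move=> i _ _; rewrite lee_fin box_volume_ge0.
  - by move=> i _ _; rewrite lee_fin box_volume_ge0.
  by apply: eq_eseriesr => i _; rewrite -EFinD box_volume_split.
apply: leeD; apply: lebesgue_outer_le; split=> //.
- move=> x [/Xab[i _ xi] /= xc]; exists i => // l; have /andP[h1 h2] := xi l.
  rewrite h1 mxE; case: eqP => // ?; subst l.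
  by rewrite /t lt_max lt_min h2 xc orbT.
- move=> x [/Xab[i _ xi] /= /negP]; rewrite -leNgt => xc.
  exists i => // l; have /andP[h1 h2] := xi l.
  rewrite h2 mxE andbT; case: eqP => // ?; subst l.
  by rewrite /t ge_max h1 ge_min xc orbT.
Qed.

Lemma box_halfspaces k (a b : 'rV[R]_k.+1) : box a b =
  \bigcap_(j : 'I_k.+1) ((~` [set x : 'rV[R]_k.+1 | x 0 j < a 0 j]) `&` [set x : 'rV[R]_k.+1 | x 0 j < b 0 j]).
Proof.
apply/seteqP; split=> x.
  move=> xab j _; have /andP[h1 h2] := xab j; split => //=.
  by apply/negP; rewrite -leNgt.
by move=> xab j; have [/= /negP + ->] := xab j I; rewrite -leNgt => ->.
Qed.

Definition boxes k : set (set 'rV[R]_k) :=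
  [set B | exists a b : 'rV[R]_k, (forall j, a 0 j <= b 0 j) /\ B = box a b].

(* [R^k] with the Borel sigma-algebra *)
Definition boxT k := g_sigma_algebraType (@boxes k).

Lemma caratheodory_box k (a b : 'rV[R]_k.+1) :
  caratheodory_measurable (@lebesgue_outer R k.+1) (box a b).
Proof.
rewrite box_halfspaces.
have : (measurable : set (set (caratheodory_type (@lebesgue_outer R k.+1))))
  (\bigcap_(j : 'I_k.+1) ((~` [set x : 'rV[R]_k.+1 | x 0 j < a 0 j]) `&` [set x : 'rV[R]_k.+1 | x 0 j < b 0 j])).
  apply: fin_bigcap_measurable => [//|j _].
  apply: measurableI; first apply: measurableC; exact: caratheodory_halfspace.
by [].
Qed.

Lemma caratheodory_borel k (A : set 'rV[R]_k.+1) :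
  (measurable : set (set (boxT k.+1))) A ->
  caratheodory_measurable (@lebesgue_outer R k.+1) A.
Proof.
move=> mA.
have sub := @smallest_sub _ (sigma_algebra setT) (@boxes k.+1)
  (measurable : set (set (caratheodory_type (@lebesgue_outer R k.+1)))).
apply: (sub _ _ A mA) => [|_ [a [b [_ ->]]]]; last exact: caratheodory_box.
exact: sigma_algebra_measurable.
Qed.

(** The outer measure retyped on Borel sets, where it carries a measure structure. *)
Definition leb k : set (boxT k.+1) -> \bar R := @lebesgue_outer R k.+1.

Lemma leb_semi_sigma_additive k : semi_sigma_additive (@leb k).
Proof.
move=> F mF tF mU.
apply: (@caratheodory_measure_sigma_additive _ _ (@lebesgue_outer R k.+1)) => //.
- by move=> i; apply: caratheodory_borel; exact: mF.
- exact: caratheodory_borel.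
Qed.

HB.instance Definition _ k := isMeasure.Build _ (boxT k.+1) R (@leb k)
  (@lebesgue_outer0 k) (@lebesgue_outer_ge0 k.+1) (@leb_semi_sigma_additive k).

Lemma boxesI k : setI_closed (@boxes k).
Proof.
move=> _ _ [a [b [ab ->]]] [c [d [cd ->]]].
pose m : 'rV[R]_k := \row_j Num.max (a 0 j) (c 0 j).
(* The outer max makes a side degenerate where the two boxes do not overlap. *)
pose n : 'rV[R]_k := \row_j Num.max (m 0 j) (Num.min (b 0 j) (d 0 j)).
exists m, n; split; first by move=> j; rewrite [leRHS]mxE le_max lexx.
apply/seteqP; split=> x.
  move=> [xab xcd] j; have /andP[h1 h2] := xab j; have /andP[h3 h4] := xcd j.
  by rewrite !mxE ge_max h1 h3/= lt_max lt_min h2 h4 orbT.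
move=> H; split=> j; have /andP[] := H j; rewrite !mxE ge_max => /andP[h1 h2];
  by rewrite !lt_max !lt_min ltNge h1 ltNge h2/= => /andP[h3 h4]; rewrite ?h1 ?h2.
Qed.

Definition cbox k (n : nat) : set 'rV[R]_k :=
  box (const_mx (- n%:R)) (const_mx n%:R).
Arguments cbox : clear implicits.

Lemma cbox_boxes k n : @boxes k (cbox k n).
Proof.
by exists (const_mx (- n%:R)), (const_mx n%:R); split=> // j; rewrite !mxE ge0_cp.
Qed.

Lemma ler_normrV k (x : 'rV[R]_k) j : `|x 0 j| <= `|x|.
Proof.
by rewrite [leRHS]/Num.norm/= mx_normrE; apply/bigmax_geP; right; exists (0, j).
Qed.

Lemma ler_rVnorm k (x : 'rV[R]_k) e : 0 <= e -> (forall j, `|x 0 j| <= e) ->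
  `|x| <= e.
Proof.
move=> e0 xe; rewrite [leLHS]/Num.norm/= mx_normrE; apply/bigmax_leP; split=> //.
by move=> [i j] _ /=; rewrite ord1.
Qed.

Lemma bigcup_cbox k : \bigcup_n cbox k n = setT.
Proof.
rewrite -subTset => x _; exists (Num.truncn `|x|).+1 => // j; rewrite !mxE.
have := le_lt_trans (ler_normrV x j) (Num.Theory.truncnS_gt `|x|).
by rewrite ltr_norml => /andP[/ltW -> ->].
Qed.

(** Subadditivity over covers bounds [nu] by the outer measure, and a single box covers itself; so
    they agree on boxes, which form a pi-system. This gives the volume of a box without a
    compactness argument: it suffices to exhibit some [nu]. *)
Lemma leb_unique k (nu : {measure set (boxT k.+1) -> \bar R}) :
  (forall a b : 'rV[R]_k.+1, (forall j, a 0 j <= b 0 j) ->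
     nu (box a b) = (box_volume a b)%:E) ->
  forall A, (measurable : set (set (boxT k.+1))) A -> lebesgue_outer A = nu A.
Proof.
move=> nuE A mA.
have mbox a b : (measurable : set (set (boxT k.+1))) (box a b).
  have [ab|/existsNP[j /negP]] := pselect (forall j, a 0 j <= b 0 j).
    by apply: sub_sigma_algebra; exists a, b.
  rewrite -ltNge => ba; rewrite (_ : box a b = set0)//.
  rewrite -subset0 => x /(_ j)/andP[h1 h2].
  by have := lt_trans (le_lt_trans h1 h2) ba; rewrite ltxx.
have legT B : (measurable : set (set (boxT k.+1))) B -> (nu B <= lebesgue_outer B)%E.
  move=> mB; apply: le_ereal_inf_tmp => _ [a [b [ab Bab ->]]].
  have := @measure_sigma_subadditive _ _ _ nu B (fun i => box (a i) (b i)).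
  move=> /(_ (fun i => mbox _ _) mB Bab)/le_trans; apply.
  by rewrite le_eqVlt; apply/orP; left; apply/eqP/eq_eseriesr => i _; rewrite nuE.
have eqB B : @boxes k.+1 B -> leb B = nu B.
  move=> [a [b [ab ->]]]; apply/eqP; rewrite eq_le legT ?andbT ?nuE//.
  apply: (le_trans (@lebesgue_outer_le _ _
    (fun i => if i is 0%N then a else 0) (fun i => if i is 0%N then b else 0) _)).
    split; last by move=> x ?; exists 0%N.
    by move=> [|i] j.
  rewrite nneseries_recl//; last first.
    by move=> [|i] _; rewrite lee_fin box_volume_ge0.
  by rewrite eseries0 ?adde0// => -[|i]// _ _; rewrite box_volume0.
apply: (@measure_unique _ _ (boxT k.+1) (@boxes k.+1) (cbox k.+1) _ _ _ _
  (@leb k) nu) => //.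
- exact: boxesI.
- exact: cbox_boxes.
- exact: bigcup_cbox.
- move=> n; change (leb (cbox k.+1 n) < +oo)%E; rewrite (eqB _ (cbox_boxes _ n)).
  by rewrite nuE ?ltry// => j; rewrite !mxE ge0_cp.
Qed.
End LebesgueOuter.

(** * Volume of boxes and slicing *)

Section BoxVolume.
Context (R : realType).

Lemma lebesgue_outer_box_le k (a b : 'rV[R]_k.+1) : (forall j, a 0 j <= b 0 j) ->
  (lebesgue_outer (box a b) <= (box_volume a b)%:E)%E.
Proof.
move=> ab; apply: (le_trans (@lebesgue_outer_le _ _ _
    (fun i => if i is 0%N then a else 0) (fun i => if i is 0%N then b else 0) _)).
  split; last by move=> x ?; exists 0%N.
  by move=> [|i] j.
rewrite nneseries_recl//; last first.
  by move=> [|i] _; rewrite lee_fin box_volume_ge0.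
by rewrite eseries0 ?adde0// => -[|i]// _ _; rewrite box_volume0.
Qed.

Lemma measurable_box k (a b : 'rV[R]_k.+1) :
  (measurable : set (set (boxT R k.+1))) (box a b).
Proof.
have [ab|/existsNP[j /negP]] := pselect (forall j, a 0 j <= b 0 j).
  by apply: sub_sigma_algebra; exists a, b.
rewrite -ltNge => ba; rewrite (_ : box a b = set0)//.
rewrite -subset0 => x /(_ j)/andP[h1 h2].
by have := lt_trans (le_lt_trans h1 h2) ba; rewrite ltxx.
Qed.

Lemma leb_sigma_finite k : sigma_finite setT (@leb R k).
Proof.
exists (@cbox R k.+1); first by rewrite bigcup_cbox.
move=> n; split; first exact: measurable_box.
apply: (@le_lt_trans _ _ _ _ _ (lebesgue_outer_box_le _)); last by rewrite ltry.
by move=> j; rewrite !mxE ge0_cp.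
Qed.

HB.instance Definition _ k := Measure_isSigmaFinite.Build _ _ _ (@leb R k)
  (@leb_sigma_finite k).

Lemma box_const_mx (a b : 'rV[R]_1) :
  (fun s : R => const_mx s : 'rV[R]_1) @^-1` box a b = `[a 0 0, b 0 0[%classic.
Proof.
apply/seteqP; split=> s /=; rewrite ?in_itv/=.
  by move=> /(_ 0); rewrite !mxE.
by move=> ? j; rewrite !mxE !(ord1 j).
Qed.

Lemma measurable_const_mx :
  measurable_fun setT (fun s : R => const_mx s : boxT R 1).
Proof.
apply: (@measurability _ _ _ (boxT R 1) _ _ (@boxes R 1)) => //.
move=> _ [_ [a [b [_ ->]]] <-]; rewrite setTI box_const_mx; exact: measurable_itv.
Qed.

Definition cons_rV k (p : R * boxT R k) : boxT R k.+1 := row_mx (p.1%:M : 'M[R]_1) p.2.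

Lemma cons_rV0 k s (y : 'rV[R]_k) : (cons_rV (s, y) : 'rV_k.+1) 0 0 = s.
Proof.
by rewrite /cons_rV mxE; case: splitP => // j _ /=; rewrite !mxE !(ord1 j) eqxx.
Qed.

Lemma cons_rVS k s (y : 'rV[R]_k) j :
  (cons_rV (s, y) : 'rV_k.+1) 0 (lift 0 j) = y 0 j.
Proof.
rewrite /cons_rV mxE; case: splitP => [l|l] /=; first by rewrite (ord1 l).
by rewrite /bump /= => -[/val_inj ->].
Qed.

Definition behead_rV k (a : 'rV[R]_k.+1) : 'rV[R]_k := \row_j a 0 (lift 0 j).

Lemma box_cons_rV k (a b : 'rV[R]_k.+1) :
  @cons_rV k @^-1` box a b =
  `[a 0 0, b 0 0[%classic `*` box (behead_rV a) (behead_rV b).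
Proof.
apply/seteqP; split=> -[s y] /=.
  move=> xab; split; first by have := xab 0; rewrite cons_rV0 in_itv.
  by move=> j; have := xab (lift 0 j); rewrite cons_rVS !mxE.
move=> [] /[!in_itv]/= sab yab j; have [l ->|->] := unliftP 0 j; last by rewrite cons_rV0.
by rewrite cons_rVS; have := yab l; rewrite !mxE.
Qed.

Lemma measurable_cons_rV k : measurable_fun setT (@cons_rV k.+1).
Proof.
apply: (@measurability _ _ _ (boxT R k.+2) _ _ (@boxes R k.+2)) => //.
move=> _ [_ [a [b [_ ->]]] <-]; rewrite setTI box_cons_rV.
by apply: measurableX; [exact: measurable_itv|exact: measurable_box].
Qed.

Lemma lebesgue_measure_itvco (a b : R) : a <= b ->
  @lebesgue_measure R `[a, b[%classic = (b - a)%:E.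
Proof.
rewrite le_eqVlt => /orP[/eqP->|ab]; rewrite lebesgue_measure_itv/= lte_fin ?ab//.
by rewrite ltxx subrr.
Qed.

Definition leb1_measure : {measure set boxT R 1 -> \bar R} :=
  measure_function_pushforward__canonical__measure_function_Measure
    (@lebesgue_measure R) measurable_const_mx.

Definition lebS_measure k : {measure set boxT R k.+2 -> \bar R} :=
  measure_function_pushforward__canonical__measure_function_Measure
    (@lebesgue_measure R \x @leb R k)%E (@measurable_cons_rV k).

Lemma lebS_measure_box k : (forall a b : 'rV[R]_k.+1, (forall j, a 0 j <= b 0 j) ->
    lebesgue_outer (box a b) = (box_volume a b)%:E) ->
  forall a b : 'rV[R]_k.+2, (forall j, a 0 j <= b 0 j) ->
    lebS_measure k (box a b) = (box_volume a b)%:E.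
Proof.
move=> volE a b ab.
change ((@lebesgue_measure R \x @leb R k)%E (@cons_rV k.+1 @^-1` box a b) =
   (box_volume a b)%:E).
rewrite box_cons_rV.
transitivity (@lebesgue_measure R `[(a 0 0)%R, (b 0 0)%R[%classic *
    lebesgue_outer (box (behead_rV a) (behead_rV b)))%E.
  by apply: product_measure1E; [exact: measurable_itv|exact: measurable_box].
rewrite lebesgue_measure_itvco// volE; last by move=> j; rewrite !mxE.
rewrite -EFinM /box_volume [in RHS]big_ord_recl; congr (_ * _)%:E.
by apply: eq_bigr => j _; rewrite !mxE.
Qed.

(** Induction on the dimension: the measure required by [leb_unique] is an image of Lebesgue measure
    on the line in dimension 1, and then an image of its product with [leb], whose box volumes are
    known by induction. *)
Lemma lebesgue_outer_box k (a b : 'rV[R]_k.+1) : (forall j, a 0 j <= b 0 j) ->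
  lebesgue_outer (box a b) = (box_volume a b)%:E.
Proof.
elim: k => [|k IH] in a b *; last first.
  move=> ab; have E := lebS_measure_box IH.
  by rewrite (leb_unique E (measurable_box a b)) E.
move=> ab; have E (c d : 'rV[R]_1) : (forall j, c 0 j <= d 0 j) ->
    leb1_measure (box c d) = (box_volume c d)%:E.
  move=> cd; change (@lebesgue_measure R
    ((fun s : R => const_mx s : 'rV[R]_1) @^-1` box c d) = (box_volume c d)%:E).
  by rewrite box_const_mx lebesgue_measure_itvco// /box_volume big_ord1.
by rewrite (leb_unique E (measurable_box a b)) E.
Qed.

Lemma lebesgue_outer_null_slices k (A : set 'rV[R]_k.+2) :
  (measurable : set (set (boxT R k.+2))) A ->
  (forall y : 'rV[R]_k.+1, @lebesgue_measure R [set s | A (cons_rV (s, y))] = 0%E) ->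
  lebesgue_outer A = 0%E.
Proof.
move=> mA A0; rewrite (leb_unique (lebS_measure_box (@lebesgue_outer_box k)) mA).
change ((@lebesgue_measure R \x @leb R k)%E (@cons_rV k.+1 @^-1` A) = 0%E).
set B := _ @^-1` A.
have mB : measurable B.
  by rewrite -[B]setTI; apply: measurable_cons_rV.
(* The product is rewritten with the other order of integration, so that the sections along the
   first coordinate are integrated. *)
rewrite (@product_measure_unique _ _ _ _ _ _ (@leb R k)
  (@lebesgue_measure R \x^ @leb R k)%E)//; last first.
  by move=> X Y mX mY; exact: product_measure2E.
apply: integral0_eq => y _ /=.
by rewrite -[RHS](A0 y); congr (lebesgue_measure _); apply/seteqP; split=> s;
  rewrite /ysection/= inE.
Qed.
End BoxVolume.

Section NullLines.
Context (R : realType).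

Definition swap0 k (i : 'I_k.+1) (x : 'rV[R]_k.+1) : 'rV[R]_k.+1 :=
  \row_j x 0 (tperm 0 i j).

Lemma swap0E k i (x : 'rV[R]_k.+1) j : swap0 i x 0 j = x 0 (tperm 0 i j).
Proof. by rewrite mxE. Qed.

Lemma updE k (a : 'rV[R]_k) j c i : upd a j c 0 i = if i == j then c else a 0 i.
Proof. by rewrite mxE. Qed.

Lemma swap0K k i : involutive (@swap0 k i).
Proof. by move=> x; apply/rowP => j; rewrite !mxE tpermK. Qed.

Lemma swap0_box k i (a b : 'rV[R]_k.+1) :
  swap0 i @^-1` box a b = box (swap0 i a) (swap0 i b).
Proof.
apply/seteqP; split=> x /= xab j; by have := xab (tperm 0 i j); rewrite !mxE tpermK.
Qed.

Lemma lebesgue_outer_swap0 k i (A : set 'rV[R]_k.+1) :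
  (lebesgue_outer A <= lebesgue_outer (swap0 i @^-1` A))%E.
Proof.
apply: le_ereal_inf_tmp => _ [a [b [ab Aab ->]]].
apply: (le_trans (@lebesgue_outer_le _ _ _ (fun n => swap0 i (a n))
  (fun n => swap0 i (b n)) _)).
  split=> [n j|x Ax]; first by rewrite !mxE.
  have [|n _ xn] := Aab (swap0 i x); first by rewrite /preimage/= swap0K.
  by exists n => //; rewrite -swap0_box.
rewrite le_eqVlt; apply/orP; left; apply/eqP/eq_eseriesr => n _; congr EFin.
rewrite /box_volume [RHS](reindex_inj (@perm_inj _ (tperm 0 i))).
by apply: eq_bigr => j _; rewrite !mxE.
Qed.

Lemma measurable_swap0 k i :
  measurable_fun setT (@swap0 k i : boxT R k.+1 -> boxT R k.+1).
Proof.
apply: (@measurability _ _ (boxT R k.+1) (boxT R k.+1) _ _ (@boxes R k.+1)) => //.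
by move=> _ [_ [a [b [_ ->]]] <-]; rewrite setTI swap0_box; exact: measurable_box.
Qed.

(** Exchanging the coordinates 0 and i preserves box volumes and turns lines in direction i into the
    slices of [lebesgue_outer_null_slices]. *)
Lemma lebesgue_outer_null_lines k (i : 'I_k.+2) (A : set 'rV[R]_k.+2) :
  (measurable : set (set (boxT R k.+2))) A ->
  (forall x, @lebesgue_measure R [set s | A (upd x i s)] = 0%E) ->
  lebesgue_outer A = 0%E.
Proof.
move=> mA A0; apply/eqP; rewrite eq_le lebesgue_outer_ge0 andbT.
rewrite (le_trans (lebesgue_outer_swap0 i A))//.
rewrite lebesgue_outer_null_slices//.
  by rewrite -[X in measurable X]setTI; exact: measurable_swap0.
move=> y; rewrite -[RHS](A0 (swap0 i (cons_rV (0, y)))).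
congr (lebesgue_measure _); apply: eq_set => s /=; congr (A _).
apply/rowP => j; rewrite swap0E updE swap0E.
have [->|ji] := eqVneq j i; first by rewrite tpermR cons_rV0.
have [l ->|E] := unliftP 0 (tperm 0 i j); first by rewrite !cons_rVS.
by move: ji; rewrite -(tpermK 0 i j) E tpermL eqxx.
Qed.

End NullLines.

(** * Cubes, Borel sets and outer regularity *)

Section Cubes.
Context (R : realType) (k : nat).
Local Notation V := 'rV[R]_k.+1.
Local Notation outer := (@lebesgue_outer R k.+1).
Local Notation borel := (measurable : set (set (boxT R k.+1))).

Definition cube (x : V) (r : R) : set V := box (x - const_mx r) (x + const_mx r).

Lemma cubeP (x : V) r y :
  cube x r y <-> forall j, x 0 j - r <= y 0 j < x 0 j + r.
Proof. by split=> H j; have := H j; rewrite !mxE. Qed.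

Lemma lebesgue_outer_cube (x : V) r : 0 <= r -> outer (cube x r) = ((2 * r) ^+ k.+1)%:E.
Proof.
move=> r0; rewrite lebesgue_outer_box; last first.
  by move=> j; rewrite !mxE lerD2l ge0_cp.
rewrite /box_volume (eq_bigr (fun=> 2 * r)) ?prodr_const ?card_ord// => j _.
by rewrite !mxE; ring.
Qed.

Lemma borel_cube (x : V) r : borel (cube x r).
Proof. exact: measurable_box. Qed.

Lemma ball_cube (x : V) r : ball x r `<=` cube x r.
Proof.
move=> y; rewrite -ball_normE /= => xy; apply/cubeP => j.
have := le_lt_trans (ler_normrV (x - y) j) xy; rewrite !mxE ltr_distl => /andP[h1 h2].
by apply/andP; split; lra.
Qed.

Lemma cube_ball (x : V) r e : 0 <= r -> r < e -> cube x r `<=` ball x e.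
Proof.
move=> r0 re y /cubeP xy; rewrite -ball_normE /=.
apply: le_lt_trans re; apply: ler_rVnorm => // j; rewrite !mxE.
by have /andP[h1 h2] := xy j; rewrite ler_norml; apply/andP; split; lra.
Qed.

Lemma borel_open (U : set V) : open U -> borel U.
Proof.
move=> oU.
pose Q (p : 'rV[rat]_k.+1) : V := map_mx ratr p.
pose F (p : 'rV[rat]_k.+1 * 'rV[rat]_k.+1) := box (Q p.1) (Q p.2).
have -> : U = \bigcup_(p in [set p | F p `<=` U]) F p.
  apply/seteqP; split; last by move=> x [p /= pU /pU].
  move=> x Ux; have /nbhs_ballP[e /= e0 eU] := open_nbhs_nbhs (conj oU Ux).
  have e20 : 0 < e / 2 by rewrite divr_gt0.
  have H j : exists p : rat * rat, x 0 j - e / 2 < ratr p.1 < x 0 j /\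
      x 0 j < ratr p.2 < x 0 j + e / 2.
    have /rat_in_itvoo[p] : x 0 j - e / 2 < x 0 j by lra.
    have /rat_in_itvoo[q] : x 0 j < x 0 j + e / 2 by lra.
    by rewrite !in_itv /= => ? ?; exists (p, q).
  have [g gP] := choice H.
  exists (\row_j (g j).1, \row_j (g j).2).
    move=> y /= yg; apply/eU/(@cube_ball _ (e / 2)); [lra|lra|].
    apply/cubeP => j; have := yg j; rewrite !mxE => /andP[h1 h2].
    have [/andP[h3 h4] /andP[h5 h6]] := gP j; apply/andP; split; lra.
  move=> j; rewrite !mxE; have [/andP[h3 h4] /andP[h5 h6]] := gP j.
  by apply/andP; split => //; exact: ltW.
rewrite bigcup_mkcond; apply: countable_bigcupT_measurable => //= p.
by case: ifP => _; [exact: measurable_box|exact: measurable0].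
Qed.

Lemma borel_closed (C : set V) : closed C -> borel C.
Proof.
by move=> cC; rewrite -(setCK C); apply: measurableC; apply: borel_open; exact: closed_openC.
Qed.

Lemma lebesgue_outer_fin_num (A : set V) M : (outer A <= M%:E)%E ->
  outer A \is a fin_num.
Proof.
by move=> AM; rewrite ge0_fin_numE ?lebesgue_outer_ge0// (le_lt_trans AM)// ltry.
Qed.

Lemma le_lebesgue_outer (A B : set V) : A `<=` B -> (outer A <= outer B)%E.
Proof. exact: (@le_outer_measure _ _ (@lebesgue_outer R k.+1)). Qed.

Lemma lebesgue_outerU (A B : set V) : (outer (A `|` B) <= outer A + outer B)%E.
Proof. exact: (@outer_measureU2 _ _ (@lebesgue_outer R k.+1)). Qed.

Lemma lebesgue_outer_null_bigcup (F : (set V)^nat) :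
  (forall n, outer (F n) = 0%E) -> outer (\bigcup_n F n) = 0%E.
Proof.
move=> F0; apply/eqP; rewrite eq_le lebesgue_outer_ge0 andbT.
rewrite (le_trans (@outer_measure_sigma_subadditive _ _ (@lebesgue_outer R k.+1) F))//.
by rewrite eseries0// => n _ _; exact: F0.
Qed.

Lemma lebesgue_outer_null_sub (A B : set V) : A `<=` B ->
  outer B = 0%E -> outer A = 0%E.
Proof.
move=> AB B0; apply/eqP; rewrite eq_le lebesgue_outer_ge0 andbT -B0.
exact: le_lebesgue_outer.
Qed.

(** Continuity at 0 of a polynomial in t; it makes the thickening of a box in [outer_regular]
    cheap. *)
Lemma prod_shift_le (c : 'I_k.+1 -> R) e : 0 < e -> exists2 t, 0 < t &
  \prod_j (c j + t) <= \prod_j c j + e.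
Proof.
move=> e0; pose p : {poly R} := \prod_j ((c j)%:P + 'X).
have pE t : p.[t] = \prod_j (c j + t).
  by rewrite /p horner_prod; apply: eq_bigr => j _; rewrite !hornerE.
have /cvgrPdist_lt/(_ _ e0) := @continuous_horner _ p 0.
move=> /nbhs_ballP[d /= d0 pd].
have d2 : 0 < d / 2 by rewrite divr_gt0.
exists (d / 2) => //.
have /pd : ball (0 : R) d (d / 2).
  by rewrite -ball_normE /= sub0r normrN gtr0_norm//; lra.
rewrite !pE; under eq_bigr do rewrite addr0.
by rewrite ltr_distl => /andP[h1 h2]; lra.
Qed.

(** Half-open boxes fail to be open only at their lower faces, so the boxes of a near-optimal cover
    are extended downwards by a small [t n]. One half of e pays for the cover, the other for the
    extensions. *)
Lemma outer_regular (S : set V) e : 0 < e -> outer S \is a fin_num ->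
  exists U : set V, [/\ open U, S `<=` U & (outer U <= outer S + e%:E)%E].
Proof.
move=> e0 fS; have e20 : 0 < e / 2 by rewrite divr_gt0.
have [a [b [[ab Sab] le]]] := lebesgue_outer_adherent e20 fS.
have H n : exists t : R, 0 < t /\ box_volume (a n - const_mx t) (b n) <=
    box_volume (a n) (b n) + e / 2 / (2 ^ n.+1)%:R.
  have [|t t0 tle] := @prod_shift_le (fun j => b n 0 j - a n 0 j) (e / 2 / (2 ^ n.+1)%:R).
    by rewrite divr_gt0// ltr0n expn_gt0.
  exists t; split=> //; apply: le_trans tle; rewrite le_eqVlt; apply/orP; left.
  by apply/eqP; apply: eq_bigr => j _; rewrite !mxE; ring.
have [t tP] := choice H.
pose O n : set V := [set x : V | forall j, `]a n 0 j - t n, b n 0 j[%classic (x 0 j)].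
exists (\bigcup_n O n); split.
- apply: bigcup_open => n _; rewrite openE => x xO.
  apply: (@filter_forall V 'I_k.+1
    (fun j y => `]a n 0 j - t n, b n 0 j[%classic (y 0 j)) (nbhs x)) => j.
  apply: open_nbhs_nbhs; split; last exact: xO.
  apply: (@open_comp _ _ (fun x : V => x 0 j) `]a n 0 j - t n, b n 0 j[%classic).
    by move=> y _; exact: coord_continuous.
  exact: interval_open.
- move=> x /Sab[n _ xn]; exists n => // j; rewrite /= in_itv/=.
  have /andP[h1 h2] := xn j; rewrite h2 andbT.
  by have [t0 _] := tP n; lra.
- apply: (le_trans (@lebesgue_outer_le _ _ _ (fun n => a n - const_mx (t n)) b _)).
    split=> [n j|x [n _ xn]]; first by rewrite !mxE; have [t0 _] := tP n; have := ab n j; lra.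
    by exists n => // j; have := xn j; rewrite /= in_itv/= !mxE => /andP[/ltW -> ->].
  apply: (@le_trans _ _ (\sum_(0 <= n <oo) ((box_volume (a n) (b n))%:E +
     (e / 2 / (2 ^ n.+1)%:R)%:E))%E).
    apply: lee_nneseries => n _; last by rewrite -EFinD lee_fin (tP n).2.
    rewrite lee_fin box_volume_ge0// => j; rewrite !mxE.
    by have [t0 _] := tP n; have := ab n j; lra.
  rewrite (le_trans (epsilon_trick _ _ (ltW e20)))//; last first.
    rewrite (le_trans (leeD2r _ le))// -addeA -EFinD.
    by rewrite (_ : e / 2 + e / 2 = e)//; lra.
  by move=> n; rewrite lee_fin box_volume_ge0.
Qed.
End Cubes.

(** * Density points *)

Section Density.
Context (R : realType) (k : nat).
Local Notation V := 'rV[R]_k.+1.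
Local Notation outer := (@lebesgue_outer R k.+1).
Local Notation borel := (measurable : set (set (boxT R k.+1))).
Local Notation cara := (caratheodory_measurable (@lebesgue_outer R k.+1)).

(** Density 1, measured with cubes and without a quotient: the constant 2^(k+1) of the cube volume
    is absorbed by e. *)
Definition dense_at (S : set V) (x : V) := forall e : R, 0 < e ->
  exists2 r0, 0 < r0 & forall r, 0 < r -> r < r0 ->
    (outer (cube x r `\` S) <= (e * r ^+ k.+1)%:E)%E.

Lemma cube_meet_sub (p q : V) r s : r <= s -> cube p r `&` cube q s !=set0 ->
  cube p r `<=` cube q (3 * s).
Proof.
move=> rs [z [/cubeP zp /cubeP zq]] y /cubeP yp; apply/cubeP => j.
have /andP[? ?] := zp j; have /andP[? ?] := zq j; have /andP[? ?] := yp j.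
by apply/andP; split; lra.
Qed.

Lemma seq_argmax (T : eqType) (f : T -> R) (s : seq T) : s != [::] ->
  exists2 i, i \in s & forall j, j \in s -> f j <= f i.
Proof.
elim: s => [|a [|b s] IH _]; first by rewrite eqxx.
  by exists a; rewrite ?mem_head// => j; rewrite inE => /eqP ->.
have [i is_ imax] := IH isT.
have [ai|ia] := leP (f a) (f i).
  exists i; first by rewrite inE is_ orbT.
  by move=> j; rewrite inE => /orP[/eqP ->//|/imax].
exists a; first by rewrite mem_head.
move=> j; rewrite inE => /orP[/eqP ->//|/imax ji].
exact: le_trans ji (ltW ia).
Qed.

Definition cubes (s : seq (V * R)) : set V := \bigcup_(p in [set` s]) cube p.1 p.2.

Lemma borel_cubes s : borel (cubes s).
Proof.
by apply: fin_bigcup_measurable => [|p _]; [exact: finite_seq|exact: borel_cube].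
Qed.

(* Vitali's covering argument: keep a largest cube, drop all cubes which meet it,
   and recurse. *)
Lemma vitali_cubes (W : set V) (c : R) (s : seq (V * R)) : 0 < c ->
  (forall p, p \in s -> 0 < p.2 /\
     ((c * p.2 ^+ k.+1)%:E <= outer (W `&` cube p.1 p.2))%E) ->
  (c%:E * outer (cubes s) <= (6 ^+ k.+1)%:E * outer (W `&` cubes s))%E.
Proof.
move=> c0; have [n] := ubnP (size s); elim: n s => // n IH s sn sP.
have [->|s0] := eqVneq s [::].
  rewrite (_ : cubes [::] = set0) ?lebesgue_outer0 ?mule0//; last first.
    by rewrite -subset0 => x [p].
  by rewrite mule_ge0// ?lebesgue_outer_ge0// lee_fin exprn_ge0.
have [i is_ imax] := seq_argmax snd s0; have [i0 ile] := sP i is_.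
pose t := [seq p <- s | `[< cube p.1 p.2 `&` cube i.1 i.2 = set0 >]].
have ts : {subset t <= s} by exact: mem_subseq (filter_subseq _ _).
have tsz : (size t < n)%N.
  rewrite -ltnS (leq_trans _ sn)// ltnS size_filter -(count_predC (fun p =>
    `[< cube p.1 p.2 `&` cube i.1 i.2 = set0 >]) s) -addn1 leq_add2l -has_count.
  apply/hasP; exists i => //=; apply/asboolPn; rewrite setIid => E.
  suff : cube i.1 i.2 i.1 by rewrite E.
  by apply/cubeP => j; apply/andP; split; lra.
have IHt : (c%:E * outer (cubes t) <= (6 ^+ k.+1)%:E * outer (W `&` cubes t))%E.
  by apply: IH => // p /ts/sP.
have scov : cubes s `<=` cube i.1 (3 * i.2) `|` cubes t.
  move=> x [p /= ps xp].
  have [pi|pi] := pselect (cube p.1 p.2 `&` cube i.1 i.2 = set0).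
    by right; exists p => //=; rewrite mem_filter ps andbT; exact/asboolP.
  left; apply: (cube_meet_sub (imax _ ps)) xp; exact/set0P/eqP.
have disj : cubes t `&` cube i.1 i.2 = set0.
  rewrite -subset0 => x [[p /=]]; rewrite mem_filter => /andP[/asboolP pi _] xp xi.
  have : (cube p.1 p.2 `&` cube i.1 i.2) x by split.
  by rewrite pi.
apply: (@le_trans _ _ (c%:E * (outer (cube i.1 (3 * i.2)) + outer (cubes t))))%E.
  rewrite lee_pmul2l ?lte_fin//.
  by apply: le_trans (lebesgue_outerU _ _); exact: le_lebesgue_outer.
rewrite ge0_muleDr ?lebesgue_outer_ge0// lebesgue_outer_cube; last by rewrite mulr_ge0 ?ltW.
have mi := caratheodory_borel (borel_cube i.1 i.2).
have -> : (outer (W `&` cubes s) = outer (W `&` cubes s `&` cube i.1 i.2) +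
    outer (W `&` cubes s `&` ~` cube i.1 i.2))%E by exact: mi.
rewrite ge0_muleDr ?lebesgue_outer_ge0//; apply: leeD.
  rewrite (_ : W `&` cubes s `&` cube i.1 i.2 = W `&` cube i.1 i.2); last first.
    by apply/seteqP; split=> x [h1 h2]; [split=> //; case: h1|
      split=> //; split=> //; exists i].
  (* The tripled cube has side 6 * i.2, which is the origin of the constant. *)
  apply: (@le_trans _ _ ((6 ^+ k.+1)%:E * (c * i.2 ^+ k.+1)%:E)%E).
    by rewrite -!EFinM lee_fin (_ : 2 * (3 * i.2) = 6 * i.2) ?exprMn 1?mulrCA//; ring.
  by rewrite lee_pmul2l// lte_fin exprn_gt0.
apply: (le_trans IHt); rewrite lee_pmul2l// ?lte_fin ?exprn_gt0//.
apply: le_lebesgue_outer => x [Wx xt]; split; first split => //.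
  by case: xt => p /= /ts ps xp; exists p.
by move=> xi; have : (cubes t `&` cube i.1 i.2) x by []; rewrite disj.
Qed.

Lemma vitali_cubes_countable (T : countType) (g : T -> V * R) (W : set V) (c : R)
    (J : set T) : 0 < c ->
  (forall p, J p -> 0 < (g p).2 /\
     ((c * (g p).2 ^+ k.+1)%:E <= outer (W `&` cube (g p).1 (g p).2))%E) ->
  (c%:E * outer (\bigcup_(p in J) cube (g p).1 (g p).2) <= (6 ^+ k.+1)%:E * outer W)%E.
Proof.
move=> c0 JP.
pose s n := [seq g p | p <- [seq p <- pmap unpickle (iota 0 n) | `[< J p >]]].
have sP n q : q \in s n -> exists2 p, J p & q = g p.
  by move=> /mapP[p]; rewrite mem_filter => /andP[/asboolP Jp _] ->; exists p.
have -> : \bigcup_(p in J) cube (g p).1 (g p).2 = \bigcup_n cubes (s n).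
  apply/seteqP; split=> x.
    move=> [p Jp xp]; exists (pickle p).+1 => //; exists (g p) => //=.
    apply/mapP; exists p => //; rewrite mem_filter asboolT// mem_pmap.
    by apply/mapP; exists (pickle p); rewrite ?pickleK// mem_iota /= ltnS.
  by move=> [n _ [q /= /sP[p Jp ->] xp]]; exists p.
have nds : nondecreasing_seq (cubes \o s).
  move=> m n mn; apply/subsetPset => x [q /= /mapP[p]].
  rewrite mem_filter mem_pmap => /andP[Jp /mapP[i im ip]] -> xp; exists (g p) => //=.
  apply/mapP; exists p => //; rewrite mem_filter Jp mem_pmap; apply/mapP.
  by exists i => //; move: im; rewrite !mem_iota/= !add0n => /leq_trans; exact.
have cvgs : outer (cubes (s n)) @[n --> \oo] --> outer (\bigcup_n cubes (s n)).
  apply: (@nondecreasing_cvg_mu _ (boxT R k.+1) _ (@leb R k) (cubes \o s)) => //.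
    by move=> n; exact: borel_cubes.
  by apply: bigcupT_measurable => n; exact: borel_cubes.
rewrite -lee_pdivlMl// -(cvg_lim _ cvgs)//.
apply: lime_le; first by apply/cvg_ex; eexists; exact: cvgs.
apply: nearW => n; rewrite lee_pdivlMl//.
apply: (@le_trans _ _ ((6 ^+ k.+1)%:E * outer (W `&` cubes (s n)))%E).
  by apply: vitali_cubes => // q /sP[p Jp ->]; exact: JP.
by rewrite lee_pmul2l// ?lte_fin ?exprn_gt0//; apply: le_lebesgue_outer => x [].
Qed.

(** Take U open around S with excess at most d. Small cubes at bad points lie in U and have a fixed
    proportion of their volume outside S, so Vitali's estimate bounds the set of bad points by a
    multiple of d, and d is arbitrary. *)
Lemma nondense_null_fin (S : set V) e : 0 < e -> cara S -> outer S \is a fin_num ->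
  outer [set x | S x /\ forall r0, 0 < r0 -> exists r, [/\ 0 < r, r < r0 &
    ((e * r ^+ k.+1)%:E < outer (cube x r `\` S))%E]] = 0%E.
Proof.
move=> e0 mS fS; set B := [set x | _].
(* The factor 2 ^+ k.+1 pays for replacing a radius r by a rational radius below 2 * r. *)
pose c := e / 2 ^+ k.+1; have c0 : 0 < c by rewrite divr_gt0// exprn_gt0.
suff H d : 0 < d -> (c%:E * outer B <= (6 ^+ k.+1 * d)%:E)%E.
  have fB : outer B \is a fin_num.
    rewrite ge0_fin_numE ?lebesgue_outer_ge0//.
    rewrite (@le_lt_trans _ _ (outer S))//; first by apply: le_lebesgue_outer => x [].
    by rewrite -ge0_fin_numE ?lebesgue_outer_ge0.
  apply/eqP; rewrite eq_le lebesgue_outer_ge0 andbT -(fineK fB) lee_fin.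
  rewrite leNgt; apply/negP => b0.
  have /H : 0 < c * fine (outer B) / 2 / 6 ^+ k.+1.
    by rewrite !divr_gt0// ?mulr_gt0// exprn_gt0.
  rewrite -[in leLHS](fineK fB) -EFinM lee_fin [leRHS]mulrC divfK ?gt_eqF ?exprn_gt0//.
  by have := mulr_gt0 c0 b0; lra.
move=> d0; have [U [oU SU Ule]] := outer_regular d0 fS.
have Wd : (outer (U `\` S) <= d%:E)%E.
  have := mS U; rewrite -setDE (setIidr SU) => E.
  by move: Ule; rewrite [X in (X <= _)%E]E leeD2lE.
(* Cubes with rational centre and radius form a countable family, as [vitali_cubes_countable]
   requires. *)
pose g (p : 'rV[rat]_k.+1 * rat) : V * R := (map_mx ratr p.1, ratr p.2).
pose J := [set p | [/\ 0 < (g p).2, cube (g p).1 (g p).2 `<=` U &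
   ((c * (g p).2 ^+ k.+1)%:E <= outer (cube (g p).1 (g p).2 `\` S))%E]].
have BJ : B `<=` \bigcup_(p in J) cube (g p).1 (g p).2.
  move=> x [Sx xB]; have /nbhs_ballP[r0 /= r00 rU] := open_nbhs_nbhs (conj oU (SU _ Sx)).
  have [r [rp rr xr]] := xB (r0 / 4) (divr_gt0 r00 (ltr0n _ 4)).
  have /rat_in_itvoo[rho] : 3 * r / 2 < 2 * r by lra.
  rewrite in_itv/= => /andP[h1 h2].
  have H j : exists q : rat, x 0 j - r / 4 < ratr q < x 0 j + r / 4.
    have /rat_in_itvoo[q] : x 0 j - r / 4 < x 0 j + r / 4 by lra.
    by rewrite in_itv/=; exists q.
  have [q qP] := choice H.
  have xq : cube x r `<=` cube (g (\row_j q j, rho)).1 (ratr rho).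
    move=> y /cubeP xy; apply/cubeP => j; rewrite !mxE.
    have /andP[? ?] := xy j; have /andP[? ?] := qP j.
    by apply/andP; split; lra.
  exists (\row_j q j, rho) => /=.
    split=> /=; [lra| |].
      apply: subset_trans rU => y /cubeP qy; apply: (@cube_ball _ _ _ (3 * r)); [lra|lra|].
      apply/cubeP => j; have := qy j; rewrite !mxE => /andP[? ?].
      by have /andP[? ?] := qP j; apply/andP; split; lra.
    apply: (@le_trans _ _ (outer (cube x r `\` S))); last first.
      by apply: le_lebesgue_outer; exact: setSD.
    apply: le_trans (ltW xr); rewrite lee_fin /c -mulrA ler_pM2l//.
    rewrite mulrC -expr_div_n lerXn2r ?nnegrE; lra.
  by apply/xq/cubeP => j; apply/andP; split; lra.
apply: (@le_trans _ _ (c%:E * outer (\bigcup_(p in J) cube (g p).1 (g p).2))%E).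
  by rewrite lee_pmul2l//; exact: le_lebesgue_outer.
apply: (@le_trans _ _ ((6 ^+ k.+1)%:E * outer (U `\` S))%E); last first.
  by rewrite EFinM lee_pmul2l// lte_fin exprn_gt0.
apply: vitali_cubes_countable => // p [h1 h2 h3]; split=> //; apply: (le_trans h3).
by apply: le_lebesgue_outer => y [yp Sy]; split=> //; split=> //; exact: h2.
Qed.

(** S is cut by the cubes [cbox n] to make its measure finite, and e runs through the 1 / (m + 1).
    Density 1 of the smaller set at x implies density 1 of S. *)
Lemma lebesgue_density_rV (S : set V) : cara S ->
  outer [set x | S x /\ ~ dense_at S x] = 0%E.
Proof.
move=> mS.
pose B (n m : nat) := [set x | (S `&` @cbox R k.+1 n) x /\ forall r0, 0 < r0 ->
  exists r, [/\ 0 < r, r < r0 &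
    ((m.+1%:R^-1 * r ^+ k.+1)%:E < outer (cube x r `\` (S `&` @cbox R k.+1 n)))%E]].
apply: (@lebesgue_outer_null_sub _ _ _ (\bigcup_n \bigcup_m B n m)); last first.
  apply: lebesgue_outer_null_bigcup => n; apply: lebesgue_outer_null_bigcup => m.
  apply: nondense_null_fin; first by rewrite invr_gt0.
    apply: (@caratheodory_measurable_setI _ _ (@lebesgue_outer R k.+1)) => //.
    exact: caratheodory_box.
  apply: (@lebesgue_outer_fin_num _ _ _ (box_volume (const_mx (- n%:R)) (const_mx n%:R) : R)).
  apply: le_trans (lebesgue_outer_box_le _); last by move=> j; rewrite !mxE ge0_cp.
  by apply: le_lebesgue_outer => x [].
move=> x [Sx /existsNP[e /not_implyP[e0 xe]]].
have : (\bigcup_n @cbox R k.+1 n) x by rewrite bigcup_cbox.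
move=> [n _ xn]; exists n => //; exists (Num.truncn e^-1) => //; split=> // r0 r00.
apply: contrapT => /forallNP H; apply: xe; exists r0 => // r rp rr.
have := H r; rewrite -[in X in X -> _]/(~ _) => /not_and3P[//|//|/negP].
rewrite -leNgt => le; apply: le_trans (le_trans _ le) _.
  by apply: le_lebesgue_outer => y [xy Sy]; split=> // -[].
rewrite lee_fin ler_pM2r ?exprn_gt0// -[leRHS]invrK lef_pV2 ?posrE ?invr_gt0//.
  exact/ltW/truncnS_gt.
Qed.
End Density.

(** * Rademacher's theorem *)

Section LipschitzDerivableAE.
Context (R : realType).
Local Notation mu := (@lebesgue_measure R).

Variables (g : R -> R) (L : R).
Hypothesis gnd : {homo g : x y / x <= y}.
Hypothesis gL : forall x y, x <= y -> g y - g x <= L * (y - x).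

Let L0 : 0 <= L.
Proof. by have := gL ler01; have := gnd ler01; lra. Qed.

Let L1 : 0 < L + 1.
Proof. by have := L0; lra. Qed.

Let g_cont : continuous g.
Proof.
move=> x; apply/cvgrPdist_le => e e0; near=> y.
have Ly : `|x - y| * (L + 1) <= e.
  rewrite -ler_pdivlMr; last exact: L1.
  near: y; apply: cvgr_dist_le; first exact: cvg_id.
  by rewrite divr_gt0// L1.
apply: le_trans Ly; apply: (@le_trans _ _ (L * `|x - y|)); last first.
  by rewrite mulrDr mulr1 mulrC lerDl.
have [xy|yx] := leP x y.
  rewrite ler0_norm ?subr_le0 ?gnd// [`|x - y|]ler0_norm ?subr_le0// !opprB; exact: gL.
have {}yx := ltW yx.
rewrite ger0_norm ?subr_ge0 ?gnd// [`|x - y|]ger0_norm ?subr_ge0//; exact: gL.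
Unshelve. all: by end_near. Qed.

Let g_rc : right_continuous g.
Proof. by apply/right_continuousW => x; exact: g_cont. Qed.

Let G : cumulative R R := HB.pack g (isCumulative.Build R _ R g gnd g_rc).
Let nu : {measure set (measurableTypeR R) -> \bar R} := lebesgue_stieltjes_measure G.

Let nu_itv a b : a <= b -> nu `]a, b]%classic = (g b - g a)%:E.
Proof.
move=> ab; rewrite -(wlength_itv_bnd g false false ab).
by apply: (@measurable_mu_extE _ _ (ocitv_type R) (wlength G)); exact: is_ocitv.
Qed.

(** An interval of length l has [nu]-measure at most L * l, so a cover of a null set by intervals of
    small total length has small [nu]-measure. Dividing by L + 1 allows L = 0. *)
Let nu_dom A : measurable A -> mu A = 0%E -> nu A = 0%E.
Proof.
move=> mA A0; apply/eqP; rewrite eq_le measure_ge0 andbT.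
apply/lee_addgt0Pr => e e0; rewrite add0e.
have e1 : 0 < e / (L + 1) by rewrite divr_gt0// L1.
have : mu A \is a fin_num by rewrite A0.
move=> /(lb_ereal_inf_adherent e1)[_ [F [mF AF] <-]].
rewrite [X in (_ < X + _)%E -> _](_ : _ = 0%E) ?add0e; last exact: A0.
move=> Fe; have mF' i : measurable (F i : set (measurableTypeR R)).
  by apply: sub_sigma_algebra; exact: mF.
apply: (le_trans (@measure_sigma_subadditive _ _ _ nu A F mF' mA AF)).
have le i : (nu (F i) <= L%:E * wlength idfun (F i))%E.
  have [[x1 x2] _ <-] := mF i; rewrite /=.
  have [x12|x21] := leP x1 x2.
    by rewrite nu_itv// wlength_itv_bnd// -EFinM lee_fin gL.
  rewrite set_itv_ge ?measure0 ?wlength0 ?mule0//; rewrite bnd_simp -leNgt; exact: ltW.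
apply: (@le_trans _ _ (\sum_(0 <= i <oo) (L%:E * wlength idfun (F i)))%E).
  by apply: lee_nneseries => [i _ _|i _]; [exact: measure_ge0|exact: le].
rewrite nneseriesZl; last by move=> i _; exact: wlength_ge0.
apply: (@le_trans _ _ (L%:E * (e / (L + 1))%:E)%E).
  by rewrite lee_wpmul2l ?lee_fin//; exact: ltW.
rewrite -EFinM lee_fin mulrCA ler_piMr//; first exact: ltW.
by rewrite ler_pdivrMr// mul1r lerDl.
Qed.

(** The Stieltjes measure of g restricted to [D] is finite and dominated by Lebesgue measure. Hence
    on [D] the function g is, up to a constant, an indefinite integral of a Radon-Nikodym
    derivative, and the fundamental theorem of calculus applies. *)
Lemma nondecreasing_lipschitz_derivable_in n :
  {ae mu, forall x, `]- n%:R, n%:R[%classic x -> derivable g x 1}.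
Proof.
pose D : set (measurableTypeR R) := `]- n%:R, n%:R]%classic.
have mD : measurable D by exact: measurable_itv.
have nn : - n%:R <= n%:R :> R by rewrite ge0_cp.
have Doo : (nu D < +oo)%E by rewrite /D nu_itv// ltry.
pose nuD := mfrestr mD Doo.
pose c := charge_of_finite_measure nuD.
have dom : c `<< mu.
  apply/null_content_dominatesP => A mA A0.
  have : (nu (A `&` D) <= nu A)%E.
    have mAD : measurable (A `&` D) by exact: measurableI.
    by apply: le_measure; rewrite ?inE//; exact: subIsetl.
  rewrite (nu_dom mA A0) => le0; apply/eqP; rewrite eq_le le0/=; exact: measure_ge0.
pose f : R -> \bar R := Radon_Nikodym c mu.
have fint : mu.-integrable setT f by exact: Radon_Nikodym_integrable.
pose h := fine \o f.
have hE : EFin \o h = f.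
  by apply/funext => x /=; rewrite /h/= fineK// Radon_Nikodym_fin_num.
have hint : mu.-integrable setT (EFin \o h) by rewrite hE.
have hint' y : mu.-integrable `]-oo, y] (EFin \o h).
  exact: integrableS hint.
have hloc : locally_integrable setT h by apply: open_integrable_locally => //; exact: openT.
have := @FTC1Ny _ h hint' hloc.
apply: filterS; first exact: (ae_filter_ringOfSetsType mu).
move=> x [dF _] xn.
have FE y : - n%:R <= y <= n%:R -> (\int[mu]_(t in `]-oo, y]) h t)%R = g y - g (- n%:R).
  move=> /andP[y1 y2].
  rewrite /Rintegral -[RHS]/(fine (g y - g (- n%:R))%:E) -nu_itv//; congr fine.
  have -> : (\int[mu]_(x0 in `]-oo, y]) (h x0)%:E = \int[mu]_(x0 in `]-oo, y]) f x0)%E.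
    by apply: eq_integral => z _; rewrite -[LHS]/((EFin \o h) z) hE.
  rewrite -Radon_Nikodym_integral//.
  have -> : `]- n%:R, y]%classic = `]-oo, y]%classic `&` D; last by [].
  rewrite /D; apply/seteqP; split=> z /=; rewrite !in_itv/=.
    by move=> /andP[-> zy]; split=> //; exact: le_trans y2.
  by move=> [zy /andP[-> _]].
move: xn; rewrite /= in_itv/= => /andP[x1 x2].
have gE : \forall y \near x, g y = (\int[mu]_(t in `]-oo, y]) h t)%R + g (- n%:R).
  have xI : x \in `]- n%:R, n%:R[ by rewrite in_itv/= x1.
  apply: filterS (near_in_itvoo xI) => y; rewrite in_itv/= => /andP[y1 y2].
  by rewrite FE ?subrK// !ltW.
have gE' : \forall y \near x,
    (\int[mu]_(t in `]-oo, y]) h t)%R + g (- n%:R) = g y.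
  by apply: filterS gE => y ->.
apply: near_eq_derivable gE' _ => //.
by apply: derivableD => //; exact: derivable_cst.
Qed.

End LipschitzDerivableAE.

(** Adding L * x makes u nondecreasing with slopes at most 2 * L, which is the monotone case. *)
Lemma lipschitz_derivable_ae (R : realType) (u : R -> R) (L : R) :
  (forall x y, `|u x - u y| <= L * `|x - y|) ->
  {ae @lebesgue_measure R, forall x, derivable u x 1}.
Proof.
move=> uL; pose g x := u x + L * x.
have gnd : {homo g : x y / x <= y}.
  move=> x y xy; have := uL x y; rewrite [`|x - y|]ler0_norm ?subr_le0//.
  by rewrite ler_norml /g => /andP[h1 h2]; lra.
have gL x y : x <= y -> g y - g x <= (2 * L) * (y - x).
  move=> xy; have := uL x y; rewrite [`|x - y|]ler0_norm ?subr_le0//.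
  by rewrite ler_norml /g => /andP[h1 h2]; lra.
have H n := nondecreasing_lipschitz_derivable_in gnd gL n.
have {}H : {ae @lebesgue_measure R, forall x n,
    `]- n%:R, n%:R[%classic x -> derivable g x 1} by exact: ae_foralln.
apply: filterS H; first exact: (ae_filter_ringOfSetsType (@lebesgue_measure R)).
move=> x xH.
have gx : derivable g x 1.
  apply: (xH (Num.truncn `|x|).+1); rewrite /= in_itv/= -ltr_norml.
  exact: Num.Theory.truncnS_gt.
have -> : u = g \- (fun x => L * x) by apply/funext => z; rewrite /g/= addrK.
by apply: derivableB => //; apply: derivableM.
Qed.

Section Rademacher.
Context (R : realType) (k : nat).
Local Notation V := 'rV[R]_k.+1.
Local Notation outer := (@lebesgue_outer R k.+1).
Local Notation borel := (measurable : set (set (boxT R k.+1))).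

Definition lin (c v : V) : R := \sum_i c 0 i * v 0 i.

Definition lipschitz (F : V -> R) (L : R) := forall x y, `|F x - F y| <= L * `|x - y|.

(** If S had no point within e * r of y, the cube of half-side e * r / 2 about y would lie in
    [cube x (2 * r)] outside S, and its volume would contradict density. *)
Lemma dense_at_near (S : set V) x e : 0 < e -> dense_at S x ->
  exists2 r0, 0 < r0 & forall r, 0 < r -> r < r0 -> forall y, `|y - x| <= r ->
    exists2 z, S z & `|z - y| <= e * r.
Proof.
move=> e0 Sx; pose e' := Num.min e 1.
have e'0 : 0 < e' by rewrite lt_min e0 ltr01.
have e'1 : e' <= 1 by rewrite ge_min lexx orbT.
have e'e : e' <= e by rewrite ge_min lexx.
(* With this constant the density bound at radius 2 * r is (e' * r / 2) ^+ k.+1, below the volume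
   (e' * r) ^+ k.+1 of the missed cube. *)
have [|r0 r00 H] := Sx ((e' / 4) ^+ k.+1); first by rewrite exprn_gt0// divr_gt0.
exists (r0 / 2); first by rewrite divr_gt0.
move=> r rp rr y yx.
have e'r : 0 < e' * r by rewrite mulr_gt0.
have e'rr : e' * r <= r by rewrite ler_piMl// ltW.
apply: contrapT => noz.
have sub : cube y (e' * r / 2) `<=` cube x (2 * r) `\` S.
  move=> z zy; split; last first.
    move=> Sz; apply: noz; exists z => //.
    have : ball y (e' * r) z by apply: cube_ball zy; lra.
    rewrite -ball_normE /= distrC => /ltW/le_trans; apply.
    by rewrite ler_pM2r.
  apply/cubeP => j; have /cubeP/(_ j)/andP[h1 h2] := zy.
  have := le_trans (ler_normrV (y - x) j) yx; rewrite !mxE ler_norml => /andP[h3 h4].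
  by apply/andP; split; lra.
have := H (2 * r); rewrite mulr_gt0// => /(_ erefl).
have -> : 2 * r < r0 by lra.
move=> /(_ erefl)/(le_trans (le_lebesgue_outer sub)).
rewrite lebesgue_outer_cube; last by lra.
rewrite lee_fin -exprMn leNgt => /negP; apply.
by rewrite ltrXn2r//; lra.
Qed.

Lemma normr_delta_mx (i : 'I_k.+1) (h : R) : `|h *: delta_mx 0 i : V| <= `|h|.
Proof.
apply: ler_rVnorm => // j; rewrite !mxE eqxx/=.
by case: (j == i); rewrite ?mulr1// mulr0 normr0.
Qed.

Lemma lipschitz_continuous (F : V -> R) L : lipschitz F L -> continuous F.
Proof.
move=> FL x; apply/(@cvgrPdist_le _ _ _ _ (nbhs_filter x)) => e e0; have L1 : 0 < `|L| + 1 by rewrite ltr_pwDr.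
apply/nbhs_ballP; exists (e / (`|L| + 1)); first by rewrite /= divr_gt0.
move=> y; rewrite -ball_normE /= ltr_pdivlMr// => /ltW xy.
apply: (le_trans (FL x y)); apply: le_trans xy; rewrite mulrC ler_wpM2l//.
by rewrite (le_trans (ler_norm L))// lerDl.
Qed.

(** With slope and scale fixed, the set is closed for continuous F. A point where F has a partial
    derivative lies in such a set for some rational c and some n, so countably many of them
    suffice. *)
Definition pdiff_set (F : V -> R) (d : R) (i : 'I_k.+1) (c : R) (n : nat) : set V :=
  [set x | forall h, `|h| <= n.+1%:R^-1 ->
    `|F (x + h *: delta_mx 0 i) - F x - c * h| <= d * `|h|].

Definition affine_set (F : V -> R) (d : R) (c : V) (n : nat) : set V :=
  [set x | forall v : V, `|v| <= n.+1%:R^-1 ->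
    `|F (x + v) - F x - lin c v| <= d * `|v|].

Lemma closed_increment (F : V -> R) v c d : continuous F ->
  closed [set x : V | `|F (x + v) - F x - c| <= d].
Proof.
move=> cF; have cf : continuous (fun x : V => `|F (x + v) - F x - c|).
  move=> x; apply: (@continuous_comp _ _ _ (fun x : V => F (x + v) - F x - c) Num.norm).
    apply: continuousB; last exact: cst_continuous.
    apply: continuousB; last exact: cF.
    apply: (@continuous_comp _ _ _ (fun x : V => x + v) F); last exact: cF.
    by apply: continuousD; [exact: cvg_id|exact: cst_continuous].
  exact: norm_continuous.
apply: (@preimage_closed V R _ [set t | t <= d]); last exact: closed_le.
by move=> x _; exact: cf.
Qed.

Lemma closed_pdiff_set F L d i c n : lipschitz F L -> closed (pdiff_set F d i c n).
Proof.
move=> /lipschitz_continuous cF.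
have -> : pdiff_set F d i c n = \bigcap_(h in [set h : R | `|h| <= n.+1%:R^-1])
   [set x | `|F (x + h *: delta_mx 0 i) - F x - c * h| <= d * `|h|].
  by apply/seteqP; split=> x H h; exact: H.
by apply: closed_bigI => h _; exact: closed_increment.
Qed.

Lemma closed_affine_set F L d c n : lipschitz F L -> closed (affine_set F d c n).
Proof.
move=> /lipschitz_continuous cF.
have -> : affine_set F d c n = \bigcap_(v in [set v : V | `|v| <= n.+1%:R^-1])
   [set x | `|F (x + v) - F x - lin c v| <= d * `|v|].
  by apply/seteqP; split=> x H h; exact: H.
by apply: closed_bigI => v _; exact: closed_increment.
Qed.

Lemma pdiff_setS F d i c m n : (m <= n)%N -> pdiff_set F d i c m `<=` pdiff_set F d i c n.
Proof.
move=> mn x H h hn; apply: H; apply: (le_trans hn).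
by rewrite lef_pV2 ?posrE// ler_nat.
Qed.

(** Move from x to x + v one coordinate at a time. The intermediate points [q i] need not satisfy
    the partial estimates, but by density a point z within d * |v| of [q i] does, and replacing
    [q i] by z costs 2 * L * d * |v|. *)
Lemma dense_pdiff_affine (F : V -> R) (L d : R) (c : V) n x : lipschitz F L -> 0 <= L -> 0 < d ->
  dense_at (\bigcap_i pdiff_set F d i (c 0 i) n) x ->
  exists m, affine_set F (k.+1%:R * ((1 + 2 * L) * d)) c m x.
Proof.
move=> FL L0 d0 dx; have [r0 r00 H] := dense_at_near d0 dx.
pose r1 := Num.min (r0 / 2) n.+1%:R^-1.
have r10 : 0 < r1 by rewrite lt_min divr_gt0//= invr_gt0.
exists (Num.truncn r1^-1) => v vr.
have {}vr : `|v| <= r1.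
  rewrite (le_trans vr)// -[leRHS]invrK lef_pV2 ?posrE ?invr_gt0//.
  exact/ltW/Num.Theory.truncnS_gt.
have [->|v0] := eqVneq v 0.
  rewrite addr0 subrr sub0r normrN normr0 mulr0 /lin big1 ?normr0// => i _.
  by rewrite mxE mulr0.
have {}v0 : 0 < `|v| by rewrite normr_gt0.
have vr0 : `|v| < r0 by move: vr; rewrite le_min => /andP[? _]; lra.
have vn i : `|v 0 i| <= n.+1%:R^-1.
  by rewrite (le_trans (ler_normrV v i))// (le_trans vr)// ge_min lexx orbT.
pose q (i : nat) : V := x + \row_j (if (j < i)%N then v 0 j else 0).
have q0 : q 0%N = x by rewrite /q (_ : \row_j _ = 0) ?addr0//; apply/rowP => j; rewrite !mxE.
have qk : q k.+1 = x + v.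
  by congr (_ + _); apply/rowP => j; rewrite mxE ltn_ord.
have qS (i : 'I_k.+1) : q i.+1 = q i + v 0 i *: delta_mx 0 i.
  rewrite /q -addrA; congr (_ + _); apply/rowP => j; rewrite !mxE eqxx/=.
  rewrite ltnS leq_eqVlt -val_eqE /=; have [/val_inj ->|ji] := eqVneq (j : nat) i.
    by rewrite ltnn /= mulr1 add0r.
  by rewrite /= mulr0 addr0.
have qx i : `|q i - x| <= `|v|.
  rewrite /q addrAC subrr add0r; apply: ler_rVnorm => // j; rewrite mxE.
  by case: ifP; rewrite ?normr0 ?ler_normrV.
rewrite -qk -{1}q0 -(telescope_sumr (fun i => F (q i)))// big_mkord.
rewrite /lin -sumrB; apply: (le_trans (ler_norm_sum _ _ _)).
rewrite -mulrA -[X in X%:R * _](card_ord k.+1) mulr_natl -sumr_const.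
apply: ler_sum => i _; rewrite qS.
have [z zS zq] := H _ v0 vr0 (q i) (qx i).
have h1 := zS i I (v 0 i) (vn i).
have h2 := FL (q i + v 0 i *: delta_mx 0 i) (z + v 0 i *: delta_mx 0 i).
have h3 := FL z (q i).
have E : `|q i + v 0 i *: delta_mx 0 i - (z + v 0 i *: delta_mx 0 i)| = `|z - q i|.
  by rewrite opprD addrACA subrr addr0 distrC.
rewrite {}E in h2.
have h4 : L * `|z - q i| <= L * (d * `|v|) by rewrite ler_wpM2l.
have h5 : d * `|v 0 i| <= d * `|v| by apply: (ler_wpM2l (ltW d0)); exact: ler_normrV.
move: h1 h2 h3; rewrite !ler_norml => /andP[? ?] /andP[? ?] /andP[? ?].
by apply/andP; split; lra.
Qed.

Lemma lebesgue_outer_null_setU (A B : set V) : outer A = 0%E -> outer B = 0%E ->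
  outer (A `|` B) = 0%E.
Proof.
move=> A0 B0; apply/eqP; rewrite eq_le lebesgue_outer_ge0 andbT.
by rewrite (le_trans (lebesgue_outerU A B))// A0 B0 adde0.
Qed.

Lemma lebesgue_outer_null_countable (T : countType) (F : T -> set V) :
  (forall t, outer (F t) = 0%E) -> outer (\bigcup_t F t) = 0%E.
Proof.
move=> F0.
apply: (@lebesgue_outer_null_sub _ _ _
  (\bigcup_n (if unpickle n is Some t then F t else set0))).
  by move=> x [t _ xt]; exists (pickle t); rewrite ?pickleK.
apply: lebesgue_outer_null_bigcup => n.
by case: unpickle => [t|]; [exact: F0|exact: lebesgue_outer0].
Qed.
End Rademacher.

Section RademacherAE.
Context (R : realType) (k : nat).
Local Notation V := 'rV[R]_k.+2.
Local Notation outer := (@lebesgue_outer R k.+2).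
Local Notation borel := (measurable : set (set (boxT R k.+2))).

(** On a line in direction i, F is derivable almost everywhere; a rational slope within d / 2 of the
    derivative, at a small scale, puts the point in a [pdiff_set]. These sets are closed, so the
    exceptional set is Borel and slicing applies. *)
Lemma pdiff_null (F : V -> R) L d i : lipschitz F L -> 0 < d ->
  outer [set x | forall (q : rat) n, ~ pdiff_set F d i (ratr q) n x] = 0%E.
Proof.
move=> FL d0; set A := [set x | _].
have AE : A = ~` (\bigcup_(q in [set: rat]) \bigcup_n pdiff_set F d i (ratr q) n).
  apply/seteqP; split=> x H; first by move=> [q _ [n _]]; exact: H.
  by move=> q n xqn; apply: H; exists q => //; exists n.
have mA : borel A.
  rewrite AE; apply: measurableC; apply: countable_bigcupT_measurable => // q.
  apply: bigcupT_measurable => n; apply: borel_closed.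
  exact: closed_pdiff_set FL.
apply: (lebesgue_outer_null_lines (i := i) mA) => x.
pose u s := F (upd x i s).
have uS s h : upd x i (s + h) = upd x i s + h *: delta_mx 0 i.
  apply/rowP => j; rewrite !mxE eqxx/=.
  by case: eqP => _; rewrite ?mulr1// mulr0 addr0.
have uL s t : `|u s - u t| <= L * `|s - t|.
  apply: le_trans (FL _ _) _; have [s0|] := eqVneq (s - t) 0.
    by rewrite (subr0_eq s0) !subrr normr0 (normr0 R).
  move=> st; have L0 : 0 <= L.
    have := le_trans (normr_ge0 _) (FL (const_mx 1) 0).
    by rewrite pmulr_lge0// normr_gt0 subr0; apply/eqP => /rowP/(_ 0); rewrite !mxE; apply/eqP; rewrite oner_eq0.
  apply: ler_wpM2l => //; rewrite -[in upd x i s](subrKC t s) uS addrAC subrr add0r.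
  exact: normr_delta_mx.
have [N [mN N0 sub]] := lipschitz_derivable_ae uL.
apply/eqP; rewrite eq_le; apply/andP; split; last by apply: mu_ext_ge0 => *; exact: wlength_ge0.
rewrite -N0; apply: le_mu_ext; apply: subset_trans sub => s As /= /(_ _) du.
have {du} /cvg_ex[/= l] := du.
move=> /cvgrPdist_le/(_ _ (divr_gt0 d0 (ltr0n _ 2))).
move=> /nbhs_ballP[e /= e0 el].
have /rat_in_itvoo[q] : l - d / 2 < l + d / 2 by lra.
rewrite in_itv/= => /andP[q1 q2].
apply: (As q (Num.truncn (e^-1 *+ 2))) => h hn.
have he : `|h| < e.
  apply: le_lt_trans hn _; rewrite invf_plt ?posrE//.
  apply: le_lt_trans (Num.Theory.truncnS_gt _).
  by rewrite mulr2n lerDl invr_ge0 ltW.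
have [->|h0] := eqVneq h 0.
  by rewrite scale0r addr0 subrr sub0r mulr0 normrN !normr0 mulr0.
have := el h; rewrite -ball_normE /= sub0r normrN => /(_ he h0).
rewrite -uS -/(u s) -/(u (s + h)) /GRing.scale/= mulr1 [h + s]addrC => le.
have -> : u (s + h) - u s - ratr q * h =
    h * ((l - ratr q) - (l - h^-1 * (u (s + h) - u s))) by field.
rewrite normrM mulrC ler_wpM2r//; apply: (le_trans (ler_normB _ _)).
have : `|l - ratr q| <= d / 2 by rewrite ler_norml; apply/andP; split; lra.
by move: le; lra.
Qed.

(** At almost every x all partial slopes can be taken rational with a common scale, and x is a
    density point of the set [K p] of points sharing these data; there the partial estimates combine
    into a joint one. The tolerance [e] is such that the loss in [dense_pdiff_affine] ends in d. *)
Lemma rademacher (F : V -> R) L d : lipschitz F L -> 0 < d ->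
  outer [set x | forall (q : 'rV[rat]_k.+2) n, ~ affine_set F d (map_mx ratr q) n x] = 0%E.
Proof.
move=> FL' d0; pose L1 := Num.max L 0.
have L0 : 0 <= L1 by rewrite le_max lexx orbT.
have FL : lipschitz F L1.
  by move=> x y; apply: (le_trans (FL' x y)); rewrite ler_wpM2r// le_max lexx.
pose e := d / (k.+2%:R * (1 + 2 * L1)).
have kL : 0 < k.+2%:R * (1 + 2 * L1).
  by rewrite mulr_gt0// ?ltr0n//; lra.
have e0 : 0 < e by rewrite divr_gt0.
have eE : k.+2%:R * ((1 + 2 * L1) * e) = d.
  by rewrite mulrA mulrC divfK// gt_eqF.
pose K (p : 'rV[rat]_k.+2 * nat) := \bigcap_i pdiff_set F e i ((map_mx ratr p.1 : V) 0 i) p.2.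
have mK p : borel (K p).
  apply: borel_closed; apply: closed_bigI => i _; exact: closed_pdiff_set FL.
pose A1 := \bigcup_(i : 'I_k.+2) [set x | forall (q : rat) n, ~ pdiff_set F e i (ratr q) n x].
pose A2 := \bigcup_p [set x | K p x /\ ~ dense_at (K p) x].
apply: (@lebesgue_outer_null_sub _ _ _ (A1 `|` A2)); last first.
  apply: lebesgue_outer_null_setU.
    by apply: lebesgue_outer_null_countable => i; exact: pdiff_null FL _.
  apply: lebesgue_outer_null_countable => p; apply: lebesgue_density_rV.
  exact: caratheodory_borel.
move=> x xA; apply: contrapT => /not_orP[nA1 nA2].
have H i : exists p : rat * nat, pdiff_set F e i (ratr p.1) p.2 x.
  apply: contrapT => /forallNP H; apply: nA1; exists i => // q n.
  exact: (H (q, n)).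
have [g gP] := choice H.
pose p := (\row_i (g i).1, \max_i (g i).2)%N.
have Kp : K p x.
  by move=> i _; rewrite /p/= !mxE; apply: pdiff_setS (gP i); exact: leq_bigmax.
have dx : dense_at (K p) x by apply: contrapT => ndx; apply: nA2; exists p.
have [m] := dense_pdiff_affine FL L0 e0 dx.
by rewrite eE => xm; exact: (xA p.1 m).
Qed.
End RademacherAE.

(** * Spline approximation *)

Section Spline1D.
Context (R : realType).
Implicit Types s t : R.

(** [bq] is the C^1 primitive of the positive part, [chi] a rounded ramp with slope 0 before -1 and
    slope 1 after 0, and [psi] a rounded step from 0 at -1 to 1 at 1. *)
Definition bq s : R := Num.max s 0 ^+ 2 / 2.
Definition chi s : R := bq (s + 1) - bq s.
Definition psi s : R := chi s - chi (s - 1).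

Lemma chi_lo s : s <= -1 -> chi s = 0.
Proof. by move=> h; rewrite /chi /bq !max_r; lra. Qed.

Lemma chi_mid s : -1 <= s -> s <= 0 -> chi s = (s + 1) ^+ 2 / 2.
Proof. by move=> h1 h2; rewrite /chi /bq max_l ?max_r; lra. Qed.

Lemma chi_hi s : 0 <= s -> chi s = s + 2^-1.
Proof. by move=> h; rewrite /chi /bq !max_l; lra. Qed.

Lemma chi_incr s t : s <= t -> 0 <= chi t - chi s <= t - s.
Proof.
move=> st.
have [s1|s1] := leP s (-1); [rewrite (chi_lo s1)|have [s0|s0] := leP s 0;
  [rewrite (chi_mid (ltW s1) s0)|rewrite (chi_hi (ltW s0))]];
  (have [t1|t1] := leP t (-1); [rewrite (chi_lo t1)|have [t0|t0] := leP t 0;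
  [rewrite (chi_mid (ltW t1) t0)|rewrite (chi_hi (ltW t0))]]); apply/andP; split; nra.
Qed.

Lemma psi_lo s : s <= -1 -> psi s = 0.
Proof. by move=> h; rewrite /psi !chi_lo; lra. Qed.

Lemma psi_hi s : 1 <= s -> psi s = 1.
Proof. by move=> h; rewrite /psi !chi_hi; lra. Qed.

Lemma psi_midl s : -1 <= s -> s <= 0 -> psi s = (s + 1) ^+ 2 / 2.
Proof. by move=> h1 h2; rewrite /psi chi_mid// chi_lo; lra. Qed.

Lemma psi_midr s : 0 <= s -> s <= 1 -> psi s = 1 - (1 - s) ^+ 2 / 2.
Proof. by move=> h1 h2; rewrite /psi chi_hi// chi_mid; lra. Qed.

Lemma psi_nd s t : s <= t -> psi s <= psi t.
Proof.
move=> st.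
have [s1|s1] := leP s (-1); [rewrite (psi_lo s1)|have [s0|s0] := leP s 0;
  [rewrite (psi_midl (ltW s1) s0)|have [s2|s2] := leP s 1;
  [rewrite (psi_midr (ltW s0) s2)|rewrite (psi_hi (ltW s2))]]];
(have [t1|t1] := leP t (-1); [rewrite (psi_lo t1)|have [t0|t0] := leP t 0;
  [rewrite (psi_midl (ltW t1) t0)|have [t2|t2] := leP t 1;
  [rewrite (psi_midr (ltW t0) t2)|rewrite (psi_hi (ltW t2))]]]); nra.
Qed.

Lemma psi_ge0 s : 0 <= psi s.
Proof.
have [s1|s1] := leP s (-1); first by rewrite psi_lo.
by rewrite -(@psi_lo (-1))// psi_nd// ltW.
Qed.

Lemma psi_le1 s : psi s <= 1.
Proof.
have [s1|s1] := leP 1 s; first by rewrite psi_hi.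
by rewrite -(@psi_hi 1)// psi_nd// ltW.
Qed.

Variable M : nat.

(* The steps 0 and M+1 are frozen at 1 and 0, so that the finite family [phi]
   is a partition of unity on the whole line. *)
Definition sigma (m : nat) s : R :=
  if m == 0%N then 1 else if (M < m)%N then 0 else psi (s - m%:R).
(** For 0 < m < M this is the quadratic B-spline supported in [m - 1, m + 2], symmetric about m +
    1/2. *)
Definition phi (m : nat) s : R := sigma m s - sigma m.+1 s.
Definition rho s : R := 2^-1 + \sum_(1 <= m < M.+1) sigma m s.
Definition clamp s : R := Num.max 1 (Num.min s M%:R).

Lemma sigma_nd m s t : s <= t -> sigma m s <= sigma m t.
Proof. by move=> st; rewrite /sigma; do 2 case: ifP => // _; rewrite psi_nd// lerB. Qed.

Lemma phi_ge0 m s : 0 <= phi m s.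
Proof.
rewrite subr_ge0 /sigma /=; have [->|m0] := eqVneq m 0%N.
  by case: ifP => // _; exact: psi_le1.
have [Mm|mM] := ltnP M m; first by rewrite ltnW.
case: ifP => _; [exact: psi_ge0|apply: psi_nd].
by rewrite lerD2l lerN2 ler_nat.
Qed.

Lemma sum_phi s : \sum_(m < M.+1) phi m s = 1.
Proof.
rewrite -(big_mkord xpredT (fun m => phi m s)).
under eq_bigr do rewrite /phi -opprB.
rewrite sumrN telescope_sumr// /sigma/= ltnSn /=; ring.
Qed.

(** Summation by parts. So [rho] is the quasi-interpolant of the identity for the nodes m + 1/2, and
    [rho_id] is exact reproduction on [1, M]. *)
Lemma sum_node_phi s : \sum_(m < M.+1) (m%:R + 2^-1) * phi m s = rho s.
Proof.
rewrite -(big_mkord xpredT (fun m => (m%:R + 2^-1) * phi m s)).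
suff H n : \sum_(0 <= m < n) (m%:R + 2^-1) * phi m s =
    2^-1 + \sum_(1 <= m < n.+1) sigma m s - (n%:R + 2^-1) * sigma n s.
  by rewrite H big_nat_recr//= [sigma M.+1 s]/sigma/= ltnSn /rho; ring.
elim: n => [|n IH].
  by rewrite !big_geq// /sigma/=; ring.
by rewrite big_nat_recr//= IH [in RHS]big_nat_recr//= /phi -natr1; ring.
Qed.

Lemma rhoE s : rho s = 2^-1 + (chi (s - 1) - chi (s - M.+1%:R)).
Proof.
rewrite /rho; congr (_ + _).
rewrite (eq_big_nat _ _ (F2 := fun m => - (chi (s - m.+1%:R) - chi (s - m%:R)))); last first.
  move=> m /andP[m1 m2]; rewrite /sigma gtn_eqF//= ltnNge -ltnS m2/= /psi.
  by have -> : s - m.+1%:R = s - m%:R - 1 by [rewrite -[m.+1%:R]natr1; ring]; ring.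
by rewrite sumrN telescope_sumr//; ring.
Qed.

Lemma rho_id s : 1 <= s -> s <= M%:R -> rho s = s.
Proof.
by move=> h1 h2; rewrite rhoE -[M.+1%:R]natr1 chi_hi ?chi_lo; lra.
Qed.

Lemma rho_incr s t : s <= t -> rho t - rho s <= t - s.
Proof.
move=> st; rewrite !rhoE.
have /andP[_ h1] : 0 <= chi (t - 1) - chi (s - 1) <= (t - 1) - (s - 1).
  by apply: chi_incr; rewrite lerB.
have /andP[h2 _] : 0 <= chi (t - M.+1%:R) - chi (s - M.+1%:R) <= (t - M.+1%:R) - (s - M.+1%:R).
  by apply: chi_incr; rewrite lerB.
lra.
Qed.

(** [clamp s] replaces s because the end functions [phi 0] and [phi M] do not vanish far to the
    left, respectively to the right. *)
Lemma phi_node m s : (0 < M)%N -> (m <= M)%N -> phi m s != 0 ->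
  `|m%:R + 2^-1 - clamp s| <= 5 / 2.
Proof.
move=> M0 mM phi0; have M1 : 1 <= M%:R :> R by rewrite ler1n.
have h1 : m = M \/ s < m%:R + 2.
  have [mM'|] := ltnP m M; last by move=> ?; left; apply/eqP; rewrite eqn_leq mM.
  right; rewrite ltNge; apply/negP => ms; move/eqP: phi0; apply.
  have E1 : (M < m)%N = false by rewrite ltnNge mM.
  have E2 : (M < m.+1)%N = false by rewrite ltnNge mM'.
  rewrite /phi /sigma E1 E2 /=.
  by rewrite -[m.+1%:R]natr1 !psi_hi ?if_same ?subrr//; lra.
have h2 : m = 0%N \/ m%:R - 1 < s.
  have [->|m0] := posnP m; first by left.
  right; rewrite ltNge; apply/negP => ms; move/eqP: phi0; apply.
  have E1 : (M < m)%N = false by rewrite ltnNge mM.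
  rewrite /phi /sigma E1 gtn_eqF//=.
  by rewrite -[m.+1%:R]natr1 !psi_lo ?if_same ?subrr//; lra.
have mM' : m%:R <= M%:R :> R by rewrite ler_nat.
have m0 : 0 <= m%:R :> R by [].
have mlo : m%:R - 1 < s \/ m%:R = 0 :> R by case: h2 => [->|]; [right|left].
have mhi : s < m%:R + 2 \/ m%:R = M%:R :> R by case: h1 => [->|]; [right|left].
rewrite /clamp /Num.min; case: ltP => sM; rewrite /Num.max; case: ltP => s1;
  rewrite ler_norml; apply/andP; split; case: mlo; case: mhi => ? ?; lra.
Qed.

(** Each [sigma m] is nondecreasing, so [phi m] varies by at most the increments of [sigma m] and
    [sigma m.+1]. Their sum is an increment of [rho], which is at most t - s; hence the bound is
    free of M. *)
Lemma sum_phi_dist s t : \sum_(m < M.+1) `|phi m s - phi m t| <= 2 * `|s - t|.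
Proof.
wlog st : s t / s <= t.
  move=> H; have [st|ts] := leP s t; first exact: H.
  rewrite distrC; under eq_bigr do rewrite distrC.
  exact/H/ltW.
rewrite [`|s - t|]ler0_norm ?subr_le0// opprB.
pose D m := sigma m t - sigma m s.
have D0 m : 0 <= D m by rewrite subr_ge0 sigma_nd.
rewrite -(big_mkord xpredT (fun m => `|phi m s - phi m t|)).
apply: (@le_trans _ _ (\sum_(0 <= m < M.+1) (D m + D m.+1))).
  apply: ler_sum => m _; rewrite /phi.
  have := D0 m; have := D0 m.+1; rewrite /D ler_norml => h1 h2.
  by apply/andP; split; lra.
have SD : \sum_(1 <= m < M.+1) D m <= t - s.
  by have := rho_incr st; rewrite /rho /D sumrB; lra.
rewrite big_split/= big_ltn// [X in _ + X]big_nat_recr//=.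
have -> : D 0%N = 0 by rewrite /D /sigma/= subrr.
have -> : D M.+1 = 0 by rewrite /D /sigma/= ltnSn subrr.
rewrite [X in _ + (X + _)](_ : _ = \sum_(1 <= m < M.+1) D m); last first.
  by rewrite big_add1.
lra.
Qed.

Lemma bq_deriv s h : `|bq (s + h) - bq s - Num.max s 0 * h| <= h ^+ 2.
Proof.
rewrite /bq; case: (leP (s + h) 0) => h1; case: (leP s 0) => h2;
  rewrite ler_norml; apply/andP; split; nra.
Qed.
End Spline1D.

(** * Closure properties of C^1 functions *)

Section C1Closure.
Context (R : realType) (k : nat).
Local Notation V := 'rV[R]_k.+1.
Implicit Types f g : V -> R.

Let contD f g : continuous f -> continuous g -> continuous (fun x => f x + g x).
Proof. by move=> cf cg x; apply: continuousD; [exact: cf|exact: cg]. Qed.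

Let contM f g : continuous f -> continuous g -> continuous (fun x => f x * g x).
Proof. by move=> cf cg x; apply: continuousM; [exact: cf|exact: cg]. Qed.

Lemma C1_cst (c : R) : C1 (fun _ : V => c).
Proof.
split=> [x|v]; first exact: differentiable_cst.
rewrite [X in continuous X](_ : _ = cst 0); first exact: cst_continuous.
by apply/funext => x; rewrite (@diff_cst _ _ _ c x).
Qed.

Lemma C1_coord (i : 'I_k.+1) : C1 (fun x : V => x 0 i).
Proof.
split=> [x|v]; first exact: differentiable_coord.
have E x : 'd (fun x : V => x 0 i) x v = v 0 i.
  have lf : linear (fun x : V => x 0 i : R) by move=> a u w; rewrite !mxE.
  pose f : {linear V -> R} := HB.pack (fun x : V => x 0 i)
     (GRing.isLinear.Build _ _ _ _ (fun x : V => x 0 i) lf).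
  by rewrite -[fun x : V => x 0 i]/(f : V -> R) diff_lin//; exact: coord_continuous.
rewrite [X in continuous X](_ : _ = cst (v 0 i)); first exact: cst_continuous.
by apply/funext => x; rewrite E.
Qed.

Lemma C1_continuous f : C1 f -> continuous f.
Proof. by case=> df _ x; exact: differentiable_continuous. Qed.

Lemma C1_add f g : C1 f -> C1 g -> C1 (fun x => f x + g x).
Proof.
move=> [df cf] [dg cg]; split=> [x|v].
  by apply: (@differentiableD _ _ _ f g x).
rewrite [X in continuous X](_ : _ = (fun x => 'd f x v + 'd g x v)).
  by apply: (contD (f := fun x => 'd f x v) (g := fun x => 'd g x v)).
by apply/funext => x; rewrite (@diffD _ _ _ f g x).
Qed.

Lemma C1_mul f g : C1 f -> C1 g -> C1 (fun x => f x * g x).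
Proof.
move=> Cf Cg; have [df cf] := Cf; have [dg cg] := Cg; split=> [x|v].
  by apply: (@differentiableM _ _ f g x).
rewrite [X in continuous X](_ : _ = (fun x => f x * 'd g x v + g x * 'd f x v)).
  exact: (contD (contM (C1_continuous Cf) (cg v)) (contM (C1_continuous Cg) (cf v))).
by apply/funext => x; rewrite (@diffM _ _ f g x).
Qed.

Lemma C1_sum (I : Type) (s : seq I) (P : pred I) (f : I -> V -> R) :
  (forall i, C1 (f i)) -> C1 (fun x => \sum_(i <- s | P i) f i x).
Proof.
move=> Cf; elim: s => [|i s IH].
  by under eq_fun do rewrite big_nil; exact: C1_cst.
under eq_fun do rewrite big_cons.
case: (P i); last exact: IH.
exact: (C1_add (Cf i) IH).
Qed.

Lemma C1_prod (I : Type) (s : seq I) (P : pred I) (f : I -> V -> R) :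
  (forall i, C1 (f i)) -> C1 (fun x => \prod_(i <- s | P i) f i x).
Proof.
move=> Cf; elim: s => [|i s IH].
  by under eq_fun do rewrite big_nil; exact: C1_cst.
under eq_fun do rewrite big_cons.
case: (P i); last exact: IH.
exact: (C1_mul (Cf i) IH).
Qed.

Lemma is_derive_bq (s : R) : is_derive s 1 (@bq R) (Num.max s 0).
Proof.
suff H : h^-1 *: (bq (h *: 1 + s) - bq s) @[h --> 0^'] --> Num.max s 0.
  by split; [apply/cvg_ex; eexists; exact: H|exact: cvg_lim H].
apply/cvgrPdist_le => e e0; near=> h.
have h0 : h != 0 by near: h; exact: nbhs_dnbhs_neq.
have he : `|h| <= e by near: h; apply: dnbhs0_le.
apply: le_trans he.
rewrite distrC -(ler_pM2l (_ : 0 < `|h|)) ?normr_gt0// -normrM.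
have -> : h * (h^-1 *: (bq (h *: 1 + s) - bq s) - Num.max s 0) =
   bq (s + h) - bq s - Num.max s 0 * h.
  by rewrite /GRing.scale/= mulr1 [h + s]addrC; field.
by rewrite -normrM -expr2 (le_trans (bq_deriv s h))// ler_norm.
Unshelve. all: by end_near. Qed.

Lemma C1_bq f : C1 f -> C1 (fun x => bq (f x)).
Proof.
move=> Cf; have [df cf] := Cf.
have db s : differentiable (@bq R) s.
  by apply/derivable1_diffP; have [] := is_derive_bq s.
have dbE s (h : R) : 'd (@bq R) s h = h * Num.max s 0.
  by rewrite (diff1E (db s)) /GRing.scale/= derive1E; have [_ ->] := is_derive_bq s.
split=> [x|v]; first by apply: (@differentiable_comp _ _ _ _ f (@bq R) x).
rewrite [X in continuous X](_ : _ = (fun x => 'd f x v * Num.max (f x) 0)).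
  apply: (contM (g := fun x => Num.max (f x) 0) (cf v)) => x.
  have fc := C1_continuous Cf.
  by apply: (@continuous_max _ _ f (cst 0) x); [exact: fc|exact: cst_continuous].
by apply/funext => x; rewrite (@diff_comp _ _ _ _ f (@bq R) x)//= dbE.
Qed.

End C1Closure.

Section Hybrid.
Context (R : realType) (n : nat) (J : finType).

Lemma sum_prod_ffun (a : 'I_n -> J -> R) :
  \sum_(m : {ffun 'I_n -> J}) \prod_i a i (m i) = \prod_i \sum_j a i j.
Proof. by rewrite bigA_distr_bigA. Qed.

(* Replace the factors one at a time. *)
Lemma sum_prod_dist (a b : 'I_n -> J -> R) :
  (forall i j, 0 <= a i j) -> (forall i j, 0 <= b i j) ->
  (forall i, \sum_j a i j = 1) -> (forall i, \sum_j b i j = 1) ->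
  \sum_(m : {ffun 'I_n -> J}) `|\prod_i a i (m i) - \prod_i b i (m i)| <=
  \sum_i \sum_j `|a i j - b i j|.
Proof.
move=> a0 b0 a1 b1.
pose h (t : nat) (m : {ffun 'I_n -> J}) :=
  \prod_(i < n) (if (i < t)%N then b i (m i) else a i (m i)).
pose e (t : 'I_n) (i : 'I_n) j := if (i < t)%N then b i j
  else if i == t then `|a i j - b i j| else a i j.
have hE (t : 'I_n) m : `|h t m - h t.+1 m| = \prod_i e t i (m i).
  rewrite /h (bigD1 t)//= [X in _ - X](bigD1 t)//= [RHS](bigD1 t)//=.
  rewrite /e ltnn ltnSn eqxx.
  set P := \prod_(i < n | i != t) _.
  rewrite [X in _ - _ * X](_ : _ = P); last first.
    apply: eq_bigr => i it; rewrite ltnS leq_eqVlt.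
    by rewrite (negbTE (it : (i : nat) != t)).
  rewrite -mulrBl normrM; congr (_ * _); rewrite ger0_norm; last first.
    by apply: prodr_ge0 => i _; case: ifP.
  by apply: eq_bigr => i it; rewrite (negbTE it).
have le (m : {ffun 'I_n -> J}) : `|\prod_i a i (m i) - \prod_i b i (m i)| <= \sum_(t < n) \prod_i e t i (m i).
  have -> : \prod_i a i (m i) - \prod_i b i (m i) = \sum_(t < n) (h t m - h t.+1 m).
    rewrite -(big_mkord xpredT (fun t => h t m - h t.+1 m)).
    rewrite (eq_bigr (fun t => - (h t.+1 m - h t m))); last by move=> t _; rewrite opprB.
    rewrite sumrN telescope_sumr// opprB /h; congr (_ - _); apply: eq_bigr => i _ //.
    by rewrite ltn_ord.
  by apply: (le_trans (ler_norm_sum _ _ _)); apply: ler_sum => t _; rewrite hE.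
apply: (le_trans (ler_sum _ (fun m _ => le m))).
rewrite exchange_big /=; apply: ler_sum => t _; rewrite sum_prod_ffun (bigD1 t)//=.
rewrite [X in X * _](_ : _ = \sum_j `|a t j - b t j|); last first.
  by apply: eq_bigr => j _; rewrite /e ltnn eqxx.
rewrite [X in _ * X]big1 ?mulr1// => i it; rewrite /e (negbTE it).
by case: (i < t)%N.
Qed.
End Hybrid.

(** * Tensor-product spline quasi-interpolation *)

Section SplineOperator.
Context (R : realType) (k : nat).
Local Notation V := 'rV[R]_k.+1.
Variables (r e : R) (M : nat).
Hypotheses (r0 : 0 <= r) (e0 : 0 < e) (Mr : 2 * r / e + 1 <= M%:R).
Local Notation node := {ffun 'I_k.+1 -> 'I_M.+1}.

Let M0 : (0 < M)%N.
Proof.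
rewrite -(ltr_nat R); apply: lt_le_trans Mr.
by rewrite ltr_wpDl// divr_ge0 ?mulr_ge0// ltW.
Qed.

(* The cube [|x| <= r] becomes [1 <= resc (x 0 i) <= M]; the node of index l
   sits at [l + 1/2]. *)
Definition resc (s : R) : R := (s + r) / e + 1.
Definition unresc (s : R) : R := e * (s - 1) - r.
Definition pt (m : node) : V := \row_i unresc ((m i)%:R + 2^-1).
Definition wt (m : node) (x : V) : R := \prod_i phi M (m i) (resc (x 0 i)).
Definition spl (H : V -> R) (x : V) : R := \sum_m H (pt m) * wt m x.
Definition clip (x : V) : V := \row_i unresc (clamp M (resc (x 0 i))).

Lemma resc_id (x : V) i : `|x| <= r -> 1 <= resc (x 0 i) <= M%:R.
Proof.
move=> xr; have := le_trans (ler_normrV x i) xr; rewrite ler_norml => /andP[h1 h2].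
apply/andP; split; first by rewrite /resc lerDr divr_ge0 ?(ltW e0)//; lra.
apply: le_trans Mr; rewrite /resc lerD2r ler_pM2r ?invr_gt0//; lra.
Qed.

Lemma unrescK s : unresc (resc s) = s.
Proof. by rewrite /unresc /resc addrK mulrC divfK ?gt_eqF// addrK. Qed.

Lemma clip_id (x : V) : `|x| <= r -> clip x = x.
Proof.
move=> xr; apply/rowP => i; rewrite mxE; have /andP[h1 h2] := resc_id i xr.
by rewrite /clamp min_l// max_r// unrescK.
Qed.

Lemma clamp_dist (s t : R) : `|clamp M s - clamp M t| <= `|s - t|.
Proof.
wlog st : s t / s <= t.
  by move=> H; have [/H//|/ltW/H] := leP s t; rewrite distrC [`|t - s|]distrC.
have M1 : 1 <= M%:R :> R by rewrite ler1n.
have cl : clamp M s <= clamp M t.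
  rewrite /clamp /Num.min; case: ltP => ?; case: ltP => ?; rewrite /Num.max;
  case: ltP => ?; case: ltP => ?; lra.
rewrite !ler0_norm ?subr_le0// /clamp /Num.min; case: ltP => ?; case: ltP => ?;
  rewrite /Num.max; case: ltP => ?; case: ltP => ?; lra.
Qed.

Lemma clip_dist x y : `|clip x - clip y| <= `|x - y|.
Proof.
apply: ler_rVnorm => // i; rewrite !mxE.
have -> : unresc (clamp M (resc (x 0 i))) - unresc (clamp M (resc (y 0 i))) =
  e * (clamp M (resc (x 0 i)) - clamp M (resc (y 0 i))) by rewrite /unresc; ring.
rewrite normrM (gtr0_norm e0).
apply: (le_trans (ler_wpM2l (ltW e0) (clamp_dist _ _))).
rewrite -{1}(gtr0_norm e0) -normrM.
have -> : e * (resc (x 0 i) - resc (y 0 i)) = (x - y) 0 i.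
  by rewrite !mxE /resc; field; rewrite gt_eqF.
exact: ler_normrV.
Qed.

Lemma wt_ge0 m x : 0 <= wt m x.
Proof. by apply: prodr_ge0 => i _; exact: phi_ge0. Qed.

Lemma sum_wt x : \sum_m wt m x = 1.
Proof.
rewrite (sum_prod_ffun (fun i (j : 'I_M.+1) => phi M j (resc (x 0 i)))).
by rewrite big1// => i _; exact: sum_phi.
Qed.

Lemma wt_pt m x : wt m x != 0 -> `|pt m - clip x| <= 5 / 2 * e.
Proof.
move=> w0; apply: ler_rVnorm => [|i]; first by rewrite mulr_ge0 ?(ltW e0)//; lra.
rewrite !mxE.
have -> : unresc ((m i)%:R + 2^-1) - unresc (clamp M (resc (x 0 i))) =
  ((m i)%:R + 2^-1 - clamp M (resc (x 0 i))) * e by rewrite /unresc; ring.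
rewrite normrM (gtr0_norm e0) ler_pM2r//; apply: phi_node => //; first by rewrite -ltnS.
by apply: contraNneq w0 => p0; rewrite /wt (bigD1 i)//= p0 mul0r.
Qed.

Lemma sum_wt_dist x y : \sum_m `|wt m x - wt m y| <= 2 * k.+1%:R * `|x - y| / e.
Proof.
apply: (le_trans (sum_prod_dist (a := fun i (j : 'I_M.+1) => phi M j (resc (x 0 i)))
  (b := fun i (j : 'I_M.+1) => phi M j (resc (y 0 i))) _ _ _ _)).
- by move=> i j; exact: phi_ge0.
- by move=> i j; exact: phi_ge0.
- by move=> i; exact: sum_phi.
- by move=> i; exact: sum_phi.
apply: (@le_trans _ _ (\sum_(i < k.+1) 2 * (`|x - y| / e))).
  apply: ler_sum => i _; apply: (le_trans (sum_phi_dist _ _ _)).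
  rewrite ler_pM2l//.
  have -> : resc (x 0 i) - resc (y 0 i) = (x - y) 0 i / e.
    by rewrite !mxE /resc; field; rewrite gt_eqF.
  by rewrite normrM normfV (gtr0_norm e0) ler_pM2r ?invr_gt0// ler_normrV.
by rewrite sumr_const card_ord -mulr_natl le_eqVlt; apply/orP; left; apply/eqP; ring.
Qed.

Lemma splD H1 H2 x : spl (fun z => H1 z + H2 z) x = spl H1 x + spl H2 x.
Proof. by rewrite /spl -big_split; apply: eq_bigr => m _; rewrite mulrDl. Qed.

Lemma spl_cst c x : spl (fun=> c) x = c.
Proof. by rewrite /spl -mulr_sumr sum_wt mulr1. Qed.

(** The sum over the grid factors over the coordinates: every factor but the i-th is 1, and the i-th
    is [rho] after rescaling. The reproduction of affine functions obtained from this is what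
    [spl_close] rests on. *)
Lemma spl_coord i (x : V) : `|x| <= r -> spl (fun z => z 0 i) x = x 0 i.
Proof.
move=> xr; have /andP[h1 h2] := resc_id i xr.
rewrite /spl.
pose a (l : 'I_k.+1) (j : 'I_M.+1) : R :=
  (if l == i then unresc (j%:R + 2^-1) else 1) * phi M j (resc (x 0 l)).
have E m : (pt m) 0 i * wt m x = \prod_l a l (m l).
  rewrite /a big_split/= -/(wt m x); congr (_ * _).
  by rewrite (bigD1 i)//= eqxx big1 ?mulr1 ?mxE// => l /negbTE ->.
under eq_bigr do rewrite E.
rewrite sum_prod_ffun (bigD1 i)//= [X in _ * X]big1 ?mulr1; last first.
  move=> l li; rewrite /a (negbTE li).
  by under eq_bigr do rewrite mul1r; exact: sum_phi.
rewrite /a eqxx -[RHS]unrescK -{2}(rho_id h1 h2) -sum_node_phi /unresc.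
rewrite (eq_bigr (fun j : 'I_M.+1 => e * ((j%:R + 2^-1) * phi M j (resc (x 0 i)))
  - (e + r) * phi M j (resc (x 0 i)))); last by move=> j _; ring.
by rewrite sumrB -!mulr_sumr sum_phi; ring.
Qed.

Lemma spl_lin (c x : V) : `|x| <= r -> spl (lin c) x = lin c x.
Proof.
move=> xr; rewrite /spl /lin.
under eq_bigr do rewrite mulr_suml.
rewrite exchange_big /=; apply: eq_bigr => i _.
under eq_bigr do rewrite -mulrA.
by rewrite -mulr_sumr -/(spl (fun z => z 0 i) x) spl_coord.
Qed.

Lemma spl_bound (H : V -> R) S x : (forall m, wt m x != 0 -> `|H (pt m)| <= S) ->
  `|spl H x| <= S.
Proof.
move=> HS; apply: (le_trans (ler_norm_sum _ _ _)).
rewrite -[leRHS]mulr1 -(sum_wt x) mulr_sumr; apply: ler_sum => m _.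
rewrite normrM (ger0_norm (wt_ge0 m x)).
have [->|w0] := eqVneq (wt m x) 0; first by rewrite !mulr0.
by rewrite ler_wpM2r ?wt_ge0// HS.
Qed.

(** The weights vary in total by a multiple of |x - y| / e. When H is O(e) at the nodes seen from x
    or y, the factor 1 / e cancels. *)
Lemma spl_dist (H : V -> R) S x y :
  (forall m, wt m x != 0 \/ wt m y != 0 -> `|H (pt m)| <= S) ->
  `|spl H x - spl H y| <= S * (2 * k.+1%:R * `|x - y| / e).
Proof.
move=> HS; rewrite /spl -sumrB.
have S0 : 0 <= S.
  have [m wm] : exists m, wt m x != 0.
    apply: contrapT => /forallNP H0; have := sum_wt x.
    rewrite big1; first by move/eqP; rewrite eq_sym oner_eq0.
    by move=> m _; apply/eqP; apply: contrapT => /negP; exact: H0.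
  by apply: le_trans (HS m (or_introl wm)).
apply: (le_trans (ler_norm_sum _ _ _)).
apply: le_trans (ler_wpM2l S0 (sum_wt_dist x y)); rewrite mulr_sumr.
apply: ler_sum => m _; rewrite -mulrBr normrM.
have [wx|wx] := eqVneq (wt m x) 0; last by rewrite ler_wpM2r// HS//; left.
have [wy|wy] := eqVneq (wt m y) 0; last by rewrite ler_wpM2r// HS//; right.
by rewrite wx wy subrr normr0 !mulr0.
Qed.

Lemma C1_spl (H : V -> R) : C1 (spl H).
Proof.
apply: C1_sum => m; apply: C1_mul; first exact: C1_cst.
apply: C1_prod => i.
have Cr : C1 (fun x : V => resc (x 0 i)).
  exact: (C1_add (C1_mul (C1_add (C1_coord R i) (C1_cst k r)) (C1_cst k e^-1)) (C1_cst k 1)).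
have Cshift (f : V -> R) c : C1 f -> C1 (fun x => f x + c).
  by move=> Cf; exact: (C1_add Cf (C1_cst _ _)).
have Copp (f : V -> R) : C1 f -> C1 (fun x => - f x).
  move=> Cf; rewrite (_ : (fun x => - f x) = (fun x => -1 * f x)).
    exact: (C1_mul (C1_cst _ _) Cf).
  by apply/funext => x; rewrite mulN1r.
have Csub (f g : V -> R) : C1 f -> C1 g -> C1 (fun x => f x - g x).
  by move=> Cf Cg; exact: (C1_add Cf (Copp _ Cg)).
have Cchi (f : V -> R) : C1 f -> C1 (fun x => chi (f x)).
  by move=> Cf; exact: (Csub _ _ (C1_bq (Cshift _ 1 Cf)) (C1_bq Cf)).
have Cpsi (f : V -> R) : C1 f -> C1 (fun x => psi (f x)).
  by move=> Cf; exact: (Csub _ _ (Cchi _ Cf) (Cchi _ (Cshift _ (-1) Cf))).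
have Csig l : C1 (fun x : V => sigma M l (resc (x 0 i))).
  rewrite /sigma; case: (l == 0%N); first exact: C1_cst.
  case: (M < l)%N; first exact: C1_cst.
  exact: (Cpsi _ (Cshift _ (- l%:R) Cr)).
exact: (Csub _ _ (Csig _) (Csig _)).
Qed.

(** For |x - y| <= e the constant F (clip x), which [spl] reproduces, is subtracted; the values at
    the relevant nodes are then at most 4 * e * L, and [spl_dist] turns the 4 into the 8. At larger
    distances it is enough that [spl F] is within 5/2 * e * L of F at the clipped points. *)
Lemma spl_lipschitz (F : V -> R) L : 0 <= L -> lipschitz F L ->
  lipschitz (spl F) (8 * k.+1%:R * L).
Proof.
move=> L0 FL x y.
have k1 : 1 <= k.+1%:R :> R by rewrite ler1n.
have near z m : wt m z != 0 -> `|F (pt m) - F (clip z)| <= 5 / 2 * e * L.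
  by move=> /wt_pt h; apply: (le_trans (FL _ _)); rewrite mulrC ler_wpM2r.
have [xy|xy] := leP `|x - y| e.
  pose H z := F z + - F (clip x).
  have E z : spl F z = spl H z + F (clip x).
    by rewrite /H splD spl_cst subrK.
  rewrite !E opprD addrACA subrr addr0.
  apply: (le_trans (@spl_dist H (4 * e * L) x y _)).
    move=> m [wx|wy].
      apply: (le_trans (near _ _ wx)); rewrite ler_wpM2r// ler_wpM2r ?(ltW e0)//; lra.
    rewrite /H; have -> : F (pt m) - F (clip x) =
      (F (pt m) - F (clip y)) + (F (clip y) - F (clip x)) by ring.
    apply: (le_trans (ler_normD _ _)).
    have h1 := near _ _ wy; have h2 := FL (clip y) (clip x).
    have h3 : L * `|clip y - clip x| <= L * e.
      by rewrite ler_wpM2l// (le_trans (clip_dist _ _))// distrC.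
    have : 0 <= e * L by rewrite mulr_ge0// ltW.
    nra.
  rewrite le_eqVlt; apply/orP; left; apply/eqP; field.
  by rewrite gt_eqF.
have h z : `|spl F z - F (clip z)| <= 5 / 2 * e * L.
  have -> : spl F z - F (clip z) = spl (fun w => F w + - F (clip z)) z.
    by rewrite splD spl_cst.
  by apply: spl_bound => m; exact: near.
have -> : spl F x - spl F y = (spl F x - F (clip x)) - (spl F y - F (clip y))
   + (F (clip x) - F (clip y)) by ring.
apply: (le_trans (ler_normD _ _)).
have h1 := h x; have h2 := h y.
have h3 := le_trans (FL (clip x) (clip y)) (ler_wpM2l L0 (clip_dist x y)).
have h4 := ler_normB (spl F x - F (clip x)) (spl F y - F (clip y)).
have h5 : e * L <= `|x - y| * L by rewrite ler_wpM2r// ltW.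
have h6 : `|x - y| * L <= k.+1%:R * (`|x - y| * L).
  by rewrite ler_peMl// mulr_ge0.
have h7 : 0 <= `|x - y| * L by rewrite mulr_ge0.
have -> : 8 * k.+1%:R * L * `|x - y| = 8 * (k.+1%:R * (`|x - y| * L)) by ring.
lra.
Qed.

Lemma affine_set_lin (F : V -> R) d c n (x z : V) : affine_set F d c n x ->
  `|z - x| <= n.+1%:R^-1 ->
  `|F z - (F x - lin c x + lin c z)| <= d * `|z - x|.
Proof.
move=> Fx zx; have := Fx _ zx; rewrite subrKC; apply: le_trans.
have -> : lin c (z - x) = lin c z - lin c x.
  by rewrite /lin -sumrB; apply: eq_bigr => i _; rewrite !mxE mulrBr.
by rewrite le_eqVlt; apply/orP; left; apply/eqP; congr `|_|; ring.
Qed.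

(** The scheme of [spl_lipschitz], but the affine approximation of F at x is subtracted: it is
    reproduced too, and the remainder at nodes within 4 * e of x is at most 4 * e * d. In the
    constant 9 the operator accounts for 8 and F itself for 1. *)
Lemma spl_close (F : V -> R) d cx cy n (x y : V) : 0 < d -> 4 * e <= n.+1%:R^-1 ->
  `|x| <= r -> `|y| <= r -> affine_set F d cx n x -> affine_set F d cy n y ->
  `|(F x - spl F x) - (F y - spl F y)| <= 9 * k.+1%:R * d * `|x - y|.
Proof.
move=> d0 en xr yr Fx Fy.
have k1 : 1 <= k.+1%:R :> R by rewrite ler1n.
pose H z c w := F w + (- (F z - lin c z) + - lin c w).
have E z c w : `|w| <= r -> F w - spl F w = H z c w - spl (H z c) w.
  move=> wr; rewrite /H splD splD spl_cst.
  have -> : spl (fun w => - lin c w) w = - lin c w.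
    rewrite -[in RHS](spl_lin c wr) /spl -sumrN.
    by apply: eq_bigr => m _; rewrite mulNr.
  ring.
have HE z c w : H z c w = F w - (F z - lin c z + lin c w) by rewrite /H; ring.
have H0 z c : H z c z = 0 by rewrite HE; ring.
have near z c m : affine_set F d c n z -> `|pt m - z| <= 4 * e ->
    `|H z c (pt m)| <= d * `|pt m - z|.
  by move=> Fz h; rewrite HE; apply: affine_set_lin Fz _; exact: le_trans en.
have [xy|xy] := leP `|x - y| e.
  have -> : (F x - spl F x) - (F y - spl F y) =
      - (spl (H x cx) x - spl (H x cx) y) - H x cx y.
    by rewrite (E x cx x xr) (E x cx y yr) H0; ring.
  apply: (le_trans (ler_normB _ _)); rewrite normrN.
  have h1 : `|spl (H x cx) x - spl (H x cx) y| <= (4 * e * d) * (2 * k.+1%:R * `|x - y| / e).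
    apply: spl_dist => m wm.
    have px : `|pt m - x| <= 4 * e.
      case: wm => /wt_pt; rewrite clip_id// => h; first by have := e0; lra.
      have -> : pt m - x = (pt m - y) - (x - y) by rewrite opprB addrA subrK.
      by apply: (le_trans (ler_normB _ _)); have := e0; lra.
    by apply: (le_trans (near _ _ _ Fx px)); rewrite mulrC ler_pM2r.
  have h2 : `|H x cx y| <= d * `|x - y|.
    rewrite HE [`|x - y|]distrC; apply: affine_set_lin Fx _; rewrite distrC.
    by have e4 : e <= 4 * e by [have := e0; lra]; exact: le_trans xy (le_trans e4 en).
  have h3 : (4 * e * d) * (2 * k.+1%:R * `|x - y| / e) = 8 * k.+1%:R * (d * `|x - y|).
    by field; rewrite gt_eqF.
  rewrite h3 in h1.
  have h6 : d * `|x - y| <= k.+1%:R * (d * `|x - y|).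
    by rewrite ler_peMl// mulr_ge0// ltW.
  have -> : 9 * k.+1%:R * d * `|x - y| = 9 * (k.+1%:R * (d * `|x - y|)) by ring.
  lra.
have h z c : `|z| <= r -> affine_set F d c n z -> `|F z - spl F z| <= 5 / 2 * e * d.
  move=> zr Fz; rewrite (E z c z zr) H0 sub0r normrN; apply: spl_bound => m wm.
  have pz : `|pt m - z| <= 5 / 2 * e by have := wt_pt wm; rewrite clip_id.
  have pz' : `|pt m - z| <= 4 * e by have := e0; lra.
  by apply: (le_trans (near _ _ _ Fz pz')); rewrite mulrC ler_pM2r.
have h1 := h _ _ xr Fx; have h2 := h _ _ yr Fy.
apply: (le_trans (ler_normB _ _)).
have h5 : e * d <= `|x - y| * d by rewrite ler_pM2r// ltW.
have h6 : `|x - y| * d <= k.+1%:R * (`|x - y| * d).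
  by rewrite ler_peMl// mulr_ge0// ltW.
have h7 : 0 <= `|x - y| * d by rewrite mulr_ge0// ltW.
have -> : 9 * k.+1%:R * d * `|x - y| = 9 * (k.+1%:R * (`|x - y| * d)) by ring.
lra.
Qed.
End SplineOperator.

(** * Approximation of Lipschitz functions by C^1 functions *)

Section Gradient.
Context (R : realType) (k : nat).
Local Notation V := 'rV[R]_k.+1.

Definition has_gradient (g : V -> R) (x c : V) := forall e : R, 0 < e ->
  exists2 d, 0 < d & forall v : V, `|v| < d ->
    `|g (x + v) - g x - lin c v| <= e * `|v|.

Lemma lin_bound (c v : V) : `|lin c v| <= k.+1%:R * (`|c| * `|v|).
Proof.
apply: (le_trans (ler_norm_sum _ _ _)).
apply: (@le_trans _ _ (\sum_(i < k.+1) `|c| * `|v|)).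
  by apply: ler_sum => i _; rewrite normrM ler_pM// ler_normrV.
by rewrite sumr_const card_ord mulr_natl.
Qed.

Lemma lin_linear (c : V) : linear (lin c : V -> R).
Proof.
move=> a u v; rewrite /lin scaler_sumr -big_split/=; apply: eq_bigr => i _.
by rewrite !mxE /GRing.scale/=; ring.
Qed.

Lemma lin_delta (c : V) i : lin c (delta_mx 0 i) = c 0 i.
Proof.
rewrite /lin (bigD1 i)//= big1 ?addr0; first by rewrite mxE !eqxx mulr1.
by move=> j ji; rewrite mxE eqxx (negbTE ji) mulr0.
Qed.

Lemma lin_diff_gradient (g : V -> R) x (v : V) :
  'd g x v = lin (\row_i 'd g x (delta_mx 0 i)) v.
Proof.
rewrite [in LHS](row_sum_delta v) linear_sum; apply: eq_bigr => i _.
by rewrite linearZ mxE mulrC.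
Qed.

Lemma lin_continuous (c : V) : continuous (lin c).
Proof.
apply: (@lipschitz_continuous _ _ _ (k.+1%:R * `|c|)) => x y.
have -> : lin c x - lin c y = lin c (x - y).
  by rewrite /lin -sumrB; apply: eq_bigr => i _; rewrite !mxE mulrBr.
by rewrite -[leRHS]mulrA; exact: lin_bound.
Qed.

Lemma has_gradientP (g : V -> R) x c :
  has_gradient g x c <-> differentiable g x /\ forall v, 'd g x v = lin c v.
Proof.
pose l : {linear V -> R} := HB.pack (lin c : V -> R)
  (GRing.isLinear.Build _ _ _ _ (lin c : V -> R) (lin_linear c)).
split=> [gc|[dg dE]].
  have E : g \o shift x = cst (g x) + l +o_ (0 : V) id.
    apply/eqaddoP => e e0; have [d d0 H] := gc e e0.
    apply/nbhs_ballP; exists d => //= v; rewrite -ball_normE /= sub0r normrN => vd.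
    rewrite -[X in `|X| <= _]/(g (v + x) - (g x + lin c v)) [v + x]addrC opprD addrA.
    exact: H.
  have cl : continuous l by exact: lin_continuous.
  have dl := diff_unique cl E.
  split; last by move=> v; rewrite dl.
  by apply/diff_locallyP; rewrite dl.
have /diff_locallyP[_ /eqaddoP H] := dg.
move=> e e0; have /nbhs_ballP[d /= d0 dH] := H e e0.
exists d => // v vd; have := dH v; rewrite -ball_normE /= sub0r normrN => /(_ vd).
by rewrite !fctE /= [v + x]addrC dE opprD addrA.
Qed.

Lemma C1_has_gradient (g : V -> R) : C1 g ->
  exists c : V -> V, (forall x, has_gradient g x (c x)) /\
    forall v, continuous (fun x => lin (c x) v).
Proof.
move=> [dg cg]; exists (fun x => \row_i 'd g x (delta_mx 0 i)); split.
  by move=> x; apply/has_gradientP; split => // v; exact: lin_diff_gradient.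
by move=> v; under eq_fun do rewrite -lin_diff_gradient; exact: cg.
Qed.

Lemma has_gradient_C1 (g : V -> R) (c : V -> V) :
  (forall x, has_gradient g x (c x)) ->
  (forall v, continuous (fun x => lin (c x) v)) -> C1 g.
Proof.
move=> gc cc; split=> [x|v]; first by have /has_gradientP[] := gc x.
rewrite [X in continuous X](_ : _ = fun x => lin (c x) v)//.
by apply/funext => x; have /has_gradientP[_ ->] := gc x.
Qed.

Lemma has_gradient_lipschitz (g : V -> R) L x c : has_gradient g x c ->
  lipschitz g L -> forall v, `|lin c v| <= L * `|v|.
Proof.
move=> gc gL v; have [->|v0] := eqVneq v 0.
  by rewrite /lin big1 ?normr0 ?mulr0// => i _; rewrite mxE mulr0.
have {}v0 : 0 < `|v| by rewrite normr_gt0.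
apply/ler_addgt0Pr => e e0.
have [d d0 H] := gc (e / `|v|) (divr_gt0 e0 v0).
pose t := d / (2 * `|v|); have t0 : 0 < t by rewrite divr_gt0// mulr_gt0.
have tv : `|t *: v| = d / 2.
  by rewrite normrZ gtr0_norm// /t; field; rewrite gt_eqF.
have := H (t *: v); rewrite tv => /(_ _)/(le_trans _) h.
have lt : lin c (t *: v) = t * lin c v.
  by rewrite /lin mulr_sumr; apply: eq_bigr => i _; rewrite mxE mulrCA.
have h1 : `|g (x + t *: v) - g x| <= L * (d / 2).
  by rewrite -tv (le_trans (gL _ _))// addrAC subrr add0r.
have h2 : `|t * lin c v| <= L * (d / 2) + e / `|v| * (d / 2).
  rewrite -lt; have -> : lin c (t *: v) = (g (x + t *: v) - g x) -
     (g (x + t *: v) - g x - lin c (t *: v)) by ring.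
  apply: (le_trans (ler_normB _ _)); apply: lerD => //.
  by rewrite -tv; apply: H; rewrite tv; lra.
rewrite -(ler_pM2l t0) -{1}(gtr0_norm t0) -normrM (le_trans h2)//.
rewrite le_eqVlt; apply/orP; left; apply/eqP; rewrite /t; field.
by rewrite gt_eqF.
Qed.
End Gradient.

Section McShane.
Context (R : realType) (k : nat).
Local Notation V := 'rV[R]_k.+1.

Lemma mcshane (S : set V) (f : V -> R) L : 0 <= L ->
  (forall x y, S x -> S y -> `|f x - f y| <= L * `|x - y|) ->
  exists F, lipschitz F L /\ forall x, S x -> F x = f x.
Proof.
move=> L0 fL; have [->|/set0P[s0 Ss0]] := eqVneq S set0.
  by exists (fun=> 0); split=> // x y; rewrite subrr normr0 mulr_ge0.
pose A x := [set f y + L * `|x - y| | y in S].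
have A0 x : A x !=set0 by exists (f s0 + L * `|x - s0|), s0.
have Alb x : has_lbound (A x).
  exists (f s0 - L * `|x - s0|) => _ [y Sy <-].
  have h1 := fL _ _ Ss0 Sy; have := ler_norm (f s0 - f y).
  have : L * `|s0 - y| <= L * (`|x - s0| + `|x - y|).
    by rewrite ler_wpM2l// -[s0 - y](subrKA x) (le_trans (ler_normD _ _))// [`|s0 - x|]distrC.
  lra.
pose F x := inf (A x).
have F1 x z : F x - L * `|x - z| <= F z.
  apply: lb_le_inf => // _ [y Sy <-]; rewrite lerBlDr.
  have : F x <= f y + L * `|x - y| by apply: ge_inf => //; exists y.
  move=> /le_trans; apply.
  have : L * `|x - y| <= L * (`|z - y| + `|x - z|).
    by rewrite ler_wpM2l// -[x - y](subrKA z) (le_trans (ler_normD _ _))// addrC.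
  lra.
exists F; split=> [x z|x Sx].
  have h1 := F1 x z; have := F1 z x; rewrite [`|z - x|]distrC => h2.
  by rewrite ler_norml; apply/andP; split; lra.
apply/eqP; rewrite eq_le; apply/andP; split.
  by apply: ge_inf => //; exists x => //; rewrite subrr normr0 mulr0 addr0.
apply: lb_le_inf => // _ [y Sy <-].
by have := fL _ _ Sx Sy; have := ler_norm (f x - f y); lra.
Qed.
End McShane.

(** * C^1-convergent series *)

Section C1Series.
Context (R : realType) (k : nat).
Local Notation V := 'rV[R]_k.+1.

Lemma sum_half_le (m n : nat) : \sum_(m <= j < n) (2 ^- j : R) <= 2 * 2 ^- m.
Proof.
suff H d : \sum_(m <= j < m + d) (2 ^- j : R) = 2 * 2 ^- m - 2 * 2 ^- (m + d).
  have [mn|nm] := leqP m n.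
    by rewrite -(subnKC mn) H gerBl mulr_ge0// invr_ge0 exprn_ge0.
  by rewrite big_geq ?(ltnW nm)// mulr_ge0// invr_ge0 exprn_ge0.
elim: d => [|d IH]; first by rewrite addn0 big_geq// subrr.
rewrite addnS big_nat_recr ?leq_addr//= IH exprS invfM; lra.
Qed.

Lemma dominated_series_lim (u : nat -> R) C : (forall j, `|u j| <= C * 2 ^- j) ->
  exists l, forall m, `|l - \sum_(0 <= j < m) u j| <= 2 * C * 2 ^- m.
Proof.
move=> uC.
have C0 : 0 <= C by have := le_trans (normr_ge0 _) (uC 0%N); rewrite expr0 invr1 mulr1.
have tail m n : (m <= n)%N ->
    `|\sum_(0 <= j < n) u j - \sum_(0 <= j < m) u j| <= 2 * C * 2 ^- m.
  move=> mn; rewrite (big_cat_nat _ (n := m))//= addrAC subrr add0r.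
  apply: (le_trans (ler_norm_sum _ _ _)).
  apply: (le_trans (ler_sum _ (fun j _ => uC j))).
  by rewrite -mulr_sumr [2 * C]mulrC -mulrA ler_wpM2l// sum_half_le.
have cv : cvgn (series u).
  apply: normed_cvg; apply: (@series_le_cvg _ _ (geometric C 2^-1)) => //.
  - by move=> n /=.
  - by move=> n; rewrite /geometric /= mulr_ge0// exprn_ge0// invr_ge0.
  - by move=> n; rewrite /geometric /= exprVn; exact: uC.
  - by apply: is_cvg_geometric_series; rewrite ger0_norm ?invr_ge0// invf_lt1// ltr1n.
exists (limn (series u)) => m.
have cv' : (series u n - \sum_(0 <= j < m) u j) @[n --> \oo] -->
    limn (series u) - \sum_(0 <= j < m) u j.
  by apply: cvgB; [exact: cv|exact: cvg_cst].
rewrite -(cvg_lim _ (cvg_norm cv'))//; apply: limr_le.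
  by apply/cvg_ex; eexists; exact: (cvg_norm cv').
by near=> n; apply: tail; near: n; exact: nbhs_infty_ge.
Unshelve. all: by end_near. Qed.

Lemma C1_series (G : nat -> V -> R) C : (forall j, C1 (G j)) ->
  (forall j, lipschitz (G j) (C * 2 ^- j)) -> (forall j, G j 0 = 0) ->
  exists g, C1 g /\ forall x m,
    `|g x - \sum_(0 <= j < m) G j x| <= 2 * (C * `|x|) * 2 ^- m.
Proof.
move=> GC GL G0.
pose S m x := \sum_(0 <= j < m) G j x.
have SC m : C1 (S m) by exact: C1_sum.
have [c cP] := choice (fun j => C1_has_gradient (GC j)).
have gl j x v := has_gradient_lipschitz ((cP j).1 x) (GL j) v.
have limP (u : nat -> R) B : (forall j, `|u j| <= B * 2 ^- j) ->
  {l | forall m, `|l - \sum_(0 <= j < m) u j| <= 2 * B * 2 ^- m}.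
  by move=> uB; apply: cid; exact: dominated_series_lim.
have Gx x j : `|G j x| <= C * `|x| * 2 ^- j.
  by have := GL j x 0; rewrite G0 !subr0 mulrAC.
have cx x i j : `|c j x 0 i| <= C * `|delta_mx 0 i : V| * 2 ^- j.
  by have := gl j x (delta_mx 0 i); rewrite lin_delta mulrAC.
pose g x := sval (limP _ _ (Gx x)).
pose d x : V := \row_i sval (limP _ _ (cx x i)).
have gP x m : `|g x - S m x| <= 2 * (C * `|x|) * 2 ^- m := svalP (limP _ _ (Gx x)) m.
have C0 : 0 <= C.
  have := le_trans (normr_ge0 _) (GL 0%N (const_mx 1) 0).
  rewrite expr0 invr1 mulr1 pmulr_lge0// normr_gt0 subr0.
  by apply/eqP => /rowP/(_ 0); rewrite !mxE; apply/eqP; rewrite oner_eq0.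
have half_lim B e : 0 < e -> exists m : nat, B * 2 ^- m <= e :> R.
  move=> e0; have [B0|B0] := leP B 0.
    exists 0%N; rewrite expr0 invr1 mulr1; lra.
  exists (Num.truncn (B / e)); rewrite ler_pdivrMr ?exprn_gt0//.
  rewrite -ler_pdivrMl// mulrC; set t := B / e.
  apply: (le_trans (ltW (Num.Theory.truncnS_gt t))).
  by rewrite -natrX ler_nat ltn_expl.
have tailL m x y : `|(g x - S m x) - (g y - S m y)| <= 2 * C * 2 ^- m * `|x - y|.
  apply/ler_addgt0Pr => e e0.
  have [n nP] := half_lim (2 * (C * `|x|) + 2 * (C * `|y|)) e e0.
  pose N := maxn m n.
  have nN : 2 ^- N <= 2 ^- n :> R.
    by rewrite lef_pV2 ?posrE ?exprn_gt0// ler_weXn2l ?leq_maxr// ler1n.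
  have h1 : `|g x - S N x| <= 2 * (C * `|x|) * 2 ^- n.
    by apply: (le_trans (gP x N)); rewrite ler_wpM2l// !mulr_ge0.
  have h2 : `|g y - S N y| <= 2 * (C * `|y|) * 2 ^- n.
    by apply: (le_trans (gP y N)); rewrite ler_wpM2l// !mulr_ge0.
  have h3 : `|(S N x - S m x) - (S N y - S m y)| <= 2 * C * 2 ^- m * `|x - y|.
    have SN z : S N z - S m z = \sum_(m <= j < N) G j z.
      by rewrite /S (big_cat_nat _ (n := m) (p := N))/= ?leq_maxl// addrAC subrr add0r.
    rewrite !SN -sumrB.
    apply: (le_trans (ler_norm_sum _ _ _)).
    apply: (le_trans (ler_sum _ (fun j _ => GL j x y))).
    rewrite -mulr_suml ler_wpM2r// -mulr_sumr [2 * C]mulrC -mulrA ler_wpM2l//.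
    exact: sum_half_le.
  have -> : (g x - S m x) - (g y - S m y) = ((g x - S N x) - (g y - S N y)) +
     ((S N x - S m x) - (S N y - S m y)) by ring.
  apply: (le_trans (ler_normD _ _)); rewrite addrC; apply: lerD => //.
  by apply: (le_trans (ler_normB _ _)); lra.
have linS m x v : lin (\sum_(0 <= j < m) c j x) v = \sum_(0 <= j < m) lin (c j x) v.
  rewrite /lin; under eq_bigr do rewrite summxE mulr_suml.
  by rewrite exchange_big.
have dP m x v : `|lin (d x) v - lin (\sum_(0 <= j < m) c j x) v|
    <= k.+1%:R * (2 * C * 2 ^- m * `|v|).
  have -> : lin (d x) v - lin (\sum_(0 <= j < m) c j x) v =
    lin (d x - \sum_(0 <= j < m) c j x) v.
    by rewrite /lin -sumrB; apply: eq_bigr => i _; rewrite !mxE mulrBl.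
  apply: (le_trans (lin_bound _ _)); rewrite ler_pM2l ?ltr0n// ler_wpM2r//.
  apply: ler_rVnorm => [|i]; first by rewrite !mulr_ge0// invr_ge0 exprn_ge0.
  rewrite !mxE summxE.
  apply: (le_trans (svalP (limP _ _ (cx x i)) m)).
  rewrite ler_wpM2r ?invr_ge0 ?exprn_ge0// ler_pM2l// ler_piMr//.
  apply: ler_rVnorm => // j; rewrite mxE eqxx/=.
  by case: (j == i); rewrite ?normr1 ?normr0.
have Sgrad m x : has_gradient (S m) x (\sum_(0 <= j < m) c j x).
  apply/has_gradientP; split; first exact: (SC m).1.
  elim: m => [|m IH] v.
    rewrite big_geq//; have -> : S 0%N = cst 0 by apply/funext => y; rewrite /S big_geq.
    by rewrite diff_cst /lin big1// => i _; rewrite mxE mul0r.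
  have -> : S m.+1 = S m + G m by apply/funext => y; rewrite /S big_nat_recr.
  rewrite diffD; [|exact: (SC m).1|exact: (GC m).1].
  rewrite [LHS]/= IH [RHS]linS big_nat_recr//= -linS; congr (_ + _).
  by have /has_gradientP[_ ->] := (cP m).1 x.
exists g; split; last exact: gP.
apply: (@has_gradient_C1 _ _ _ d) => [x e e0|v].
  have [m mP] := half_lim (2 * C + k.+1%:R * (2 * C)) (e / 2) (divr_gt0 e0 (ltr0n _ 2)).
  have [r r0 H] := Sgrad m x (e / 2) (divr_gt0 e0 (ltr0n _ 2)).
  exists r => // v vr.
  have h1 := H v vr; have h2 := tailL m (x + v) x; have h3 := dP m x v.
  have E : x + v - x = v by rewrite addrAC subrr add0r.
  rewrite {}E in h2.
  have h4 := ler_wpM2r (normr_ge0 v) mP.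
  have -> : g (x + v) - g x - lin (d x) v =
    ((g (x + v) - S m (x + v)) - (g x - S m x)) +
    (S m (x + v) - S m x - lin (\sum_(0 <= j < m) c j x) v) -
    (lin (d x) v - lin (\sum_(0 <= j < m) c j x) v) by ring.
  apply: (le_trans (ler_normB _ _)).
  have h5 := ler_normD (g (x + v) - S m (x + v) - (g x - S m x))
    (S m (x + v) - S m x - lin (\sum_(0 <= j < m) c j x) v).
  lra.
move=> x; apply/(@cvgrPdist_le _ _ _ _ (nbhs_filter x)) => e e0.
have [m mP] := half_lim (k.+1%:R * (2 * C * `|v|)) (e / 4) (divr_gt0 e0 (ltr0n _ 4)).
have cS : continuous (fun x => lin (\sum_(0 <= j < m) c j x) v).
  move=> y; have := (SC m).2 v y.
  rewrite [X in continuous_at _ X -> _](_ : _ = fun x => lin (\sum_(0 <= j < m) c j x) v)//.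
  by apply/funext => z; have /has_gradientP[_ ->] := Sgrad m z.
have /(@cvgrPdist_le _ _ _ _ (nbhs_filter x))/(_ _ (divr_gt0 e0 (ltr0n _ 2))) := cS x.
apply: filterS => y xy.
have h1 := dP m x v; have h2 := dP m y v.
have E : k.+1%:R * (2 * C * 2 ^- m * `|v|) = k.+1%:R * (2 * C * `|v|) * 2 ^- m by ring.
rewrite {}E in h1 h2.
have -> : lin (d x) v - lin (d y) v = (lin (d x) v - lin (\sum_(0 <= j < m) c j x) v)
  - (lin (d y) v - lin (\sum_(0 <= j < m) c j y) v) +
  (lin (\sum_(0 <= j < m) c j x) v - lin (\sum_(0 <= j < m) c j y) v) by ring.
apply: (le_trans (ler_normD _ _)).
have h5 := ler_normB (lin (d x) v - lin (\sum_(0 <= j < m) c j x) v)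
   (lin (d y) v - lin (\sum_(0 <= j < m) c j y) v).
lra.
Qed.
End C1Series.

Section Lusin.
Context (R : realType) (k : nat).
Local Notation V := 'rV[R]_k.+2.
Local Notation outer := (@lebesgue_outer R k.+2).
Local Notation borel := (measurable : set (set (boxT R k.+2))).
Local Notation cara := (caratheodory_measurable (@lebesgue_outer R k.+2)).

Definition cball (r : R) : set V := [set x | `|x| <= r].

Lemma borel_cball r : borel (cball r).
Proof.
apply: borel_closed; apply: (@preimage_closed V R Num.norm [set t | t <= r]);
  last exact: closed_le.
by move=> x _; exact: norm_continuous.
Qed.

Lemma cball_fin r : 0 <= r -> (outer (cball r) < +oo)%E.
Proof.
move=> r0; apply: (@le_lt_trans _ _ (outer (cube 0 (r + 1)))).
  apply: le_lebesgue_outer => x xr; apply: ball_cube; rewrite -ball_normE /= sub0r normrN.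
  by apply: le_lt_trans xr _; rewrite ltrDl.
by rewrite lebesgue_outer_cube ?ltry// addr_ge0.
Qed.

(** Rademacher's theorem gives a scale n depending on the point. The sets [D n] increase and exhaust
    the ball up to a null set, so by continuity from above one n works off a set of measure at most
    h. *)
Lemma lipschitz_uniformly_affine (F : V -> R) L d h r : lipschitz F L -> 0 < d ->
  0 < h -> 0 <= r ->
  exists (N : set V) n, [/\ borel N, (outer N <= h%:E)%E &
    forall x, `|x| <= r -> ~ N x -> exists c, affine_set F d c n x].
Proof.
move=> FL d0 h0 r0.
pose D n := \bigcup_(q : 'rV[rat]_k.+2) affine_set F d (map_mx ratr q) n.
have bD n : borel (D n).
  apply: countable_bigcupT_measurable => // q; apply: borel_closed.
  exact: closed_affine_set FL.
have Dnd m n : (m <= n)%N -> D m `<=` D n.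
  move=> mn x [q _ xq]; exists q => // v vn; apply: xq; apply: (le_trans vn).
  by rewrite lef_pV2 ?posrE// ler_nat.
pose N n := cball r `\` D n.
have bN n : borel (N n) by apply: measurableD; [exact: borel_cball|exact: bD].
have cv : outer (N n) @[n --> \oo] --> outer (\bigcap_n N n).
  apply: (@nonincreasing_cvg_mu _ (boxT R k.+2) _ (@leb R k.+1) N) => //.
  - apply: le_lt_trans (cball_fin r0); apply: le_lebesgue_outer; exact: subDsetl.
  - exact: bigcapT_measurable.
  - move=> m n mn; apply/subsetPset => x [xr xD]; split=> // xDm; apply: xD.
    exact: Dnd mn _ xDm.
have N0 : outer (\bigcap_n N n) = 0%E.
  apply: lebesgue_outer_null_sub (rademacher FL d0) => x xN q n xq.
  by have [_] := xN n I; apply; exists q.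
rewrite N0 in cv.
have [n nP] : exists n, (outer (N n) <= h%:E)%E.
  apply: contrapT => /forallNP H.
  have : (h%:E <= 0)%E.
    rewrite -(cvg_lim _ cv)//; apply: lime_ge; first by apply/cvg_ex; eexists; exact: cv.
    by apply: nearW => n; have /negP := H n; rewrite -ltNge => /ltW.
  by rewrite lee_fin leNgt h0.
exists (N n), n; split=> // x xr xN.
have [q _ xq] : D n x by apply: contrapT => xD; apply: xN.
by exists (map_mx ratr q).
Qed.

(* Iterated with constants [d = 2^-j], this exhibits F, off a small set, as a
   C^1-convergent series of C^1 functions. *)
Lemma lipschitz_split (F : V -> R) L d h r : 0 < L -> lipschitz F L -> 0 < d ->
  0 < h -> 0 <= r ->
  exists (N : set V) (G F' : V -> R),
    [/\ borel N /\ (outer N <= h%:E)%E, C1 G, lipschitz G (8 * k.+2%:R * L),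
        lipschitz F' d & forall x, `|x| <= r -> ~ N x -> F x = G x + F' x].
Proof.
move=> L0 FL d0 h0 r0.
have k0 : 0 < 9 * k.+2%:R :> R by rewrite mulr_gt0.
(* [d'] undoes the constant 9 * k.+2 of [spl_close]. *)
pose d' := d / (9 * k.+2%:R); have d'0 : 0 < d' by rewrite divr_gt0.
have [N [n [bN Nh NP]]] := lipschitz_uniformly_affine FL d'0 h0 r0.
pose e := n.+1%:R^-1 / 4 : R; have e0 : 0 < e by rewrite divr_gt0// invr_gt0.
have e4 : 4 * e <= n.+1%:R^-1 by rewrite /e mulrC divfK.
pose M := (Num.truncn (2 * r / e + 1)).+1.
have Mr : 2 * r / e + 1 <= M%:R by exact/ltW/Num.Theory.truncnS_gt.
pose G := spl r e M F.
have [|F' [F'd F'E]] :=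
    @mcshane R k.+1 (cball r `&` ~` N) (fun x => F x - G x) d (ltW d0).
  move=> x y [xr xN] [yr yN]; have [cx xc] := NP x xr xN; have [cy yc] := NP y yr yN.
  have := @spl_close _ _ r e M r0 e0 Mr F d' cx cy n x y d'0 e4 xr yr xc yc.
  by rewrite (_ : 9 * k.+2%:R * d' = d)// /d' mulrC divfK// gt_eqF.
exists N, G, F'; split=> //.
- exact: C1_spl.
- by apply: spl_lipschitz => //; exact: ltW.
- by move=> x xr xN; rewrite F'E// addrC subrK.
Qed.

Lemma lusin_C1 (F : V -> R) L h r : lipschitz F L -> 0 < h -> 0 <= r ->
  exists (N : set V) (g : V -> R),
    [/\ borel N, (outer N <= h%:E)%E, C1 g & forall x, `|x| <= r -> ~ N x -> F x = g x].
Proof.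
move=> FL' h0 r0; pose L1 := `|L| + 1.
have L10 : 0 < L1 by rewrite ltr_pwDr.
have FL : lipschitz F L1.
  move=> x y; apply: (le_trans (FL' x y)); rewrite ler_wpM2r//.
  by rewrite (le_trans (ler_norm L))// lerDl.
have p2 j : 0 < 2 ^- j :> R by rewrite invr_gt0 exprn_gt0.
(* The splitting is an implication so that it can be chosen for every pair; where the Lipschitz
   bound fails, any triple will do. *)
pose P (a : nat * (V -> R)) (b : set V * (V -> R) * (V -> R)) :=
  lipschitz a.2 (L1 * 2 ^- a.1) ->
  [/\ borel b.1.1 /\ (outer b.1.1 <= (h / (2 ^ a.1.+1)%:R)%:E)%E, C1 b.1.2,
      lipschitz b.1.2 (8 * k.+2%:R * (L1 * 2 ^- a.1)),
      lipschitz b.2 (L1 * 2 ^- a.1.+1) &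
      forall x, `|x| <= r -> ~ b.1.1 x -> a.2 x = b.1.2 x + b.2 x].
have [st stP] : {st & forall a, P a (st a)}.
  apply: choice => -[j H]; have [Hl|nHl] := pselect (lipschitz H (L1 * 2 ^- j)).
    have h2 : 0 < h / (2 ^ j.+1)%:R by rewrite divr_gt0// ltr0n expn_gt0.
    have [N [G [F' ?]]] := lipschitz_split (mulr_gt0 L10 (p2 j)) Hl
      (mulr_gt0 L10 (p2 j.+1)) h2 r0.
    by exists (N, G, F').
  by exists (set0, H, H).
pose Fs := fix Fs j := if j is j'.+1 then (st (j', Fs j')).2 else F.
have FsL j : lipschitz (Fs j) (L1 * 2 ^- j).
  elim: j => [|j IH]; first by rewrite expr0 invr1 mulr1.
  by have [] := stP (j, Fs j) IH.
pose Nj j := (st (j, Fs j)).1.1.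
pose Gj j := (st (j, Fs j)).1.2.
have sP j := stP (j, Fs j) (FsL j).
(* [C1_series] needs terms vanishing at 0. The constants dropped here are not known to be summable,
   so F and the sum g agree off [N] only up to a constant, which is read off at a point [x0]. *)
pose G j x := Gj j x - Gj j 0.
have GC j : C1 (G j).
  by have [_ GjC _ _ _] := sP j; exact: (C1_add GjC (C1_cst _ (- Gj j 0))).
have GL j : lipschitz (G j) (8 * k.+2%:R * L1 * 2 ^- j).
  have [_ _ GjL _ _] := sP j; move=> x y; rewrite -mulrA.
  by rewrite /G opprB addrA subrK; exact: GjL.
have G0 j : G j 0 = 0 by rewrite /G subrr.
have [g [Cg gP]] := C1_series GC GL G0.
pose N := \bigcup_j Nj j.
have bN : borel N by apply: bigcupT_measurable => j; have [[]] := sP j.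
have Nh : (outer N <= h%:E)%E.
  apply: (le_trans (@outer_measure_sigma_subadditive _ _ (@lebesgue_outer R k.+2) Nj)).
  apply: (@le_trans _ _ (\sum_(0 <= j <oo) (0 + (h / (2 ^ j.+1)%:R)%:E))%E).
    apply: lee_nneseries => [j _ _|j _]; first exact: lebesgue_outer_ge0.
    by rewrite add0e; have [[]] := sP j.
  apply: (le_trans (epsilon_trick _ _ (ltW h0))) => //.
  by rewrite eseries0// add0e.
have [NE|/existsNP[x0 /not_implyP[x0r x0N]]] :=
    pselect (forall x, `|x| <= r -> N x).
  exists N, (fun=> 0); split; [exact: bN|exact: Nh|exact: C1_cst|].
  by move=> x /NE xN /(_ xN).
exists N, (fun x => g x + (F x0 - g x0)).
split; [exact: bN|exact: Nh|exact: (C1_add Cg (C1_cst _ _))|].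
move=> x xr xN.
have FE y m : `|y| <= r -> ~ N y -> F y = \sum_(0 <= j < m) Gj j y + Fs m y.
  move=> yr yN; elim: m => [|m IH]; first by rewrite big_geq// add0r.
  rewrite big_nat_recr//= -addrA {}IH; congr (_ + _).
  have [_ _ _ _ E] := sP m; apply: (E y yr) => yNm.
  by apply: yN; exists m.
have key m : `|(F x - F x0) - (g x - g x0)| <=
    (L1 * `|x - x0| + 2 * (8 * k.+2%:R * L1 * `|x|) + 2 * (8 * k.+2%:R * L1 * `|x0|)) * 2 ^- m.
  have h1 := gP x m; have h2 := gP x0 m; have h3 := FsL m x x0.
  have -> : (F x - F x0) - (g x - g x0) = (Fs m x - Fs m x0) -
     (g x - \sum_(0 <= j < m) G j x) + (g x0 - \sum_(0 <= j < m) G j x0).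
    rewrite (FE x m xr xN) (FE x0 m x0r x0N) /G !sumrB; ring.
  apply: (le_trans (ler_normD _ _)).
  have h4 := ler_normB (Fs m x - Fs m x0) (g x - \sum_(0 <= j < m) G j x).
  rewrite mulrAC in h3; lra.
have H0 : F x - F x0 - (g x - g x0) = 0.
  apply/eqP; rewrite -normr_eq0 eq_le normr_ge0 andbT; apply/ler_addgt0Pr => e e0.
  set B := (L1 * _ + _ + _) in key; rewrite add0r.
  have B0 : 0 <= B by rewrite !addr_ge0// !mulr_ge0// ltW.
  apply: (le_trans (key (Num.truncn (B / e)))).
  rewrite ler_pdivrMr ?exprn_gt0// -ler_pdivrMl// mulrC; set t := B / e.
  apply: (le_trans (ltW (Num.Theory.truncnS_gt t))).
  by rewrite -natrX ler_nat ltn_expl.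
lra.
Qed.
End Lusin.

(** * The Carnot-Caratheodory distance *)

Section AbsoluteContinuity.
Context (R : realType).
Local Notation mu := (@lebesgue_measure R).

(* The integral is a supremum over the simple functions below the integrand.
   This matters because [s |-> hnorm (gamma s) (derive1 gamma s)] is not known
   to be measurable. *)
Lemma ge0_le_integral_lower (D : set R) (f g : R -> \bar R) :
  (forall x, D x -> 0 <= f x)%E -> (forall x, D x -> f x <= g x)%E ->
  (\int[mu]_(x in D) f x <= \int[mu]_(x in D) g x)%E.
Proof.
move=> f0 fg; have g0 x : D x -> (0 <= g x)%E.
  by move=> Dx; apply: le_trans (fg x Dx); exact: f0.
have -> := @ge0_integralE _ _ _ mu D f f0.
have -> := @ge0_integralE _ _ _ mu D g g0.
apply: ge_ereal_sup => _ [h hf <-]; apply: ereal_sup_ubound; exists h => // x.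
by apply: (le_trans (hf x)); apply: lee_restrict.
Qed.

(** Let c be the supremum of the x up to which the estimate holds. The local hypothesis on intervals
    containing c carries the estimate from a point just below c to a point beyond c, unless b is
    reached. *)
Lemma local_to_global (a b : R) (u P : R -> R) : a <= b ->
  (forall s, a <= s <= b -> exists2 d, 0 < d & forall x y,
    a <= x -> y <= b -> s - d < x -> x <= s -> s <= y -> y < s + d ->
    `|u y - u x| <= P y - P x) ->
  `|u b - u a| <= P b - P a.
Proof.
move=> ab H.
pose S := [set x | a <= x <= b /\ `|u x - u a| <= P x - P a].
have Sa : S a by split; rewrite ?lexx ?ab// !subrr normr0.
have Sub : has_ubound S by exists b => x [/andP[]].
have Ssup : has_sup S by split; [exists a|].
pose c := sup S.
have ac : a <= c by exact: sup_upper_bound.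
have cb : c <= b by apply: (ge_sup (ex_intro _ a Sa)) => x [/andP[]].
have acb : a <= c <= b by rewrite ac cb.
have [d d0 Hd] := H c acb.
have [x Sx cx] := sup_adherent d0 Ssup.
have [/andP[ax xb] xP] := Sx.
have xc : x <= c by exact: sup_upper_bound.
pose y := Num.min b (c + d / 2).
have yb : y <= b by rewrite ge_min lexx.
have cy : c <= y by rewrite le_min cb/= lerDl divr_ge0// ltW.
have yd : y < c + d by rewrite gt_min ltrD2l; apply/orP; right; lra.
have Sy : S y.
  split; first by rewrite yb andbT; exact: le_trans ax (le_trans xc cy).
  rewrite -[u y - u a](subrKA (u x)); apply: (le_trans (ler_normD _ _)).
  by have := Hd x y ax yb cx xc cy yd; lra.
have yc : y <= c by exact: sup_upper_bound.
have byE : y = b.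
  by apply/eqP; rewrite eq_le yb/=; move: yc; rewrite ge_min => /orP[bc|]; [|lra];
    exact: le_trans bc cy.
by move: Sy; rewrite byE => -[].
Qed.

Definition acR (a b : R) (u : R -> R) := forall e : R, 0 < e -> exists2 d, 0 < d &
  forall (N : nat) (s t : 'I_N -> R),
    (forall i, [/\ a <= s i, s i <= t i & t i <= b]) ->
    trivIset setT (fun i => `]s i, t i[%classic) ->
    \sum_(i < N) (t i - s i) < d -> \sum_(i < N) `|u (t i) - u (s i)| < e.

(** The supremum of these sums is the variation of u over the part of [a, x] inside O; [ac_sums_lt]
    makes it small when O has small measure. *)
Definition ac_sums (a : R) (O : set R) (u : R -> R) (x : R) : set R :=
  [set S | exists N (s t : 'I_N -> R), [/\
    forall i, [/\ a <= s i, s i <= t i & t i <= x],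
    trivIset setT (fun i => `]s i, t i[%classic),
    (forall i, `]s i, t i[%classic `<=` O) &
    S = \sum_(i < N) `|u (t i) - u (s i)|]].

Lemma ac_sums0 a O u x : ac_sums a O u x 0.
Proof.
exists 0%N, (fun=> 0), (fun=> 0); split=> [[]//| |[]//|]; last by rewrite big_ord0.
by move=> [].
Qed.

Lemma ac_sums_add a O u x y S : x <= y -> a <= x -> `]x, y[%classic `<=` O ->
  ac_sums a O u x S -> ac_sums a O u y (S + `|u y - u x|).
Proof.
move=> xy ax xyO [N [s [t [st tst stO ->]]]].
pose s' (i : 'I_N.+1) := if unlift ord_max i is Some j then s j else x.
pose t' (i : 'I_N.+1) := if unlift ord_max i is Some j then t j else y.
exists N.+1, s', t'; split.
- move=> i; rewrite /s' /t'; case: unliftP => [j _|_]; last by [].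
  by have [h1 h2 h3] := st j; split=> //; exact: le_trans xy.
- apply/trivIsetP => i j _ _; rewrite /s' /t'.
  case: unliftP => [i' ->|->]; case: unliftP => [j' ->|->] ij //.
  + move/trivIsetP : tst => /(_ i' j' I I); apply.
    by apply: contraNneq ij => ->.
  + rewrite -subset0 => z [] /=; rewrite !in_itv/= => /andP[_ zt] /andP[xz _].
    have [_ _ tx] := st i'; have := lt_le_trans (lt_trans xz zt) tx.
    by rewrite ltxx.
  + rewrite -subset0 => z [] /=; rewrite !in_itv/= => /andP[xz _] /andP[_ zt].
    have [_ _ tx] := st j'; have := lt_le_trans (lt_trans xz zt) tx.
    by rewrite ltxx.
  + by move: ij; rewrite eqxx.
- by move=> i; rewrite /s' /t'; case: unliftP => [j _|_]; [exact: stO|exact: xyO].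
- rewrite big_ord_recr /=; congr (_ + _); last by rewrite /s' /t' unlift_none.
  apply: eq_bigr => i _; rewrite /s' /t'.
  rewrite (_ : widen_ord (leqnSn N) i = lift ord_max i) ?liftK//.
  by apply: val_inj; rewrite /= /bump leqNgt ltn_ord.
Qed.

Lemma ac_sums_lt a b u e d O x S : (forall (N : nat) (s t : 'I_N -> R),
    (forall i, [/\ a <= s i, s i <= t i & t i <= b]) ->
    trivIset setT (fun i => `]s i, t i[%classic) ->
    \sum_(i < N) (t i - s i) < d -> \sum_(i < N) `|u (t i) - u (s i)| < e) ->
  measurable O -> (mu O < d%:E)%E -> x <= b -> ac_sums a O u x S -> S < e.
Proof.
move=> H mO Od xb [N [s [t [st tst stO ->]]]].
apply: H => // [i|]; first by have [h1 h2 h3] := st i; split=> //; exact: le_trans xb.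
rewrite -lte_fin; apply: le_lt_trans Od.
have mI i : measurable (`]s i, t i[%classic : set (measurableTypeR R)).
  exact: measurable_itv.
have Ei i : mu `]s i, t i[%classic = (t i - s i)%:E.
  have [_ sti _] := st i.
  rewrite lebesgue_measure_itv/= lte_fin; case: ltP => // ts.
  by congr EFin; apply/esym/eqP; rewrite subr_eq0 eq_le ts sti.
have E : (\sum_(i < N) (t i - s i))%:E = mu (\big[setU/set0]_(i < N) `]s i, t i[%classic).
  rewrite measure_bigsetU_ord//.
  by rewrite -sumEFin; apply: eq_bigr => i _; exact: (esym (Ei i)).
rewrite E; apply: le_measure; rewrite ?inE; [|exact: mO|].
  by apply: bigsetU_measurable => i _; exact: mI.
by rewrite -bigcup_seq => x0 [i _]; exact: stO.
Qed.

Definition lm (O : set R) (a x : R) : R := fine (mu (O `&` `[a, x]%classic)).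

Lemma lm_fin (O : set (measurableTypeR R)) a x : measurable O ->
  mu (O `&` `[a, x]%classic) \is a fin_num.
Proof.
move=> mO; have mI : measurable (`[a, x]%classic : set (measurableTypeR R)).
  exact: measurable_itv.
rewrite ge0_fin_numE//; apply: (@le_lt_trans _ _ (mu `[a, x]%classic)).
  apply: le_measure; rewrite ?inE; [exact: measurableI|exact: mI|].
  by move=> z [].
by rewrite lebesgue_measure_itv/=; case: ifP => _ //; rewrite -EFinB ltry.
Qed.

Lemma lm_mono (O : set (measurableTypeR R)) a x y : measurable O -> x <= y ->
  lm O a x <= lm O a y.
Proof.
move=> mO xy; rewrite fine_le ?lm_fin//.
have mI z : measurable (O `&` `[a, z]%classic : set (measurableTypeR R)).
  by apply: measurableI => //; exact: measurable_itv.
apply: le_measure; rewrite ?inE; [exact: mI|exact: mI|].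
by apply: setIS => z /=; rewrite !in_itv/= => /andP[-> /le_trans->].
Qed.

Lemma lm_inc (O : set (measurableTypeR R)) a x y : measurable O -> a <= x ->
  x <= y -> `]x, y]%classic `<=` O -> y - x <= lm O a y - lm O a x.
Proof.
move=> mO ax xy xyO; rewrite lerBrDr -lee_fin EFinD fineK ?lm_fin//.
have mI z : measurable (O `&` `[a, z]%classic : set (measurableTypeR R)).
  by apply: measurableI => //; exact: measurable_itv.
have mJ : measurable (`]x, y]%classic : set (measurableTypeR R)).
  exact: measurable_itv.
have -> : (y - x)%:E = mu `]x, y]%classic.
  rewrite lebesgue_measure_itv/= lte_fin; case: ltP => // yx.
  by congr EFin; apply/eqP; rewrite subr_eq0 eq_le xy yx.
rewrite fineK ?lm_fin// -measureU//; last first.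
  rewrite -subset0 => z [] /=; rewrite in_itv/= => /andP[xz _] [_].
  by rewrite in_itv/= => /andP[_ /(lt_le_trans xz)]; rewrite ltxx.
apply: le_measure; rewrite ?inE; [exact: measurableU|exact: mI|].
move=> z [|[Oz]] /= zz; split=> //; first exact: xyO.
  move: zz; rewrite !in_itv/= => /andP[/ltW/(le_trans ax) -> ->]//.
by move: zz; rewrite !in_itv/= => /andP[-> /le_trans->].
Qed.

(** A substitute for the set where the derivative of v is at most c in absolute value; for
    continuous v it is a countable union of closed sets, hence measurable. *)
Definition slope_set (v : R -> R) (c : R) : set R := [set s | exists n : nat,
  forall h, `|h| < n.+1%:R^-1 -> `|v (s + h) - v s| <= c * `|h|].

Lemma slope_set_measurable (v : R -> R) (c : R) : continuous v ->
  measurable (slope_set v c : set (measurableTypeR R)).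
Proof.
move=> cv.
rewrite (_ : slope_set v c = \bigcup_n \bigcap_(h in [set h | `|h| < n.+1%:R^-1])
   [set s | `|v (s + h) - v s| <= c * `|h|]); last first.
  by apply/seteqP; split=> [s [n H]|s [n _ H]]; exists n.
apply: bigcup_measurable => n _; apply: closed_measurable.
apply: closed_bigI => h _.
pose g s := `|v (s + h) - v s|.
rewrite (_ : mkset _ = g @^-1` [set z | z <= c * `|h|])//.
apply: closed_comp; last exact: closed_le.
move=> s _; apply: cvg_norm; apply: cvgB; last exact: cv.
apply: continuous_comp; last exact: cv.
by apply: cvgD; [exact: cvg_id|exact: cvg_cst].
Qed.

Lemma slope_set_mono (v : R -> R) (c c' : R) : c <= c' ->
  slope_set v c `<=` slope_set v c'.
Proof.
move=> cc s [n H]; exists n => h /H /le_trans; apply.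
by rewrite ler_wpM2r.
Qed.

Lemma slope_set_derive (v : R -> R) s c : derivable v s 1 -> `|derive1 v s| < c ->
  slope_set v c s.
Proof.
move=> dv vc.
have : \forall h \near 0^', `|h^-1 *: (v (h *: (1:R) + s) - v s)| < c.
  have /cvg_norm : h^-1 *: (v (h *: (1:R) + s) - v s) @[h --> 0^'] --> derive1 v s.
    by rewrite derive1E; exact: dv.
  by move/cvgr_lt; apply.
move=> /nbhs_ballP[d /= d0 Hd].
have [n nd] := ltr_add_invr d0.
exists n => h hn; have [->|h0] := eqVneq h 0.
  by rewrite addr0 subrr !normr0 mulr0.
have := Hd h; rewrite /ball/= sub0r normrN => /(_ _ h0).
move: nd; rewrite add0r => nd /(_ (lt_trans hn nd)).
rewrite normrZ normfV scaler1 [h + s]addrC => /ltW.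
by rewrite mulrC ler_pdivrMr ?normr_gt0.
Qed.

(** Lower sums: the simple function with value [c j] on [A j] lies below h on D, and only that
    function has to be measurable. *)
Lemma layer_integral_le (D : set (measurableTypeR R))
    (A : nat -> set (measurableTypeR R)) (c : nat -> R) (h : R -> \bar R) (M : nat) :
  measurable D -> (forall j, measurable (A j)) -> trivIset setT A ->
  (forall j, A j `<=` D) -> (forall j, 0 <= c j) ->
  (forall x, 0 <= h x)%E -> (forall j x, A j x -> (c j)%:E <= h x)%E ->
  (\sum_(j < M) (c j)%:E * mu (A j) <= \int[mu]_(x in D) h x)%E.
Proof.
move=> mD mA tA AD c0 h0 ch.
pose g (j : 'I_M) (x : measurableTypeR R) : \bar R := ((c j)%:E * (\1_(A j) x)%:E)%E.
have mI (j : 'I_M) : measurable_fun D (fun x : measurableTypeR R => (\1_(A j) x : R)%:E).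
  apply/measurable_EFinP; exact: measurable_indic.
have g0 j x : (0 <= g j x)%E by rewrite mule_ge0// lee_fin.
have -> : (\sum_(j < M) (c j)%:E * mu (A j) = \int[mu]_(x in D) \sum_(j < M) g j x)%E.
  rewrite ge0_integral_sum//; last by move=> j; apply: measurable_funeM; exact: mI.
  apply: eq_bigr => j _; rewrite ge0_integralZl_EFin//.
  by rewrite integral_indic// setIidl.
apply: ge0_le_integral_lower => x Dx; first exact: sume_ge0.
have [[j Ajx]|noA] := pselect (exists j : 'I_M, A j x).
  rewrite (bigD1 j)//= big1 ?adde0; last first.
    move=> i ij; rewrite /g indicE memNset ?mule0// => Aix.
    move/trivIsetP : tA => /(_ i j I I ij)/seteqP[/(_ x) + _].
    by apply.
  by rewrite /g indicE mem_set// mule1; exact: ch.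
rewrite big1// => j _; rewrite /g indicE memNset ?mule0// => Ajx.
by apply: noA; exists j.
Qed.

(** The good points are sorted into layers [A j] with slope between j * e and (j + 1) * e; finitely
    many layers fill [a, b] up to a set [Z m] of small measure. Near every point the increments of
    P1 + P2 dominate those of v: [P1] integrates the slope rounded up over open sets around the
    layers, and [P2] is the variation of v in an open set around [Z m]. The slope rounded down lies
    below h. *)
Lemma ac_integral_le_cont (a b : R) (v : R -> R) (h : R -> \bar R) :
  a < b -> continuous v -> acR a b v -> (forall x, 0 <= h x)%E ->
  {ae mu, forall s, `]a, b[%classic s ->
     derivable v s 1 /\ (`|derive1 v s|%:E <= h s)%E} ->
  (`|v b - v a|%:E <= \int[mu]_(s in `[a, b]) h s)%E.
Proof.
move=> ab cv acv h0 [N [mN N0 HN]].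
apply/lee_addgt0Pr => e' e'0.
(* The error e' is spent as e * (b - a) for rounding the slopes, one e for the excess of the [V j]
   over the [A j], and one e for the variation inside [UZ]. *)
pose e := e' / (b - a + 2).
have e0 : 0 < e by rewrite divr_gt0//; lra.
pose D : set (measurableTypeR R) := `]a, b[%classic `\` N.
have mab : measurable (`]a, b[%classic : set (measurableTypeR R)) by exact: measurable_itv.
have mcab : measurable (`[a, b]%classic : set (measurableTypeR R)) by exact: measurable_itv.
have mD : measurable D by exact: measurableD.
have HD s : D s -> derivable v s 1 /\ (`|derive1 v s|%:E <= h s)%E.
  move=> [abs Ns]; apply: contrapT => nP; apply: Ns; apply: HN => /= P; apply: nP.
  exact: P.
pose F (j : nat) : set (measurableTypeR R) := slope_set v (j.+1%:R * e) `&` D.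
have mF j : measurable (F j) by apply: measurableI => //; exact: slope_set_measurable.
have ndF : {homo F : i j / (i <= j)%N >-> (i <= j)%O}.
  move=> i j ij; apply/subsetPset; apply: setSI; apply: slope_set_mono.
  by rewrite ler_wpM2r ?ler_nat// ltW.
pose Z (m : nat) : set (measurableTypeR R) := `[a, b]%classic `\` F m.
have mZ m : measurable (Z m) by exact: measurableD.
have [d d0 Hd] := acv e e0.
have [m Zm] : exists m, (mu (Z m) < d%:E)%E.
  have mbZ : measurable (\bigcap_n Z n) by exact: bigcap_measurable.
  have bZ0 : mu (\bigcap_n Z n) = 0%E.
    apply/eqP; rewrite eq_le measure_ge0 andbT.
    have mU : measurable (N `|` [set a] `|` [set b] : set (measurableTypeR R)).
      by apply: measurableU; [apply: measurableU|]; [exact: mN|exact: measurable_set1|exact: measurable_set1].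
    have -> : 0%E = mu (N `|` [set a] `|` [set b]).
      rewrite measureU0; [|by apply: measurableU; [exact: mN|exact: measurable_set1]|exact: measurable_set1|exact: lebesgue_measure_set1].
      by rewrite measureU0; [|exact: mN|exact: measurable_set1|exact: lebesgue_measure_set1].
    apply: le_measure; rewrite ?inE; [exact: mbZ|exact: mU|].
    move=> s Zs; have [-> | sa] := eqVneq s a; first by left; right.
    have [-> | sb] := eqVneq s b; first by right.
    left; left; apply: contrapT => Ns.
    have [abs _] := Zs 0%N I.
    have Ds : D s.
      split=> //; move: abs; rewrite /= !in_itv/= => /andP[as_ sb_].
      by rewrite !lt_neqAle eq_sym sa sb as_ sb_.
    have [n vn] : exists n : nat, `|derive1 v s| / e < n.+1%:R.
      by exists (Num.truncn (`|derive1 v s| / e)); exact: Num.Theory.truncnS_gt.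
    have [_] := Zs n I; apply; split=> //; apply: slope_set_derive; first by have [] := HD _ Ds.
    by rewrite -ltr_pdivrMr.
  have : mu (Z n) @[n --> \oo] --> mu (\bigcap_n Z n).
    apply: nonincreasing_cvg_mu => //.
    - apply: (@le_lt_trans _ _ (mu `[a, b]%classic)).
        by apply: le_measure; rewrite ?inE; [exact: mZ|exact: mcab|exact: subDsetl].
      by rewrite lebesgue_measure_itv/= lte_fin ab -EFinB ltry.
    - by move=> i j ij; apply/subsetPset; apply: setDS; apply/subsetPset; exact: ndF.
  rewrite bZ0 => /(_ _ (@open_ereal_lt' R 0%E d%:E _)).
  rewrite lte_fin => /(_ d0)[m _ Hm].
  by exists m; apply: Hm => /=.
have [UZ [oUZ ZUZ UZd]] : exists O, [/\ open O, Z m `<=` O & (mu O < d%:E)%E].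
  have fZ : mu (Z m) \is a fin_num.
    by rewrite ge0_fin_numE//; exact: lt_trans Zm (ltry _).
  have dZ : 0 < d - fine (mu (Z m)) by rewrite subr_gt0 -lte_fin fineK.
  have [U [oU ZU Ult]] := lebesgue_regularity_outer (mZ m) (lt_trans Zm (ltry _)) dZ.
  exists U; split=> //.
  have mU : measurable (U : set (measurableTypeR R)) by exact: open_measurable.
  have MU : mu U = (mu (Z m) + mu (U `\` Z m))%E.
    by rewrite -{1}(setDUK ZU) measureU ?setDIK//; exact: measurableD.
  rewrite MU.
  have fO : mu (U `\` Z m) \is a fin_num.
    by rewrite ge0_fin_numE//; exact: lt_trans Ult (ltry _).
  by move: Ult; rewrite EFinB fineK// lteBrDl.
have mUZ : measurable (UZ : set (measurableTypeR R)) by exact: open_measurable.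
pose A := seqD F.
have seqDex i s : F i s -> exists2 j, (j < i.+1)%N & A j s.
  elim: i => [|i IH] Fs; first by exists 0%N.
  have [/IH[j jm Aj]|nF] := pselect (F i s); first by exists j => //; exact: ltnW.
  by exists i.+1.
pose M := m.+1.
have mA j : measurable (A j).
  by rewrite /A /seqD; case: j => [|j]; [exact: mF|exact: measurableD].
have AF j : A j `<=` F j by rewrite /A /seqD; case: j => [|j] // x [].
have AD j : A j `<=` D by move=> x /AF[].
have Aab j : A j `<=` `[a, b]%classic.
  by move=> x /AD[/subset_itv_oo_cc].
have muA j : (mu (A j) < +oo)%E.
  apply: (@le_lt_trans _ _ (mu `[a, b]%classic)).
    by apply: le_measure; rewrite ?inE; [exact: mA|exact: mcab|exact: Aab].
  by rewrite lebesgue_measure_itv/= lte_fin ab -EFinB ltry.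
(* M layers, with coefficients at most M * e and excess at most [eta] each, cost at most e
   together. *)
pose eta : R := (M * M)%:R^-1.
have eta0 : 0 < eta by rewrite invr_gt0 ltr0n.
have /boolp.choice[V HO] : forall j, exists O, [/\ open O, A j `<=` O &
    (mu (O `\` A j) < eta%:E)%E].
  by move=> j; exact: (lebesgue_regularity_outer (mA j) (muA j) eta0).
have mO j : measurable (V j : set (measurableTypeR R)).
  by have [oO _ _] := HO j; exact: open_measurable.
pose P1 x := \sum_(j < M) (j.+1%:R * e) * lm (V j) a x.
pose P2 x := sup (ac_sums a UZ v x).
have c0 (j : nat) : 0 <= j.+1%:R * e by rewrite mulr_ge0// ltW.
have P1mono x y : x <= y -> P1 x <= P1 y.
  by move=> xy; apply: ler_sum => j _; rewrite ler_wpM2l//; exact: lm_mono.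
have subO x S : x <= b -> ac_sums a UZ v x S -> S < e.
  by move=> xb; exact: (ac_sums_lt Hd mUZ UZd xb).
have hs x : x <= b -> has_sup (ac_sums a UZ v x).
  move=> xb; split; first by exists 0; exact: ac_sums0.
  by exists e => S /(subO _ _ xb)/ltW.
have P2add x y : a <= x -> x <= y -> y <= b -> `]x, y[%classic `<=` UZ ->
    P2 x + `|v y - v x| <= P2 y.
  move=> ax xy yb xyO; rewrite -lerBrDr; apply: ge_sup.
    by exists 0; exact: ac_sums0.
  move=> S HS; rewrite lerBrDr; apply: sup_upper_bound; first exact: hs.
  exact: ac_sums_add.
have P2mono x y : a <= x -> x <= y -> y <= b -> P2 x <= P2 y.
  move=> ax xy yb; apply: ge_sup; first by exists 0; exact: ac_sums0.
  move=> S [n [s [t [st tst stO ->]]]]; apply: sup_upper_bound; first exact: hs.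
  exists n, s, t; split=> // i; have [h1 h2 h3] := st i; split=> //.
  exact: le_trans xy.
have main : `|v b - v a| <= (P1 b + P2 b) - (P1 a + P2 a).
  apply: (@local_to_global a b v (fun x => P1 x + P2 x) (ltW ab)) => s sab.
  have [Zs|nZs] := pselect (Z m s).
    have /nbhs_ballP[d1 /= d10 Hd1] : nbhs s UZ by apply: open_nbhs_nbhs; split=> //; exact: ZUZ.
    exists d1 => // x y ax yb sx xs sy ys.
    have xy : x <= y by exact: le_trans sy.
    have := P1mono _ _ xy; have : P2 x + `|v y - v x| <= P2 y; last lra.
    apply: P2add => // z /=; rewrite in_itv/= => /andP[xz zy]; apply: Hd1.
    by rewrite /ball/= ltr_distlC; apply/andP; split; lra.
  have [j jM Ajs] : exists2 j, (j < M)%N & A j s.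
    apply: seqDex; apply: contrapT => nF; apply: nZs; split=> //.
  have [oOj AOj _] := HO j.
  have /nbhs_ballP[d1 /= d10 Hd1] : nbhs s (V j).
    by apply: open_nbhs_nbhs; split=> //; exact: AOj.
  have [[n Hn] _] := AF _ _ Ajs.
  exists (Num.min d1 n.+1%:R^-1); first by rewrite lt_min d10 invr_gt0 ltr0n.
  move=> x y ax yb sx xs sy ys.
  have [sx1 sx2] : s - x < d1 /\ s - x < n.+1%:R^-1.
    by apply/andP; rewrite -lt_min ltrBlDr -ltrBlDl.
  have [sy1 sy2] : y - s < d1 /\ y - s < n.+1%:R^-1.
    by apply/andP; rewrite -lt_min ltrBlDl.
  have xy : x <= y by exact: le_trans sy.
  have vxy : `|v y - v x| <= (j.+1%:R * e) * (y - x).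
    have := Hn (x - s); have := Hn (y - s).
    rewrite (_ : s + (x - s) = x); last by rewrite addrC subrK.
    rewrite (_ : s + (y - s) = y); last by rewrite addrC subrK.
    have -> : `|y - s| = y - s by rewrite ger0_norm// subr_ge0.
    have -> : `|x - s| = s - x by rewrite distrC ger0_norm// subr_ge0.
    move=> /(_ sy2) h2 /(_ sx2) h1.
    rewrite -[v y - v x](subrKA (v s)); apply: (le_trans (ler_normD _ _)).
    have -> : y - x = (y - s) + (s - x) by rewrite subrKA.
    rewrite mulrDr; apply: lerD; [exact: h2|by rewrite distrC].
  have := P2mono x y ax xy yb; have : `|v y - v x| <= P1 y - P1 x; last lra.
  rewrite /P1 -sumrB (bigD1 (Ordinal jM))//=.
  rewrite -[X in X <= _]addr0 lerD//.
    apply: (le_trans vxy); rewrite -mulrBr ler_wpM2l//; apply: lm_inc => //.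
    move=> z /=; rewrite in_itv/= => /andP[xz zy]; apply: Hd1.
    by rewrite /ball/= ltr_distlC; apply/andP; split; lra.
  by apply: sumr_ge0 => i _; rewrite -mulrBr mulr_ge0// subr_ge0; exact: lm_mono.
have P2b : P2 b <= e.
  by apply: ge_sup; [exists 0; exact: ac_sums0|move=> S /(subO _ _ (lexx b))/ltW].
have P2a : 0 <= P2 a.
  by apply: sup_upper_bound; [exact/hs/ltW|exact: ac_sums0].
have P1a : 0 <= P1 a.
  by apply: sumr_ge0 => j _; rewrite mulr_ge0//; apply: fine_ge0; exact: measure_ge0.
have fA j : mu (A j) \is a fin_num by rewrite ge0_fin_numE//; exact: muA.
have tA : trivIset setT A by exact: trivIset_seqD.
have lmO j : lm (V j) a b <= fine (mu (A j)) + eta.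
  have [_ AO Oe] := HO j.
  have mOA : measurable (V j `\` A j : set (measurableTypeR R)) by exact: measurableD.
  have fOA : mu (V j `\` A j) \is a fin_num.
    by rewrite ge0_fin_numE//; exact: lt_trans Oe (ltry _).
  rewrite -lee_fin EFinD !fineK ?lm_fin//.
  apply: (@le_trans _ _ (mu (V j))).
    by apply: le_measure; rewrite ?inE; [exact: measurableI|exact: mO|exact: subIsetl].
  have -> : mu (V j) = (mu (A j) + mu (V j `\` A j))%E.
    by rewrite -{1}(setDUK AO) measureU ?setDIK.
  by rewrite leeD2lE//; exact: ltW.
have sumA : \sum_(j < M) fine (mu (A j)) <= b - a.
  rewrite -lee_fin -sumEFin.
  rewrite (_ : (\sum_(j < M) (fine (mu (A j)))%:E)%E = mu (\big[setU/set0]_(j < M) A j)).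
    have -> : (b - a)%:E = mu `[a, b]%classic by rewrite lebesgue_measure_itv/= lte_fin ab.
    apply: le_measure; rewrite ?inE; [exact: bigsetU_measurable|exact: mcab|].
    by rewrite -bigcup_mkord => x [j _ /Aab].
  rewrite measure_bigsetU//.
  by apply: eq_bigr => j _; rewrite fineK.
have layer := layer_integral_le M mD mA tA AD
  (fun j => mulr_ge0 (ler0n R j) (ltW e0)) h0.
have {}layer : (\sum_(j < M) (j%:R * e)%:E * mu (A j) <= \int[mu]_(x in D) h x)%E.
  apply: layer => -[|j] x Ajx; first by rewrite mul0r.
  have [dx hx] := HD x (AD _ _ Ajx).
  apply: le_trans hx; rewrite lee_fin leNgt; apply/negP => lt.
  have [_ +] := Ajx; apply; split; [exact: slope_set_derive|exact: (AD _ _ Ajx)].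
have DI : (\int[mu]_(x in D) h x <= \int[mu]_(x in `[a, b]) h x)%E.
  rewrite integral_mkcond [leRHS]integral_mkcond; apply: ge0_le_integral_lower => x _.
    exact: erestrict_ge0.
  rewrite !patchE; case: ifPn => [|_]; last by case: ifPn.
  by rewrite inE => -[/subset_itv_oo_cc xab _]; rewrite mem_set.
have {DI}layer := le_trans layer DI.
apply: (@le_trans _ _ ((\sum_(j < M) (j%:R * e) * fine (mu (A j)))%:E + e'%:E)%E); last first.
  rewrite leeD2r// -sumEFin; move: layer; apply: le_trans.
  by apply: lee_sum => j _; rewrite EFinM fineK.
rewrite -EFinD lee_fin; apply: (le_trans main).
have P1b : P1 b <= \sum_(j < M) (j%:R * e) * fine (mu (A j)) + e * (b - a) + e.
  apply: (@le_trans _ _ (\sum_(j < M) ((j%:R * e) * fine (mu (A j))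
     + e * fine (mu (A j)) + (j.+1%:R * e) * eta))).
    apply: ler_sum => j _; have := ler_wpM2l (c0 j) (lmO j).
    move=> /le_trans; apply; rewrite mulrDr lerD2r.
    by rewrite -natr1 mulrDl mul1r mulrDl.
  rewrite !big_split/= lerD//.
    by rewrite lerD2l -mulr_sumr ler_wpM2l// ltW.
  rewrite -mulr_suml -mulr_suml; apply: (@le_trans _ _ ((M * M)%:R * e * eta)).
    rewrite ler_wpM2r ?(ltW eta0)// ler_wpM2r ?(ltW e0)//.
    rewrite natrM -[X in _ <= _ * X%:R](card_ord M) -sumr_const mulr_sumr.
    by apply: ler_sum => j _; rewrite mulr1 ler_nat.
  by rewrite mulrAC /eta divff ?mul1r// pnatr_eq0 muln_eq0.
have -> : e' = e * (b - a) + e + e.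
  have ne : b - a + 2 != 0 by apply: lt0r_neq0; lra.
  by rewrite -[LHS](divfK ne) -/e; lra.
lra.
Qed.
End AbsoluteContinuity.

(** * Horizontal curves and the contact form *)

Section HorizontalCurves.
Context (R : realType).
Local Notation mu := (@lebesgue_measure R).

(** Freezing u outside [a, b] gives a continuous function on the line with the same derivative in
    the open interval. *)
Lemma ac_integral_le (a b : R) (u : R -> R) (h : R -> \bar R) :
  a < b -> acR a b u -> (forall x, 0 <= h x)%E ->
  {ae mu, forall s, `[a, b]%classic s ->
     derivable u s 1 /\ (`|derive1 u s|%:E <= h s)%E} ->
  (`|u b - u a|%:E <= \int[mu]_(s in `[a, b]) h s)%E.
Proof.
move=> ab acu h0 aeu.
pose cl x := Num.min b (Num.max a x).
have cl_id x : a <= x <= b -> cl x = x.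
  by move=> /andP[ax xb]; rewrite /cl (max_idPr ax) (min_idPr xb).
have cl_in x : a <= cl x <= b.
  by rewrite /cl le_min (ltW ab) le_max lexx/= ge_min lexx.
have cl_mono x y : x <= y -> cl x <= cl y /\ cl y - cl x <= y - x.
  by move=> xy; rewrite /cl /Num.min /Num.max; case: (ltP a x) => ?; case: (ltP a y) => ?;
    do 2?case: ltP => ?; split; lra.
pose v := u \o cl.
have va : v a = u a by rewrite /v/= cl_id// lexx ltW.
have vb : v b = u b by rewrite /v/= cl_id// lexx andbT ltW.
have v_in x : a <= x <= b -> v x = u x by move=> /cl_id; rewrite /v/= => ->.
rewrite -va -vb; apply: ac_integral_le_cont => //.
- move=> x; apply/(@cvgrPdist_lt _ _ _ _ (nbhs_filter x)) => e e0.
  have [d d0 Hd] := acu e e0.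
  have step y z : y <= z -> z - y < d -> `|v z - v y| < e.
    move=> yz zyd; have [cyz cd] := cl_mono _ _ yz.
    have := Hd 1%N (fun=> cl y) (fun=> cl z); rewrite !big_ord1; apply.
    + by move=> _; have /andP[] := cl_in y; have /andP[] := cl_in z.
    + by apply/trivIsetP => i j _ _; rewrite !ord1 eqxx.
    + exact: le_lt_trans cd zyd.
  apply/nbhs_ballP; exists d => //= y; rewrite /ball/= => xy.
  have [yx|xy'] := leP y x.
    by apply: step => //; rewrite -[X in X < _]ger0_norm ?subr_ge0.
  rewrite distrC; apply: step; first exact: ltW.
  by rewrite -[X in X < _]ger0_norm ?subr_ge0 1?distrC// ltW.
- move=> e e0; have [d d0 Hd] := acu e e0; exists d => // N s t st tst sd.
  have := Hd N s t st tst sd.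
  by congr (_ < _); apply: eq_bigr => i _; have [h1 h2 h3] := st i;
    rewrite !v_in// ?h1 ?h3 ?andbT; [exact: le_trans h3|exact: le_trans h2].
- move: aeu; apply: filterS; first exact: (ae_filter_ringOfSetsType mu).
  move=> s H abs; have [|du hu] := H _; first exact: subset_itv_oo_cc.
  have near_uv : \near s, u s = v s.
    have : nbhs s `]a, b[%classic by apply: open_nbhs_nbhs; split => //; exact: interval_open.
    apply: filterS => z; rewrite /= in_itv/= => /andP[az zb].
    by rewrite v_in// !ltW.
  split; first exact: (near_eq_derivable near_uv).
  by rewrite derive1E -(near_eq_derive (1 : R) near_uv) -derive1E.
Qed.

Lemma linB m (c u v : 'rV[R]_m.+1) : lin c (u - v) = lin c u - lin c v.
Proof. by rewrite /lin -sumrB; apply: eq_bigr => j _; rewrite !mxE mulrBr. Qed.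

Lemma linD m (c u v : 'rV[R]_m.+1) : lin c (u + v) = lin c u + lin c v.
Proof. by rewrite /lin -big_split; apply: eq_bigr => j _; rewrite !mxE mulrDr. Qed.

Lemma linZ m (c v : 'rV[R]_m.+1) (r : R) : lin c (r *: v) = r * lin c v.
Proof. by rewrite /lin mulr_sumr; apply: eq_bigr => j _; rewrite !mxE mulrCA. Qed.

Lemma is_derive_lin (m : nat) (c : 'rV[R]_m.+1) (g : R -> 'rV[R]_m.+1) s :
  derivable g s 1 -> is_derive s 1 (fun x => lin c (g x)) (lin c (derive1 g s)).
Proof.
move=> dg.
have E : (fun h => h^-1 *: (((fun x => lin c (g x)) \o shift s) (h *: (1 : R)) - lin c (g s)))
   @ 0^' --> lin c (derive1 g s).
  rewrite (_ : (fun _ => _) = lin c \o (fun h => h^-1 *: ((g \o shift s) (h *: (1:R)) - g s))).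
    apply: continuous_cvg; first exact: lin_continuous.
    by rewrite derive1E; exact: dg.
  by apply/funext => h /=; rewrite linZ linB.
by apply: DeriveDef; [exact: cvgP E|rewrite /derive; exact: cvg_lim E].
Qed.

Lemma enorm_ge0 m (v : 'rV[R]_m) : 0 <= enorm v.
Proof. exact: sqrtr_ge0. Qed.

Lemma ler_enorm m (v : 'rV[R]_m) i : `|v 0 i| <= enorm v.
Proof.
rewrite -sqrtr_sqr ler_wsqrtr// (bigD1 i)//= lerDl.
by apply: sumr_ge0 => j _; exact: sqr_ge0.
Qed.

Lemma lin_enorm m (c v : 'rV[R]_m.+1) :
  `|lin c v| <= (\sum_i `|c 0 i|) * enorm v.
Proof.
apply: (le_trans (ler_norm_sum _ _ _)); rewrite mulr_suml; apply: ler_sum => i _.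
by rewrite normrM ler_wpM2l// ler_enorm.
Qed.

Lemma abs_continuous_lin m a b (c : 'rV[R]_m.+1) (g : R -> 'rV[R]_m.+1) :
  abs_continuous a b g -> acR a b (fun s => lin c (g s)).
Proof.
move=> acg e e0; pose C := \sum_i `|c 0 i| + 1.
have C0 : 0 < C by apply: ltr_wpDl => //; exact: sumr_ge0.
have [d d0 Hd] := acg (e / C) (divr_gt0 e0 C0).
exists d => // N s t st tst sd; have := Hd N s t st tst sd.
rewrite ltr_pdivlMr// mulrC; apply: le_lt_trans.
rewrite mulr_sumr; apply: ler_sum => i _.
rewrite -linB.
apply: (le_trans (lin_enorm _ _)); rewrite ler_wpM2r ?enorm_ge0//.
by rewrite lerDl.
Qed.

Section Length.
Variable n : nat.
Local Notation H := 'rV[R]_(n.*2.+1).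
Implicit Types (p q v c : H) (j : 'I_n).

(** A calibration argument: a covector dominated by the horizontal norm along the curve cannot grow
    faster than length. It is applied to the horizontal coordinates and to a multiple of the contact
    form. *)
Lemma horizontal_lin_le a b (g : R -> H) c : a < b -> horizontal_curve a b g ->
  (forall s v, a <= s <= b -> (v <= hframe (g s))%MS ->
     `|lin c v| <= hnorm (g s) v) ->
  (`|lin c (g b - g a)|%:E <= hlength_curve a b g)%E.
Proof.
move=> ab [acg aeg] Hc.
rewrite linB.
apply: (@ac_integral_le a b (fun s => lin c (g s))) => //.
- exact: abs_continuous_lin.
- by move=> s; rewrite lee_fin enorm_ge0.
- move: aeg; apply: filterS; first exact: (ae_filter_ringOfSetsType mu).
  move=> s Hs abs; have [dg hg] := Hs abs.
  have := is_derive_lin c dg => -[d1 d2]; split => //.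
  by rewrite derive1E d2 lee_fin; apply: Hc.
Qed.

Lemma horizontal_sub a b s t (g : R -> H) : horizontal_curve a b g ->
  a <= s -> t <= b -> horizontal_curve s t g.
Proof.
move=> [acg aeg] as_ tb; split.
  move=> e e0; have [d d0 Hd] := acg e e0; exists d => // N x y xy; apply: Hd.
  by move=> i; have [h1 h2 h3] := xy i; split=> //; [exact: le_trans h1|exact: le_trans tb].
move: aeg; apply: filterS; first exact: (ae_filter_ringOfSetsType mu).
move=> x Hx /=; rewrite in_itv/= => /andP[sx xt]; apply: Hx.
by rewrite /= in_itv/= (le_trans as_)//= (le_trans xt).
Qed.

Lemma hlength_sub a b s t (g : R -> H) : a <= s -> t <= b ->
  (hlength_curve s t g <= hlength_curve a b g)%E.
Proof.
move=> as_ tb; rewrite /hlength_curve integral_mkcond [leRHS]integral_mkcond.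
have h0 x : (0 <= (hnorm (g x) (derive1 g x))%:E)%E by rewrite lee_fin enorm_ge0.
apply: ge0_le_integral_lower => x _; first exact: erestrict_ge0.
rewrite !patchE; case: ifPn => [|_]; last by case: ifPn.
rewrite inE/= in_itv/= => /andP[sx xt].
by rewrite mem_set//= in_itv/= (le_trans as_)//= (le_trans xt).
Qed.

Lemma x_idxE j : x_idx j = j.*2 :> nat.
Proof. by rewrite inordK// ltnS leq_double ltnW. Qed.

Lemma y_idxE j : y_idx j = j.*2.+1 :> nat.
Proof. by rewrite inordK// ltnS ltn_double. Qed.

Lemma idx_xx i j : (x_idx i == x_idx j) = (i == j).
Proof. by rewrite -val_eqE/= !x_idxE -!muln2 eqn_pmul2r. Qed.
Lemma idx_yy i j : (y_idx i == y_idx j) = (i == j).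
Proof. by rewrite -val_eqE/= !y_idxE eqSS -!muln2 eqn_pmul2r. Qed.
Lemma idx_xy i j : (x_idx i == y_idx j) = false.
Proof.
rewrite -val_eqE/= x_idxE y_idxE; apply/negP => /eqP/(congr1 odd).
by rewrite /= !odd_double.
Qed.
Lemma idx_xt j : (x_idx j == t_idx n) = false.
Proof. by rewrite -val_eqE/= x_idxE ltn_eqF// ltn_double. Qed.
Lemma idx_yt j : (y_idx j == t_idx n) = false.
Proof.
rewrite -val_eqE/= y_idxE; apply/negP => /eqP/(congr1 odd).
by rewrite /= !odd_double.
Qed.

Lemma idx_cases (i : 'I_(n.*2.+1)) :
  [\/ exists j, i = x_idx j, exists j, i = y_idx j | i = t_idx n].
Proof.
have [it|it] := eqVneq i (t_idx n); first by constructor 3.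
have ilt : (i < n.*2)%N.
  by rewrite ltn_neqAle -ltnS ltn_ord andbT; move: it; rewrite -val_eqE.
have hlt : (i./2 < n)%N by rewrite ltn_half_double.
have iE := odd_double_half i.
case: (boolP (odd i)) iE => oi iE.
  by constructor 2; exists (Ordinal hlt); apply: val_inj; rewrite [RHS]y_idxE -[LHS]iE.
by constructor 1; exists (Ordinal hlt); apply: val_inj; rewrite [RHS]x_idxE -[LHS]iE.
Qed.

Lemma horizontal_coord p v : (v <= hframe p)%MS ->
  [/\ forall j, `|v 0 (x_idx j)| <= hnorm p v,
      forall j, `|v 0 (y_idx j)| <= hnorm p v &
      v 0 (t_idx n) = \sum_(j < n) 2 * (p 0 (y_idx j) * v 0 (x_idx j)
         - p 0 (x_idx j) * v 0 (y_idx j))].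
Proof.
move=> /mulmxKpV vE; rewrite /hnorm; move: (v *m pinvmx (hframe p)) vE => c vE.
have vi i : v 0 i = \sum_(j < n) (c 0 (lshift n j) * fieldX j p 0 i +
    c 0 (rshift n j) * fieldY j p 0 i).
  rewrite -vE -[in LHS](hsubmxK c) mul_row_col !mxE big_split/=; congr (_ + _);
    by apply: eq_bigr => j _; rewrite !mxE.
have vx j : v 0 (x_idx j) = c 0 (lshift n j).
  rewrite vi (bigD1 j)//= big1 ?addr0 => [|i ij];
    rewrite !mxE/= ?idx_xx ?idx_xt ?idx_xy ?eqxx /= ?mulr1n; first by ring.
  by rewrite eq_sym (negbTE ij) mulr0n; ring.
have vy j : v 0 (y_idx j) = c 0 (rshift n j).
  rewrite vi (bigD1 j)//= big1 ?addr0 => [|i ij];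
    rewrite !mxE/= ?idx_yy ?idx_yt ?[y_idx _ == x_idx _]eq_sym ?idx_xy ?eqxx /= ?mulr1n; first by ring.
  by rewrite eq_sym (negbTE ij) mulr0n; ring.
split=> [j|j|]; [by rewrite vx ler_enorm|by rewrite vy ler_enorm|].
rewrite vi; apply: eq_bigr => j _; rewrite vx vy !mxE/= !eqxx/=.
by rewrite ![t_idx n == _]eq_sym idx_xt idx_yt /= ?mulr0n ?mulr1n; ring.
Qed.

Lemma linC m (c v : 'rV[R]_m.+1) : lin c v = lin v c.
Proof. by apply: eq_bigr => i _; rewrite mulrC. Qed.

Lemma lin_sum m (c : 'rV[R]_m.+1) (u : 'I_n -> 'rV[R]_m.+1) :
  lin c (\sum_j u j) = \sum_j lin c (u j).
Proof.
rewrite /lin exchange_big/=; apply: eq_bigr => i _.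
by rewrite summxE mulr_sumr.
Qed.

(** The contact form dt - 2 sum_j (y_j dx_j - x_j dy_j) at p, as the vector that represents it
    through [lin]. *)
Definition theta p : H := delta_mx 0 (t_idx n) -
  \sum_(j < n) ((2 * p 0 (y_idx j)) *: delta_mx 0 (x_idx j) -
                (2 * p 0 (x_idx j)) *: delta_mx 0 (y_idx j)).

Lemma lin_theta p v : lin (theta p) v = v 0 (t_idx n) -
  \sum_(j < n) 2 * (p 0 (y_idx j) * v 0 (x_idx j) - p 0 (x_idx j) * v 0 (y_idx j)).
Proof.
rewrite linC linB lin_delta lin_sum; congr (_ - _); apply: eq_bigr => j _.
by rewrite linB !linZ !lin_delta; ring.
Qed.

(** Initial pieces of the curve have length at most D, so the x and y coordinates stay within D of
    their start. On a horizontal v at g s the form theta at g s vanishes, and theta at g a is at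
    most 4 * n * D times the norm of v: for each of n indices, two products with a factor 2.
    Integrating over a length D gives the square. *)
Lemma curve_bounds a b (g : R -> H) (D : R) : (0 < n)%N -> a < b ->
  horizontal_curve a b g -> (hlength_curve a b g <= D%:E)%E -> 0 < D ->
  (forall i, i != t_idx n -> `|(g b - g a) 0 i| <= D) /\
  `|lin (theta (g a)) (g b - g a)| <= (4 * n)%:R * D ^+ 2.
Proof.
move=> n0 ab hg hl D0.
have coord s i : a <= s <= b -> i != t_idx n -> `|(g s - g a) 0 i| <= D.
  rewrite le_eqVlt => /andP[/orP[/eqP <- _ _|as_ sb it]].
    by rewrite subrr mxE normr0 ltW.
  rewrite -lee_fin -lin_delta linC; apply: le_trans hl.
  apply: le_trans (hlength_sub g (lexx a) sb).
  apply: horizontal_lin_le => //; first exact: horizontal_sub hg _ _.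
  move=> r v _ /horizontal_coord[vx vy _]; rewrite linC lin_delta.
  by case: (idx_cases i) it => [[j ->]|[j ->]|->]//; rewrite eqxx.
split; first by move=> i; apply: coord; rewrite lexx ltW.
pose M : R := (4 * n)%:R * D.
have M0 : 0 < M by rewrite mulr_gt0// ltr0n muln_gt0.
suff : (`|lin (M^-1 *: theta (g a)) (g b - g a)|%:E <= D%:E)%E.
  rewrite linC linZ linC normrM normfV (gtr0_norm M0) lee_fin.
  by rewrite mulrC ler_pdivrMr// /M mulrCA -expr2.
apply: le_trans hl; apply: horizontal_lin_le => // s v abs hv.
have [vx vy vt] := horizontal_coord hv.
rewrite linC linZ linC lin_theta vt -sumrB normrM normfV (gtr0_norm M0).
rewrite mulrC ler_pdivrMr// mulrC.
apply: (le_trans (ler_norm_sum _ _ _)).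
apply: (@le_trans _ _ (\sum_(j < n) 4 * D * hnorm (g s) v)); last first.
  rewrite sumr_const card_ord -[leLHS]mulr_natl /M natrM.
  by rewrite le_eqVlt; apply/orP; left; apply/eqP; ring.
apply: ler_sum => j _.
rewrite (_ : _ - _ = 2 * ((g s - g a) 0 (y_idx j) * v 0 (x_idx j) -
  (g s - g a) 0 (x_idx j) * v 0 (y_idx j))); last by rewrite !mxE; ring.
rewrite normrM gtr0_norm// (_ : 4 = 2 * 2) -?mulrA; last by rewrite -natrM.
rewrite ler_wpM2l// mulr_natl mulr2n; apply: (le_trans (ler_normB _ _)).
by rewrite !normrM lerD// ler_pM// coord ?idx_yt ?idx_xt.
Qed.

Lemma d_cc_bounds p q (D : R) : (0 < n)%N -> (d_cc p q < D%:E)%E ->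
  (forall i, i != t_idx n -> `|(q - p) 0 i| <= D) /\
  `|lin (theta p) (q - p)| <= (4 * n)%:R * D ^+ 2.
Proof.
move=> n0 /ereal_inf_lt[_ [a [b [g [ab hg <- <- ->]]]] lD].
apply: curve_bounds => //; first exact: ltW.
rewrite -lte_fin; apply: le_lt_trans lD; apply: integral_ge0 => x _.
by rewrite lee_fin enorm_ge0.
Qed.
End Length.
End HorizontalCurves.

(** * Isotropic row spaces *)

Section DensityPoints.
Context (R : realType) (k : nat).
Local Notation V := 'rV[R]_k.+1.
Local Notation outer := (@lebesgue_outer R k.+1).
Local Notation cara := (caratheodory_measurable outer).
Implicit Types (x : V) (S : set V).

Lemma enorm_le (v : V) : enorm v <= k.+1%:R * `|v|.
Proof.
rewrite -[leRHS]ger0_norm ?mulr_ge0// -sqrtr_sqr ler_wsqrtr//.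
apply: (@le_trans _ _ (\sum_(i < k.+1) `|v| ^+ 2)).
  by apply: ler_sum => i _; rewrite -[leLHS]real_normK ?num_real// lerXn2r ?nnegrE// ler_normrV.
rewrite sumr_const card_ord -[leLHS]mulr_natl exprMn ler_wpM2r ?sqr_ge0//.
by rewrite -natrX ler_nat expnS leq_pmulr.
Qed.

Lemma cube_eball x r : 0 < r -> cube x r `<=` eball x (k.+2%:R * r).
Proof.
move=> r0 y /cubeP xy; rewrite /eball/=; apply: (le_lt_trans (enorm_le _)).
apply: (@le_lt_trans _ _ (k.+1%:R * r)); last by rewrite ltr_pM2r// ltr_nat.
rewrite ler_wpM2l//; apply: ler_rVnorm; first exact: ltW.
by move=> j; have /andP[h1 h2] := xy j; rewrite !mxE ler_norml; apply/andP; split; lra.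
Qed.

Lemma eball_cube x r : eball x r `<=` cube x r.
Proof.
move=> y; rewrite /eball/= => xy; apply/cubeP => j.
have := le_lt_trans (ler_enorm (y - x) j) xy.
by rewrite !mxE ltr_norml => /andP[h1 h2]; apply/andP; split; lra.
Qed.

(** Caratheodory's condition splits the ball; its volume is bounded by those of an inscribed and a
    circumscribed cube. *)
Lemma eball_split S x s : cara S -> 0 < s -> exists o i c : R,
  [/\ outer (eball x s) = o%:E, outer (S `&` eball x s) = i%:E,
      outer (eball x s `\` S) = c%:E, o = i + c &
      0 <= c /\ (2 * (s / k.+2%:R)) ^+ k.+1 <= o <= (2 * s) ^+ k.+1].
Proof.
move=> mS s0; have s2 : 0 < s / k.+2%:R by rewrite divr_gt0.
have le1 : (outer (eball x s) <= ((2 * s) ^+ k.+1)%:E)%E.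
  by rewrite -(lebesgue_outer_cube x (ltW s0)); apply: le_lebesgue_outer; exact: eball_cube.
have le2 : (((2 * (s / k.+2%:R)) ^+ k.+1)%:E <= outer (eball x s))%E.
  rewrite -(lebesgue_outer_cube x (ltW s2)); apply: le_lebesgue_outer.
  have E : k.+2%:R * (s / k.+2%:R) = s by rewrite mulrCA mulfV ?mulr1// pnatr_eq0.
  by move=> y /(cube_eball s2); rewrite E.
have fin A : A `<=` eball x s -> outer A \is a fin_num.
  move=> As; apply: (@lebesgue_outer_fin_num _ _ _ ((2 * s) ^+ k.+1)).
  by apply: le_trans le1; exact: le_lebesgue_outer.
have f1 := fin _ (@subset_refl _ (eball x s)).
have f2 := fin (S `&` eball x s) (@subIsetr _ _ _).
have f3 := fin (eball x s `\` S) (@subDsetl _ _ _).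
exists (fine (outer (eball x s))), (fine (outer (S `&` eball x s))),
  (fine (outer (eball x s `\` S))); rewrite !fineK//; split => //.
  apply: EFin_inj; rewrite EFinD !fineK//.
  by have := mS (eball x s); rewrite setDE (setIC S).
split; first by apply: fine_ge0; exact: lebesgue_outer_ge0.
by rewrite -!lee_fin fineK// le1 le2.
Qed.

Lemma density_point_dense S x : cara S -> density_point S x -> dense_at S x.
Proof.
move=> mS dS e e0.
(* The volume of the cube around the ball of radius k.+2 * r, divided by r ^+ k.+1. *)
pose K : R := (2 * k.+2%:R) ^+ k.+1.
have K0 : 0 < K by rewrite exprn_gt0// mulr_gt0.
move/cvgrPdist_le : dS => /(_ (e / K) (divr_gt0 e0 K0))[d /= d0 Hd].
exists (d / k.+2%:R); first by rewrite divr_gt0.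
move=> r r0; rewrite ltr_pdivlMr// mulrC => rd.
have s0 : 0 < k.+2%:R * r by rewrite mulr_gt0.
have [w [i [c [wE iE cE wic [c0 /andP[b1 b2]]]]]] := eball_split x mS s0.
have := Hd (k.+2%:R * r); rewrite /= sub0r normrN gtr0_norm// => /(_ rd s0).
rewrite wE iE/= => H.
apply: (@le_trans _ _ (outer (eball x (k.+2%:R * r) `\` S))).
  by apply: le_lebesgue_outer; apply: setSD; exact: cube_eball.
rewrite cE lee_fin.
have oo : 0 < w by apply: lt_le_trans b1; rewrite exprn_gt0// mulr_gt0// divr_gt0.
have : c / w <= e / K.
  apply: le_trans H; apply: le_trans (ler_norm _).
  rewrite (_ : c = w - i); last by lra.
  by rewrite mulrBl divff// lt0r_neq0.
rewrite ler_pdivrMr// => /le_trans; apply.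
apply: (@le_trans _ _ (e / K * (2 * (k.+2%:R * r)) ^+ k.+1)).
  by rewrite ler_wpM2l// divr_ge0// ltW.
by rewrite mulrA [X in _ * X]exprMn -/K mulrA divfK ?lt0r_neq0.
Qed.

Lemma dense_density_point S x : cara S -> dense_at S x -> density_point S x.
Proof.
move=> mS dS; apply/cvgrPdist_le => e e0.
pose K : R := (2 / k.+2%:R) ^+ k.+1.
have K0 : 0 < K by rewrite exprn_gt0// divr_gt0.
have [d d0 Hd] := dS (e * K) (mulr_gt0 e0 K0).
exists d => //= r; rewrite /= sub0r normrN => rd r0; rewrite gtr0_norm// in rd.
have [w [i [c [wE iE cE wic [c0 /andP[b1 b2]]]]]] := eball_split x mS r0.
rewrite wE iE/=.
have cd : c <= e * K * r ^+ k.+1.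
  rewrite -lee_fin -cE; apply: le_trans (Hd r r0 rd).
  by apply: le_lebesgue_outer; apply: setSD; exact: eball_cube.
have oo : 0 < w by apply: lt_le_trans b1; rewrite exprn_gt0// mulr_gt0// divr_gt0.
have -> : 1 - i / w = c / w.
  rewrite (_ : c = w - i); last by lra.
  by rewrite mulrBl divff// lt0r_neq0.
have cw : 0 <= c / w by rewrite divr_ge0// ltW.
rewrite ger0_norm// ler_pdivrMr//; apply: (le_trans cd).
rewrite -mulrA ler_wpM2l//; first exact: ltW.
apply: le_trans b1.
by rewrite /K -exprMn mulrA mulrAC.
Qed.

Lemma dense_atI (m : nat) (K : 'I_m -> set V) x :
  (forall i, dense_at (K i) x) -> dense_at (\bigcap_i K i) x.
Proof.
move=> HK e e0.
have m0 : 0 < e / m.+1%:R by rewrite divr_gt0.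
have /boolp.choice[d Hd] : forall i, exists d, 0 < d /\ forall r, 0 < r -> r < d ->
    (outer (cube x r `\` K i) <= (e / m.+1%:R * r ^+ k.+1)%:E)%E.
  by move=> i; have [d d0 Hd] := HK i _ m0; exists d.
exists (\big[Num.min/1]_i d i).
  by elim/big_ind : _ => // [a b a0 b0|i _]; [rewrite lt_min a0|have [] := Hd i].
move=> r r0 rd.
apply: (@le_trans _ _ (\sum_(i < m) outer (cube x r `\` K i))%E).
  apply: (@le_trans _ _ (outer (\big[setU/set0]_(i < m) (cube x r `\` K i)))).
    apply: le_lebesgue_outer => y [xy nK]; apply: contrapT => nU; apply: nK => i _.
    apply: contrapT => nKi; apply: nU; rewrite -bigcup_seq; exists i => //=.
    exact: mem_index_enum.
  elim/big_ind2 : _ => [|a b c d' ac bd|i _]//; first by rewrite lebesgue_outer0.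
  by apply: (le_trans (lebesgue_outerU _ _)); exact: leeD.
apply: (@le_trans _ _ (\sum_(i < m) (e / m.+1%:R * r ^+ k.+1)%:E)%E).
  apply: lee_sum => i _; have [_] := Hd i; apply=> //.
  by apply: (lt_le_trans rd); apply: bigmin_le_cond.
rewrite sumEFin lee_fin sumr_const card_ord -[leLHS]mulr_natr mulrAC ler_wpM2r//.
  by rewrite exprn_ge0// ltW.
by rewrite mulrAC ler_pdivrMr// ler_wpM2l ?ler_nat// ltW.
Qed.
End DensityPoints.

Section IsotropicRank.
Context (R : realType) (n : nat).
Local Notation H := 'rV[R]_(n.*2.+1).
Implicit Types a b p v : H.

(** The symplectic form of C^n, extended by 0 in the t-direction, as a matrix acting on row vectors;
    see [lin_sympl]. *)
Definition sympl : 'M[R]_(n.*2.+1) := \sum_(j < n)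
  ((delta_mx 0 (y_idx j) : H)^T *m (delta_mx 0 (x_idx j) : H) -
   (delta_mx 0 (x_idx j) : H)^T *m (delta_mx 0 (y_idx j) : H)).

Lemma mul_delta_outer v i (u : H) : v *m ((delta_mx 0 i : H)^T *m u) = v 0 i *: u.
Proof.
rewrite mulmxA trmx_delta -(colE i v) [col i v]mx11_scalar mul_scalar_mx mxE.
by [].
Qed.

Lemma mul_sympl v : v *m sympl = \sum_(j < n)
  (v 0 (y_idx j) *: delta_mx 0 (x_idx j) - v 0 (x_idx j) *: delta_mx 0 (y_idx j)).
Proof.
by rewrite mulmx_sumr; apply: eq_bigr => j _; rewrite mulmxBr !mul_delta_outer.
Qed.

Lemma mul_symplE v : [/\ forall j, (v *m sympl) 0 (x_idx j) = v 0 (y_idx j),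
  forall j, (v *m sympl) 0 (y_idx j) = - v 0 (x_idx j) &
  (v *m sympl) 0 (t_idx n) = 0].
Proof.
rewrite mul_sympl; split=> [j|j|]; rewrite summxE.
- rewrite (bigD1 j)//= big1 ?addr0 => [|i ij];
    rewrite !mxE/= ?idx_xx ?idx_xy ?eqxx /= ?mulr1n; first by ring.
  by rewrite eq_sym (negbTE ij) ?mulr0n; ring.
- rewrite (bigD1 j)//= big1 ?addr0 => [|i ij];
    rewrite !mxE/= ?idx_yy ?[y_idx _ == x_idx _]eq_sym ?idx_xy ?eqxx /= ?mulr1n; first by ring.
  by rewrite eq_sym (negbTE ij) ?mulr0n; ring.
- by rewrite big1// => j _; rewrite !mxE/= ![t_idx n == _]eq_sym idx_xt idx_yt /= ?mulr0n; ring.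
Qed.

Lemma lin_sympl a b : lin (a *m sympl) b =
  \sum_(j < n) (a 0 (y_idx j) * b 0 (x_idx j) - a 0 (x_idx j) * b 0 (y_idx j)).
Proof.
rewrite mul_sympl linC lin_sum; apply: eq_bigr => j _.
by rewrite linB !linZ !lin_delta.
Qed.

Lemma lin_sympl_alt a : lin (a *m sympl) a = 0.
Proof. by rewrite lin_sympl big1// => j _; rewrite mulrC subrr. Qed.

Lemma lin_thetaD p a v : lin (theta (p + a)) v = lin (theta p) v - 2 * lin (a *m sympl) v.
Proof.
rewrite !lin_theta lin_sympl mulr_sumr -addrA -opprD -big_split/=; congr (_ - _).
by apply: eq_bigr => j _; rewrite !mxE; ring.
Qed.

Lemma linE m (a b : 'rV[R]_m.+1) : lin a b = (a *m b^T) 0 0.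
Proof. by rewrite mxE; apply: eq_bigr => i _; rewrite mxE. Qed.

(* [sympl] is degenerate only in the t-direction; adding the rank one matrix
   [theta^T *m e_t] keeps the row space of [A] isotropic and makes the form
   non-degenerate. *)
Lemma isotropic_rank k (A : 'M[R]_(k, n.*2.+1)) p :
  A *m sympl *m A^T = 0 -> A *m (theta p)^T = 0 -> (\rank A <= n)%N.
Proof.
move=> As At.
pose M := sympl + (theta p)^T *m (delta_mx 0 (t_idx n) : H).
have AM : A *m M *m A^T = 0.
  by rewrite mulmxDr mulmxA At mul0mx addr0.
have rM : row_free M.
  apply: inj_row_free => v; rewrite mulmxDr mulmxA.
  rewrite (mx11_scalar (v *m (theta p)^T)) -linE linC mul_scalar_mx => /rowP vM.
  have [vx vy vt] := mul_symplE v.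
  have y0 j : v 0 (y_idx j) = 0.
    by have := vM (x_idx j); rewrite mxE vx !mxE eqxx idx_xt mulr0n mulr0 addr0.
  have x0 j : v 0 (x_idx j) = 0.
    have := vM (y_idx j); rewrite mxE vy !mxE eqxx idx_yt mulr0n mulr0 addr0.
    by move/eqP; rewrite oppr_eq0 => /eqP.
  have t0 : v 0 (t_idx n) = 0.
    have := vM (t_idx n); rewrite mxE vt !mxE !eqxx mulr1 add0r lin_theta big1 ?subr0//.
    by move=> j _; rewrite x0 y0 !mulr0 subrr mulr0.
  apply/rowP => i; rewrite mxE.
  by case: (idx_cases i) => [[j ->]|[j ->]|->].
(* The ranks of [A *m M] and of the transpose of A both equal that of A and add up to at most 2n +
   1; halving rounds down to n. *)
have := mulmx0_rank_max AM; rewrite mxrankMfree// mxrank_tr addnn => /half_leq.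
by rewrite doubleK /= uphalf_double.
Qed.
End IsotropicRank.

(** * Blow-up at a density point *)

Section BlowUp.
Context (R : realType) (k : nat).
Local Notation V := 'rV[R]_k.+1.

Lemma near_natS_gt (M : R) : \forall m \near \oo, M < m.+1%:R.
Proof.
exists (Num.truncn M) => // m /= Mm; apply: lt_le_trans (Num.Theory.truncnS_gt M) _.
by rewrite ler_nat ltnS.
Qed.

(** By [dense_at_near], S comes o(1/m)-close to x + w / m. The infimum of the rescaled distance need
    not be attained, so [z m] minimises it only up to 1 / (m + 1); this choice is possible for every
    m, before any threshold. *)
Lemma approx_seq (S : set V) x : dense_at S x -> forall w : V, exists z : nat -> V,
  (forall m, S (z m)) /\ m.+1%:R *: (z m - x) @[m --> \oo] --> w.
Proof.
move=> dS w.
have S0 : S !=set0.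
  have [r0 r00 H] := dense_at_near ltr01 dS.
  have r20 : 0 < r0 / 2 by rewrite divr_gt0.
  have r21 : r0 / 2 < r0 by lra.
  have [|y Sy _] := H (r0 / 2) r20 r21 x; first by rewrite subrr normr0 ltW.
  by exists y.
have /boolp.choice[z Hz] : forall m : nat, exists z, S z /\ forall z', S z' ->
    `|m.+1%:R *: (z - x) - w| <= `|m.+1%:R *: (z' - x) - w| + m.+1%:R^-1.
  move=> m; pose D := [set `|m.+1%:R *: (z' - x) - w| | z' in S].
  have lD : has_lbound D by exists 0 => _ [z' _ <-].
  have iD : has_inf D.
    by split=> //; have [y Sy] := S0; exists `|m.+1%:R *: (y - x) - w|, y.
  have m0 : 0 < m.+1%:R^-1 :> R by rewrite invr_gt0.
  have [_ [z Sz <-] zl] := inf_adherent m0 iD.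
  exists z; split=> // z' Sz'; apply: (le_trans (ltW zl)); rewrite lerD2r.
  by apply: ge_inf => //; exists z'.
exists z; split; first by move=> m; have [] := Hz m.
apply/cvgrPdist_le => e e0; pose N := `|w| + 1.
have N0 : 0 < N by rewrite ltr_wpDl.
have e'0 : 0 < e / 2 / N by rewrite !divr_gt0.
have [r0 r00 H] := dense_at_near e'0 dS.
near=> m.
have t0 : 0 < m.+1%:R :> R by [].
have Nr : N / m.+1%:R < r0.
  rewrite ltr_pdivrMr// mulrC -ltr_pdivrMr//; near: m; exact: near_natS_gt.
have [|z' Sz' z'y] := H _ (divr_gt0 N0 t0) Nr (x + m.+1%:R^-1 *: w).
  rewrite addrC addKr normrZ normfV normr_nat mulrC ler_wpM2r// ?invr_ge0//.
  by rewrite lerDl.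
rewrite distrC; have [_ /(_ _ Sz')] := Hz m; move=> /le_trans; apply.
have -> : m.+1%:R *: (z' - x) - w = m.+1%:R *: (z' - (x + m.+1%:R^-1 *: w)).
  by rewrite opprD addrA [in RHS]scalerBr scalerA mulfV ?scale1r ?lt0r_neq0.
rewrite normrZ normr_nat [leRHS]splitr lerD//.
  rewrite mulrC -ler_pdivlMr//; apply: (le_trans z'y).
  by rewrite mulrA divfK// lt0r_neq0.
have te : (e / 2)^-1 < m.+1%:R by near: m; exact: near_natS_gt.
by rewrite -[leRHS]invrK lef_pV2 ?posrE ?invr_gt0 ?divr_gt0// ltW.
Unshelve. all: by end_near.
Qed.

Lemma gradient_seq (g : V -> R) x c (z : nat -> V) w : has_gradient g x c ->
  m.+1%:R *: (z m - x) @[m --> \oo] --> w ->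
  m.+1%:R * (g (z m) - g x) @[m --> \oo] --> lin c w.
Proof.
move=> gc zw; apply/cvgrPdist_le => e e0; pose N := `|w| + 1.
have N0 : 0 < N by rewrite ltr_wpDl.
have [d d0 Hd] := gc (e / 2 / N) (divr_gt0 (divr_gt0 e0 (ltr0Sn _ 1)) N0).
have lw : lin c (m.+1%:R *: (z m - x)) @[m --> \oo] --> lin c w.
  by apply: continuous_cvg => //; exact: lin_continuous.
have nw : `|m.+1%:R *: (z m - x)| @[m --> \oo] --> `|w| by apply: cvg_norm.
near=> m.
have t0 : 0 < m.+1%:R :> R by [].
have tN : `|m.+1%:R *: (z m - x)| < N.
  near: m; move/cvgr_lt : nw; apply; by rewrite ltrDl.
have tE : `|m.+1%:R *: (z m - x)| = m.+1%:R * `|z m - x| by rewrite normrZ normr_nat.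
have vd : `|z m - x| < d.
  rewrite tE mulrC -ltr_pdivlMr// in tN; apply: (lt_trans tN).
  rewrite ltr_pdivrMr// mulrC -ltr_pdivrMr//; near: m; exact: near_natS_gt.
rewrite distrC -(subrKA (lin c (m.+1%:R *: (z m - x)))) [leRHS]splitr.
apply: (le_trans (ler_normD _ _)); apply: lerD; last first.
  by rewrite distrC; near: m; move/cvgrPdist_le : lw; apply; rewrite divr_gt0.
rewrite linZ -mulrBr normrM normr_nat.
have := Hd _ vd; rewrite [x + _]addrC subrK => h.
apply: (@le_trans _ _ (m.+1%:R * (e / 2 / N * `|z m - x|))); first by rewrite ler_wpM2l.
rewrite mulrCA -tE; apply: (@le_trans _ _ (e / 2 / N * N)).
  by rewrite ler_wpM2l ?ltW// !divr_gt0.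
by rewrite divfK// lt0r_neq0.
Unshelve. all: by end_near.
Qed.

Lemma cvg_sum_R (m : nat) (F : 'I_m -> nat -> R) (l : 'I_m -> R) :
  (forall i, F i j @[j --> \oo] --> l i) ->
  \sum_(i < m) F i j @[j --> \oo] --> \sum_(i < m) l i.
Proof. by move=> H; apply: cvg_big => // ; exact: add_continuous. Qed.

Lemma cvg_lin m (a b : nat -> 'rV[R]_m.+1) (c d : 'rV[R]_m.+1) :
  (forall i, a j 0 i @[j --> \oo] --> c 0 i) ->
  (forall i, b j 0 i @[j --> \oo] --> d 0 i) ->
  lin (a j) (b j) @[j --> \oo] --> lin c d.
Proof. by move=> ac bd; apply: cvg_sum_R => i; apply: cvgM. Qed.

Lemma cvg_mulmx m (a : nat -> 'rV[R]_m.+1) (c : 'rV[R]_m.+1) (M : 'M[R]_m.+1) :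
  (forall i, a j 0 i @[j --> \oo] --> c 0 i) ->
  forall i, (a j *m M) 0 i @[j --> \oo] --> (c *m M) 0 i.
Proof.
move=> ac i; rewrite mxE; under eq_fun do rewrite mxE.
by apply: cvg_sum_R => j; apply: cvgM; [exact: ac|exact: cvg_cst].
Qed.

(* Iterating the midpoint inequality divides the constant by 2 each time, so
   the quadratic error disappears; the cocycle identity on the triangle
   0, u, v then annihilates the form. *)
Lemma quadratic_cocycle (a : nat -> V -> R) (M : 'M[R]_k.+1) (C : R) :
  (forall u, lin (u *m M) u = 0) ->
  (forall u v e, 0 < e -> \forall m \near \oo,
    `|a m v - a m u - 2 * lin (u *m M) v| <= C * `|v - u| ^+ 2 + e) ->
  forall u v e, 0 < e -> \forall m \near \oo, `|a m v - a m u| <= e /\ lin (u *m M) v = 0.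
Proof.
move=> alt HC.
have HN N : forall u v e, 0 < e -> \forall m \near \oo,
    `|a m v - a m u - 2 * lin (u *m M) v| <= C / 2 ^+ N * `|v - u| ^+ 2 + e.
  elim: N => [|N IH] u v e e0; first by rewrite expr0 divr1; exact: HC.
  pose w := 2^-1 *: (u + v).
  have e20 : 0 < e / 2 by rewrite divr_gt0.
  (* Since the form alternates, each half of the segment carries half of its value, while the
     squares of the two half-lengths add up to half the square. *)
  have uw : lin (u *m M) w = 2^-1 * lin (u *m M) v.
    by rewrite /w linZ linD alt add0r.
  have wv : lin (w *m M) v = 2^-1 * lin (u *m M) v.
    by rewrite /w -scalemxAl mulmxDl linC linZ linD ![lin v _]linC alt addr0.
  have nuw : `|w - u| = 2^-1 * `|v - u|.
    rewrite (_ : w - u = 2^-1 *: (v - u)) ?normrZ ?gtr0_norm ?invr_gt0//.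
    by apply/rowP => i; rewrite !mxE; lra.
  have nwv : `|v - w| = 2^-1 * `|v - u|.
    rewrite (_ : v - w = 2^-1 *: (v - u)) ?normrZ ?gtr0_norm ?invr_gt0//.
    by apply/rowP => i; rewrite !mxE; lra.
  near=> m.
  have h1 : `|a m w - a m u - 2 * lin (u *m M) w| <= C / 2 ^+ N * `|w - u| ^+ 2 + e / 2.
    by near: m; exact: IH.
  have h2 : `|a m v - a m w - 2 * lin (w *m M) v| <= C / 2 ^+ N * `|v - w| ^+ 2 + e / 2.
    by near: m; exact: IH.
  rewrite uw nuw in h1; rewrite wv nwv in h2.
  have -> : a m v - a m u - 2 * lin (u *m M) v =
    (a m w - a m u - 2 * (2^-1 * lin (u *m M) v)) +
    (a m v - a m w - 2 * (2^-1 * lin (u *m M) v)) by field.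
  apply: (le_trans (ler_normD _ _)); apply: (le_trans (lerD h1 h2)).
  rewrite [2 ^+ N.+1]exprSr invfM mulrA; rewrite le_eqVlt; apply/orP; left; apply/eqP; field.
  by rewrite expf_neq0// pnatr_eq0.
have HL u v e : 0 < e -> \forall m \near \oo, `|a m v - a m u - 2 * lin (u *m M) v| <= e.
  move=> e0; have e20 : 0 < e / 2 by rewrite divr_gt0.
  have [N HNe] : exists N : nat, C * `|v - u| ^+ 2 <= e / 2 * 2 ^+ N.
    exists (Num.truncn (C * `|v - u| ^+ 2 / (e / 2))).
    rewrite -ler_pdivrMl// mulrC; apply: ltW.
    apply: lt_le_trans (Num.Theory.truncnS_gt _) _.
    by have := ltn_expl (Num.truncn (C * `|v - u| ^+ 2 / (e / 2))) (ltnSn 1);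
      rewrite -(ler_nat R) natrX.
  have := HN N u v _ e20; apply: filterS => m /le_trans; apply.
  rewrite [leRHS]splitr lerD2r mulrAC ler_pdivrMr ?exprn_gt0//.
have L0 v : lin (0 *m M) v = 0 by rewrite mul0mx linC /lin big1// => i _; rewrite mxE mulr0.
have O0 u v : lin (u *m M) v = 0.
  apply/eqP; rewrite -normr_eq0 eq_le normr_ge0 andbT; apply/ler_addgt0Pr => e e0.
  rewrite add0r; have e20 : 0 < e / 3 by rewrite divr_gt0.
  near \oo => m.
  have h1 : `|a m v - a m u - 2 * lin (u *m M) v| <= e / 3 by near: m; exact: HL.
  have h2 : `|a m v - a m 0 - 2 * lin (0 *m M) v| <= e / 3 by near: m; exact: HL.
  have h3 : `|a m u - a m 0 - 2 * lin (0 *m M) u| <= e / 3 by near: m; exact: HL.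
  rewrite L0 mulr0 subr0 in h2; rewrite L0 mulr0 subr0 in h3.
  move: h1 h2 h3; rewrite !ler_norml => /andP[? ?] /andP[? ?] /andP[? ?].
  by apply/andP; split; lra.
move=> u v e e0; have := HL u v e e0; apply: filterS => m.
by rewrite O0 mulr0 subr0.
Unshelve. all: by end_near.
Qed.
End BlowUp.

Section ContactIsotropic.
Context (R : realType) (k n : nat).
Local Notation V := 'rV[R]_k.+1.
Local Notation H := 'rV[R]_(n.*2.+1).

Lemma mx_delta_entry p q (M : 'M[R]_(p, q)) i j :
  M i j = ((delta_mx 0 i : 'rV[R]_p) *m M *m (delta_mx 0 j : 'rV[R]_q)^T) 0 0.
Proof. by rewrite trmx_delta -rowE -colE !mxE. Qed.

(** Moving the base point from p to p + u changes theta by a symplectic term, which alternation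
    reduces to the pairing of u with u'. The rest is the difference of one function at u' and at u,
    so it telescopes. *)
Lemma contact_expansion (p u u' : H) (t : R) :
  t ^+ 2 * lin (theta (p + u)) ((p + u') - (p + u)) =
  t * lin (theta p) (t *: u') - t * lin (theta p) (t *: u)
  - 2 * lin ((t *: u) *m sympl R n) (t *: u').
Proof.
rewrite opprD addrACA subrr add0r lin_thetaD !linB lin_sympl_alt subr0.
rewrite -scalemxAl ![lin (t *: (u *m _)) _]linC !linZ ![lin _ (u *m _)]linC !linZ.
ring.
Qed.

Lemma contact_isotropic (g : V -> H) x (A : 'M[R]_(k.+1, n.*2.+1)) (S : set V) (C d : R) :
  dense_at S x ->
  (forall i, has_gradient (fun y => g y 0 i) x (\row_j A j i)) ->
  0 <= C -> 0 < d ->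
  (forall z z', S z -> S z' -> `|z - x| < d -> `|z' - x| < d ->
     `|lin (theta (g z)) (g z' - g z)| <= C * `|z' - z| ^+ 2) ->
  A *m sympl R n *m A^T = 0 /\ A *m (theta (g x))^T = 0.
Proof.
(* The blow-up is centred at the value of g, since x need not lie in S. *)
move=> dS gA C0 d0 HC; set p := g x.
have /boolp.choice[z Hz] := approx_seq dS.
pose t (m : nat) : R := m.+1%:R.
pose xi m w : H := t m *: (g (z w m) - p).
have xiE w i : xi m w 0 i @[m --> \oo] --> (w *m A) 0 i.
  have [_ zw] := Hz w; have := gradient_seq (gA i) zw.
  rewrite (_ : lin _ _ = (w *m A) 0 i); last first.
    by rewrite mxE linC; apply: eq_bigr => j _; rewrite mxE.
  apply: cvg_trans; apply: near_eq_cvg; apply: nearW => m /=.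
  by rewrite /xi [RHS]mxE [(g _ - p) 0 i]mxE [(- p) 0 i]mxE.
(* [a m w] itself is not known to converge; only its differences are controlled. *)
pose a m w := t m * lin (theta p) (xi m w).
have lA u v : lin (u *m (A *m sympl R n *m A^T)) v = lin (u *m A *m sympl R n) (v *m A).
  by rewrite !linE trmx_mul !mulmxA.
have Q u v e : 0 < e -> \forall m \near \oo, `|a m v - a m u -
    2 * lin (u *m (A *m sympl R n *m A^T)) v| <= C * `|v - u| ^+ 2 + e.
  move=> e0; rewrite lA.
  have [Szu zu] := Hz u; have [Szv zv] := Hz v.
  have c1 : lin (xi m u *m sympl R n) (xi m v) @[m --> \oo] -->
      lin (u *m A *m sympl R n) (v *m A).
    by apply: cvg_lin; [exact: (@cvg_mulmx R n.*2 (xi^~ u) (u *m A) (sympl R n) (xiE u))|exact: (xiE v)].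
  have c2 : C * `|t m *: (z v m - z u m)| ^+ 2 @[m --> \oo] --> C * `|v - u| ^+ 2.
    apply: cvgM; first exact: cvg_cst.
    rewrite expr2; under eq_fun do rewrite expr2.
    have c3 : `|t m *: (z v m - z u m)| @[m --> \oo] --> `|v - u|.
      apply: cvg_norm.
      rewrite (_ : (fun m => _) = fun m => m.+1%:R *: (z v m - x) - m.+1%:R *: (z u m - x)).
        exact: cvgB.
      by apply/funext => m; rewrite -scalerBr opprB addrA subrK.
    exact: cvgM.
  have near_z w : \forall m \near \oo, `|z w m - x| < d.
    have [_ zw] := Hz w.
    have nw : `|m.+1%:R *: (z w m - x)| @[m --> \oo] --> `|w| by apply: cvg_norm.
    near=> m.
    have tN : `|m.+1%:R *: (z w m - x)| < `|w| + 1.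
      by near: m; move/cvgr_lt : nw; apply; rewrite ltrDl.
    have tM : (`|w| + 1) / d < m.+1%:R by near: m; exact: near_natS_gt.
    rewrite ltr_pdivrMr// in tM; have := lt_trans tN tM.
    by rewrite normrZ normr_nat ltr_pM2l.
  near=> m.
  have h1 : `|lin (u *m A *m sympl R n) (v *m A) -
      lin (xi m u *m sympl R n) (xi m v)| <= e / 4.
    by near: m; move/cvgrPdist_le : c1; apply; rewrite divr_gt0.
  have h2 : C * `|t m *: (z v m - z u m)| ^+ 2 <= C * `|v - u| ^+ 2 + e / 2.
    by near: m; move/cvgr_le : c2; apply; rewrite ltrDl divr_gt0.
  have h3 : `|a m v - a m u - 2 * lin (xi m u *m sympl R n) (xi m v)| <=
      C * `|t m *: (z v m - z u m)| ^+ 2.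
    have := contact_expansion p (g (z u m) - p) (g (z v m) - p) (t m).
    rewrite ![p + (_ - p)]addrC !subrK -/(xi m u) -/(xi m v) -/(a m v) -/(a m u) => <-.
    rewrite normrM normrX normrZ exprMn mulrCA ler_wpM2l ?exprn_ge0//.
    by apply: HC => //; near: m; exact: near_z.
  have := le_trans h3 h2; move: h1.
  rewrite !ler_norml => /andP[? ?] /andP[? ?]; apply/andP; split; lra.
have alt u : lin (u *m (A *m sympl R n *m A^T)) u = 0 by rewrite lA lin_sympl_alt.
have L := quadratic_cocycle alt Q.
have lin0 m (v : 'rV[R]_m.+1) : lin v 0 = 0.
  by rewrite /lin big1// => i _; rewrite mxE mulr0.
split.
  apply/matrixP => i j; rewrite mx_delta_entry -linE mxE.
  by have /filter_ex[m [_ ->]] := L (delta_mx 0 i) (delta_mx 0 j) 1 ltr01.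
(* [a m w] has one factor t m more than [lin (theta p) (xi m w)]. As t m >= 1, the smallness of a m
   w - a m 0 passes to the differences without that factor, and these converge. *)
have T w : lin (theta p) (w *m A) = 0.
  apply/eqP; rewrite -normr_eq0 eq_le normr_ge0 andbT; apply/ler_addgt0Pr => e e0.
  rewrite add0r; have e20 : 0 < e / 3 by rewrite divr_gt0.
  have c w' : lin (theta p) (xi m w') @[m --> \oo] --> lin (theta p) (w' *m A).
    by apply: cvg_lin => i; [exact: cvg_cst|exact: xiE].
  near \oo => m.
  have [h1 _] : `|a m w - a m 0| <= e / 3 /\ lin (0 *m (A *m sympl R n *m A^T)) w = 0.
    by near: m; exact: L.
  have h2 : `|lin (theta p) (w *m A) - lin (theta p) (xi m w)| <= e / 3.
    by near: m; move/cvgrPdist_le : (c w); apply.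
  have h3 : `|lin (theta p) (0 *m A) - lin (theta p) (xi m 0)| <= e / 3.
    by near: m; move/cvgrPdist_le : (c 0); apply.
  rewrite mul0mx lin0 in h3.
  have h4 : `|lin (theta p) (xi m w) - lin (theta p) (xi m 0)| <= e / 3.
    apply: le_trans h1; rewrite -mulrBr normrM ger0_norm//.
    by rewrite ler_peMl// ler1n.
  move: h2 h3 h4; rewrite !ler_norml => /andP[? ?] /andP[? ?] /andP[? ?].
  by apply/andP; split; lra.
apply/matrixP => i j; rewrite ord1 [RHS]mxE mx_delta_entry trmx_delta mulmxA.
have -> : (delta_mx 0 0 : 'M[R]_1) = 1%:M by apply/matrixP => ? ?; rewrite !ord1 !mxE.
by rewrite mulmx1 -linE linC T.
Unshelve. all: by end_near.
Qed.

(** Each coordinate has its own set [K i] and C^1 function; on the intersection S all of them agree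
    with f, and S still has density 1 at x. There the distance estimate for f becomes a quadratic
    contact estimate for the C^1 map [G]. *)
Lemma ap_jacobian_rank (E : set V) (f : V -> H) x (A : 'M[R]_(k.+1, n.*2.+1)) :
  (0 < n)%N -> E x -> locally_lipschitz_cc E f -> ap_jacobian E f x A -> (\rank A <= n)%N.
Proof.
move=> n0 Ex lipf HA.
have /boolp.choice[K /boolp.choice[g Hg]] := HA.
pose G y : H := \row_i g i y.
pose S := \bigcap_i K i.
have dS : dense_at S x.
  by apply: dense_atI => i; have [_ mK _ _ [dK _]] := Hg i; exact: density_point_dense.
have fG z : S z -> f z = G z.
  by move=> Sz; apply/rowP => i; rewrite mxE; have [_ _ _ fg _] := Hg i; apply: fg; exact: Sz.
have SE : S `<=` E by move=> z /(_ ord0 I); have [KE _ _ _ _] := Hg ord0; exact: KE.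
have [r [L [r0 HL]]] := lipf x Ex.
(* |L| + 1 is positive and gives the strict inequality that [d_cc_bounds] needs. *)
pose L' := `|L| + 1.
have L'0 : 0 < L' by rewrite ltr_wpDl.
pose C := (4 * n)%:R * (L' * k.+1%:R) ^+ 2.
have C0 : 0 <= C by rewrite mulr_ge0// exprn_ge0// mulr_ge0// ltW.
have gA i : has_gradient (fun y => G y 0 i) x (\row_j A j i).
  have [_ _ [dg _] _ [_ dE]] := Hg i.
  rewrite (_ : (fun y => _) = g i); last by apply/funext => y; rewrite mxE.
  apply/has_gradientP; split=> // v; rewrite dE mxE linC.
  by apply: eq_bigr => j _; rewrite mxE.
have d0 : 0 < r / k.+1%:R by rewrite divr_gt0.
have [|AS AT] := contact_isotropic dS gA C0 d0; last exact: isotropic_rank AS AT.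
have inb z : `|z - x| < r / k.+1%:R -> eball x r z.
  rewrite ltr_pdivlMr// mulrC => zr; exact: le_lt_trans (enorm_le _) zr.
move=> z z' Sz Sz' /inb zx /inb zx'.
have [->|zz'] := eqVneq z' z.
  by rewrite !subrr normr0 expr2 !mulr0 /lin big1 ?normr0// => i _; rewrite [X in _ * X]mxE mulr0.
have nz : 0 < enorm (z - z').
  rewrite lt_neqAle enorm_ge0 andbT eq_sym; apply: contra_neq zz' => e0.
  apply/eqP; rewrite eq_sym -subr_eq0; apply/eqP/rowP => i; rewrite [RHS]mxE.
  by apply/eqP; rewrite -normr_eq0 eq_le normr_ge0 andbT -[leRHS]e0 ler_enorm.
have lt_d : (d_cc (f z) (f z') < (L' * enorm (z - z'))%:E)%E.
  apply: (le_lt_trans (HL z z' (SE _ Sz) (SE _ Sz') zx zx')).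
  by rewrite lte_fin ltr_pM2r// (le_lt_trans (ler_norm L))// ltrDl.
have [_] := d_cc_bounds n0 lt_d; rewrite -!fG// => /le_trans; apply.
rewrite /C -[leRHS]mulrA ler_wpM2l// -exprMn.
have L'0' := ltW L'0.
rewrite lerXn2r ?nnegrE ?mulr_ge0 ?enorm_ge0//.
by rewrite -[leRHS]mulrA ler_wpM2l// distrC enorm_le.
Qed.
End ContactIsotropic.

(** * Existence of the approximate derivative *)

Section ApproximateDifferentiability.
Context (R : realType) (k : nat).
Local Notation V := 'rV[R]_k.+2.
Local Notation outer := (@lebesgue_outer R k.+2).
Local Notation cara := (caratheodory_measurable outer).

(** A bad point lies in every [N j], hence in a null set, or it is a non-density point of some
    [K j], on which phi agrees with the C^1 function [g j]. *)
Lemma lipschitz_ap_differential (E P : set V) (phi : V -> R) (L r : R) :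
  P `<=` E -> cara P -> 0 <= L -> 0 <= r -> (forall x, P x -> `|x| <= r) ->
  (forall x y, P x -> P y -> `|phi x - phi y| <= L * `|x - y|) ->
  outer [set x | P x /\ ~ exists c, ap_differential E phi x (lin c)] = 0%E.
Proof.
move=> PE mP L0 r0 Pr philip.
have [F [FL Fphi]] := mcshane L0 philip.
have /boolp.choice[N /boolp.choice[g HN]] : forall j : nat, exists N g,
    [/\ (measurable : set (set (boxT R k.+2))) N, (outer N <= (j.+1%:R^-1)%:E)%E,
        C1 g & forall x, `|x| <= r -> ~ N x -> F x = g x].
  by move=> j; apply: (lusin_C1 FL _ r0); rewrite invr_gt0.
pose K j := P `\` N j.
have mK j : cara (K j).
  have [mN _ _ _] := HN j.
  by apply: (@caratheodory_measurable_setD _ _ outer) => //; exact: caratheodory_borel.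
apply: (@lebesgue_outer_null_sub _ _ _ ((\bigcap_j N j) `|`
    \bigcup_j [set x | K j x /\ ~ dense_at (K j) x])).
  move=> x [Px nd]; have [|nN] := pselect ((\bigcap_j N j) x); first by left.
  have [j Nj] : exists j, ~ N j x.
    by apply: contrapT => H; apply: nN => j _; apply: contrapT => Nj; apply: H; exists j.
  right; exists j => //; split; first by split.
  move=> dK; apply: nd; have [_ _ cg Fg] := HN j.
  exists (\row_i 'd (g j) x (delta_mx 0 i)), (K j), (g j); split=> //.
  - by move=> y [/PE].
  - by move=> y [Py Ny]; rewrite -Fphi// Fg//; exact: Pr.
  - by split; [exact: dense_density_point|move=> v; exact: lin_diff_gradient].
apply: lebesgue_outer_null_setU.
  apply/eqP; rewrite eq_le lebesgue_outer_ge0 andbT; apply/lee_addgt0Pr => e e0.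
  rewrite add0e; have [j je] := ltr_add_invr e0; rewrite add0r in je.
  have [_ Nj _ _] := HN j.
  apply: (@le_trans _ _ (outer (N j))); first by apply: le_lebesgue_outer => x; exact.
  by apply: (le_trans Nj); rewrite lee_fin ltW.
by apply: lebesgue_outer_null_bigcup => j; exact: lebesgue_density_rV.
Qed.

Lemma rat_approx m (x : 'rV[R]_m.+1) e : 0 < e ->
  exists q : 'rV[rat]_m.+1, `|map_mx ratr q - x| < e.
Proof.
move=> e0; have /boolp.choice[q Hq] : forall j, exists q : rat,
    x 0 j - e / 2 < ratr q < x 0 j + e / 2.
  move=> j; have /rat_in_itvoo[q qx] : x 0 j - e / 2 < x 0 j + e / 2 by lra.
  by exists q; move: qx; rewrite in_itv.
exists (\row_j q j); apply: (@le_lt_trans _ _ (e / 2)); last by lra.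
apply: ler_rVnorm => [|j]; first lra.
by rewrite !mxE ler_norml; have /andP[h1 h2] := Hq j; apply/andP; split; lra.
Qed.

(** Countably many pieces cover E: its intersections with balls of rational centre and radius 1 / (N
    + 1) on which phi is N-Lipschitz. Around a given x one N serves both purposes, once it is large
    against L and 1 / r. *)
Lemma locally_lipschitz_ap_differential (E : set V) (phi : V -> R) : cara E ->
  (forall x, E x -> exists r L : R, 0 < r /\ forall y z, E y -> E z ->
     `|y - x| < r -> `|z - x| < r -> `|phi y - phi z| <= L * `|y - z|) ->
  outer [set x | E x /\ ~ exists c, ap_differential E phi x (lin c)] = 0%E.
Proof.
move=> mE lphi.
pose Q (q : 'rV[rat]_k.+2) : V := map_mx ratr q.
pose P (i : 'rV[rat]_k.+2 * nat) := E `&` ball (Q i.1) (i.2.+1%:R^-1).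
pose good (i : 'rV[rat]_k.+2 * nat) := forall x y, P i x -> P i y ->
  `|phi x - phi y| <= i.2%:R * `|x - y|.
pose F i := [set x | good i /\ P i x /\ ~ exists c, ap_differential E phi x (lin c)].
apply: (@lebesgue_outer_null_sub _ _ _ (\bigcup_i F i)); last first.
  apply: lebesgue_outer_null_countable => i.
  have [gi|ngi] := pselect (good i); last first.
    by rewrite (_ : F i = set0) ?lebesgue_outer0//; apply/seteqP; split=> // x [].
  have PE : P i `<=` E by move=> x [].
  have mP : cara (P i).
    apply: (@caratheodory_measurable_setI _ _ outer) => //.
    by apply: caratheodory_borel; apply: borel_open; exact: ball_open.
  have bP x : P i x -> `|x| <= `|Q i.1| + i.2.+1%:R^-1.
    move=> [_]; rewrite -ball_normE/= => /ltW h.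
    rewrite -[x](subrK (Q i.1)) addrC; apply: (le_trans (ler_normD _ _)).
    by rewrite lerD2l distrC.
  have := lipschitz_ap_differential PE mP (ler0n R i.2) _ bP gi.
  rewrite (_ : [set x | _ /\ _] = F i); last by apply/seteqP; split=> x; [|case].
  by apply; rewrite addr_ge0// invr_ge0.
move=> x [Ex nd]; have [r [L [r0 HL]]] := lphi x Ex.
pose N := maxn (Num.truncn `|L|).+1 (Num.truncn (2 / r)).
have NL : L <= N%:R.
  apply: (le_trans (ler_norm L)); apply: ltW; apply: lt_le_trans (Num.Theory.truncnS_gt _) _.
  by rewrite ler_nat leq_maxl.
have Nr : 2 * N.+1%:R^-1 < r.
  rewrite ltr_pdivrMr// mulrC -ltr_pdivrMr//.
  by apply: lt_le_trans (Num.Theory.truncnS_gt _) _; rewrite ler_nat ltnS leq_maxr.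
have N0 : 0 < N.+1%:R^-1 :> R by rewrite invr_gt0.
have [q qx] := rat_approx x N0.
have inP y : P (q, N) y -> E y /\ `|y - x| < r.
  move=> [Ey]; rewrite -ball_normE/= => yq; split=> //.
  rewrite -(subrKA (Q q)); apply: (le_lt_trans (ler_normD _ _)).
  apply: lt_trans Nr; rewrite mulr_natl mulr2n; apply: ltrD => //.
  by rewrite distrC.
exists (q, N) => //; split; last by split=> //; split=> //; rewrite -ball_normE.
move=> y z /inP[Ey yx] /inP[Ez zx]; apply: (le_trans (HL y z Ey Ez yx zx)).
by rewrite ler_wpM2r.
Qed.

Lemma enormB m (x y : 'rV[R]_m) : enorm (x - y) = enorm (y - x).
Proof. by congr Num.sqrt; apply: eq_bigr => i _; rewrite !mxE -sqrrN opprB. Qed.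

(** The horizontal coordinates of f are locally Lipschitz at once. For the t coordinate, the contact
    estimate leaves an error of order D^2 and a sum of horizontal increments with coefficients
    bounded near x; since D is bounded there, all of it is O(D). *)
Lemma ap_jacobian_ae n (E : set V) (f : V -> 'rV[R]_(n.*2.+1)) : (0 < n)%N ->
  cara E -> locally_lipschitz_cc E f ->
  outer [set x | E x /\ ~ exists A : 'M[R]_(k.+2, n.*2.+1), ap_jacobian E f x A] = 0%E.
Proof.
move=> n0 mE lipf.
pose B (i : 'I_(n.*2.+1)) := [set x | E x /\
  ~ exists c, ap_differential E (fun y => f y 0 i) x (lin c)].
apply: (@lebesgue_outer_null_sub _ _ _ (\bigcup_i B i)).
  move=> x [Ex nA]; apply: contrapT => nB; apply: nA.
  have /boolp.choice[c Hc] : forall i, exists c,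
      ap_differential E (fun y => f y 0 i) x (lin c).
    by move=> i; apply: contrapT => H; apply: nB; exists i.
  exists (\matrix_(j, i) c i 0 j) => i.
  have [K [g [KE mK cg fg [dK dE]]]] := Hc i.
  exists K, g; split=> //; split=> // v; rewrite dE mxE linC.
  by apply: eq_bigr => j _; rewrite mxE.
apply: lebesgue_outer_null_countable => i.
apply: locally_lipschitz_ap_differential => // x Ex.
have [r [L [r0 HL]]] := lipf x Ex.
pose L' := `|L| + 1.
have L'0 : 0 < L' by rewrite ltr_wpDl.
have bd y z : E y -> E z -> eball x r y -> eball x r z -> y != z ->
    (d_cc (f y) (f z) < (L' * enorm (y - z))%:E)%E.
  move=> Ey Ez xy xz yz; apply: (le_lt_trans (HL y z Ey Ez xy xz)).
  rewrite lte_fin ltr_pM2r; first by rewrite (le_lt_trans (ler_norm L))// ltrDl.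
  rewrite lt_neqAle enorm_ge0 andbT eq_sym; apply: contra_neq yz => e0.
  apply/eqP; rewrite -subr_eq0; apply/eqP/rowP => j; rewrite [RHS]mxE.
  by apply/eqP; rewrite -normr_eq0 eq_le normr_ge0 andbT -[leRHS]e0 ler_enorm.
have K0 : 0 < k.+2%:R :> R by [].
pose Lx := L' * k.+2%:R.
have Lx0 : 0 <= Lx by rewrite mulr_ge0// ltW.
(* [Bd] bounds the horizontal coordinates of f near x. *)
pose Bd := `|f x| + L' * r.
have Bd0 : 0 <= Bd by rewrite addr_ge0// mulr_ge0// ltW.
exists (r / k.+2%:R), (Lx * (1 + (4 * n)%:R * (L' * (2 * r) + Bd))).
split; first by rewrite divr_gt0.
have inb z : `|z - x| < r / k.+2%:R -> eball x r z.
  rewrite ltr_pdivlMr// mulrC => zr; exact: le_lt_trans (enorm_le _) zr.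
have xx : eball x r x by apply: inb; rewrite subrr normr0 divr_gt0.
move=> z y Ez Ey zx yx; have [->|yz] := eqVneq y z.
  by rewrite !subrr !normr0 mulr0.
have xy := inb _ yx; have xz := inb _ zx.
have [co th] := d_cc_bounds n0 (bd _ _ Ey Ez xy xz yz).
set D := L' * enorm (y - z) in co th.
have D0 : 0 <= D by rewrite mulr_ge0 ?enorm_ge0// ltW.
have DL : D <= Lx * `|z - y|.
  by rewrite /D /Lx -mulrA ler_wpM2l ?(ltW L'0)// [leRHS]mulrC distrC mulrC enorm_le.
pose Ct := (4 * n)%:R * (L' * (2 * r) + Bd).
have Ct0 : 0 <= Ct.
  rewrite mulr_ge0// addr_ge0// mulr_ge0 ?mulr_ge0//; exact: ltW.
suff : `|f z 0 i - f y 0 i| <= D * (1 + Ct).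
  move=> /le_trans; apply; rewrite -/Ct [leRHS]mulrAC ler_wpM2r// addr_ge0//.
have fE j : f z 0 j - f y 0 j = (f z - f y) 0 j by rewrite !mxE.
have [it|it] := eqVneq i (t_idx n); last first.
  by rewrite fE (le_trans (co i it))// ler_peMr// lerDl.
have fB j : j != t_idx n -> `|f y 0 j| <= Bd.
  move=> jt; have [->|yx'] := eqVneq y x.
    by rewrite /Bd ler_wpDr ?ler_normrV// mulr_ge0// ltW.
  rewrite eq_sym in yx'; have [co' _] := d_cc_bounds n0 (bd _ _ Ex Ey xx xy yx').
  have := co' j jt; rewrite 2!mxE => h.
  rewrite -(subrK (f x 0 j) (f y 0 j)) addrC; apply: (le_trans (ler_normD _ _)).
  rewrite lerD ?ler_normrV//; apply: (le_trans h); rewrite ler_wpM2l ?(ltW L'0)//.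
  by rewrite enormB ltW.
have Dr : D <= L' * (2 * r).
  rewrite ler_wpM2l ?(ltW L'0)//; apply: (le_trans (enorm_le _)).
  rewrite mulrC -ler_pdivlMr// mulrAC -[leRHS]mulrA mulr_natl mulr2n.
  rewrite -(subrKA x); apply: (le_trans (ler_normD _ _)).
  by rewrite [_^-1 * r]mulrC; apply: lerD; apply: ltW => //; rewrite distrC.
rewrite it fE.
rewrite lin_theta in th.
rewrite -[X in `|X|](subrK (\sum_(j < n) 2 * (f y 0 (y_idx j) * (f z - f y) 0 (x_idx j) -
  f y 0 (x_idx j) * (f z - f y) 0 (y_idx j)))).
apply: (le_trans (ler_normD _ _)); apply: (le_trans (lerD th (ler_norm_sum _ _ _))).
apply: (@le_trans _ _ ((4 * n)%:R * D ^+ 2 + \sum_(j < n) 4 * (Bd * D))).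
  rewrite lerD2l; apply: ler_sum => j _; rewrite normrM gtr0_norm//.
  rewrite (_ : 4 = 2 * 2) -?mulrA; last by rewrite -natrM.
  rewrite ler_wpM2l// mulr_natl mulr2n; apply: (le_trans (ler_normB _ _)).
  by rewrite !normrM lerD// ler_pM// ?fB ?co ?idx_yt ?idx_xt.
rewrite sumr_const card_ord -[X in _ + X]mulr_natl.
have -> : (4 * n)%:R * D ^+ 2 + n%:R * (4 * (Bd * D)) = D * ((4 * n)%:R * (D + Bd)).
  by rewrite natrM; ring.
rewrite ler_wpM2l// ler_wpDl// ler_wpM2l// lerD2r//.
Qed.
End ApproximateDifferentiability.

Theorem theorem1p2 (R : realType) (k n : nat) (n_gt0 : (0 < n)%N)
    (n_lt_k : (n < k)%N) (E : set 'rV[R]_k)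
    (mE : caratheodory_measurable (@lebesgue_outer R k) E)
    (f : 'rV[R]_k -> 'rV[R]_(n.*2.+1))
    (lipf : @locally_lipschitz_cc R k n E f) :
  lebesgue_outer [set x | E x /\
    ~ ((exists A : 'M[R]_(k, n.*2.+1), ap_jacobian E f x A) /\
       (forall A : 'M[R]_(k, n.*2.+1), ap_jacobian E f x A ->
          (\rank A <= n)%N))] = 0%E.
Proof.
(* 0 < n < k leaves k >= 2, the dimensions in which null sets are tested by slicing. *)
case: k n_lt_k E mE f lipf => [|[|k]] n_lt_k E mE f lipf //.
  by move: n_lt_k; rewrite ltnS leqNgt n_gt0.
apply: lebesgue_outer_null_sub (ap_jacobian_ae n_gt0 mE lipf) => x [Ex bad].
split=> // - [A jA]; apply: bad; split; first by exists A.
by move=> B; exact: ap_jacobian_rank n_gt0 Ex lipf.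
Qed.
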